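(* Let $\mu = \exp(-V)\, dx$ be a log-concave probability measure having positive smooth density on $\mathbb{R}^d$. Then for any $f \in C^1(\mathbb{R}^d)$, $$\mathrm{Var}_{\mu}(f) \le C_{d} \int_{\mathbb{R}^d} \Big\langle \Big(D^2 V + \frac{1}{2d} \nabla V \otimes \nabla V \Big)^{-1} \nabla f, \nabla f \Big \rangle \, d \mu$$ with $C_d = 2$.
   Context: Derivatives and scalar products are Euclidean. $\mathrm{Var}_\mu(f) = \int f^2 d\mu - (\int f d\mu)^2$. The measure $\mu=\exp(-V)dx$ on $\mathbb{R}^d$ is log-concave if $V:\mathbb{R}^d\to\mathbb{R}$ is convex. For a positive semi-definite symmetric matrix $A$ which may be singular, $\langle A^{-1}v,v\rangle$ is understood as $\sup_{w\in\mathbb{R}^d}(2\langle v,w\rangle-\langle Aw,w\rangle)\in[0,+\infty]$, which equals $+\infty$ if $v$ is not in the range of $A$ and is the usual expression if $A$ is invertible. *)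

(* Defs.v *)
From HB Require Import structures.
From mathcomp Require Import all_boot all_order all_algebra.
From mathcomp Require Import all_classical all_reals all_analysis.

Set Implicit Arguments.
Unset Strict Implicit.
Unset Printing Implicit Defensive.

Import Order.TTheory GRing.Theory Num.Theory.
Import numFieldNormedType.Exports.

Local Open Scope classical_set_scope.
Local Open Scope ring_scope.

Definition measure_rV_display : measure_display -> measure_display.
Proof. exact. Qed.

(* The product sigma-algebra on row vectors, built as the library does for
   tuples; for entries in R : realType it is the Borel sigma-algebra of R^n. *)
Section measurable_rV.
Context {d} {T : sigmaRingType d}.
Variable n : nat.

Let coors : 'I_n -> 'rV[T]_n -> T := fun i x => x ord0 i.

Let rV_set0 : g_sigma_preimage coors set0.
Proof. exact: sigma_algebra0. Qed.

Let rV_setC A : g_sigma_preimage coors A -> g_sigma_preimage coors (~` A).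
Proof. exact: sigma_algebraC. Qed.

Let rV_bigcup (F : _^nat) : (forall i, g_sigma_preimage coors (F i)) ->
  g_sigma_preimage coors (\bigcup_i (F i)).
Proof. exact: sigma_algebra_bigcup. Qed.

HB.instance Definition _ := @isMeasurable.Build (measure_rV_display d)
  'rV[T]_n (g_sigma_preimage coors) rV_set0 rV_setC rV_bigcup.

End measurable_rV.

Lemma measurable_coord d (T : sigmaRingType d) n (i : 'I_n) :
  measurable_fun [set: 'rV[T]_n] (fun x : 'rV[T]_n => x ord0 i).
Proof.
move=> _ Y mY; rewrite setTI; apply: sub_sigma_algebra => /=.
rewrite -bigcup_seq/=; exists i => /=; first by rewrite mem_index_enum.
by exists Y => //; rewrite setTI.
Qed.

Lemma measurable_fun_rVP d1 d2 (T1 : measurableType d1) (T2 : measurableType d2)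
    n (f : T1 -> 'rV[T2]_n) :
  (forall i, measurable_fun [set: T1] (fun x => f x ord0 i)) ->
  measurable_fun [set: T1] f.
Proof.
move=> mf; have fS : g_sigma_preimage (fun i x => f x ord0 i) `<=` measurable.
  apply: smallest_sub; first exact: sigma_algebra_measurable.
  case: n => [|n] in f mf *; first by rewrite big_ord0.
  rewrite -bigcup_mkord_ord; apply: bigcup_sub => i Ii.
  by move=> A [B mB <-]; exact: mf.
rewrite (_ : g_sigma_preimage _ = preimage_set_system setT f
    (g_sigma_preimage (fun i (x : 'rV[T2]_n) => x ord0 i))) in fS; last first.
  exact: (g_sigma_preimage_comp (fun i (x : 'rV[T2]_n) => x ord0 i) f).
by move=> _ A mA; apply: fS; exists A.
Qed.

Section lebesgue_rV.
Context {R : realType}.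

Definition rV_cons n (p : measurableTypeR R * 'rV[R]_n) : 'rV[R]_n.+1 :=
  row_mx (const_mx p.1 : 'rV[R]_1) p.2.

Lemma rV_cons0 n (p : measurableTypeR R * 'rV[R]_n) : rV_cons p ord0 ord0 = p.1.
Proof.
rewrite (_ : rV_cons p ord0 ord0 = rV_cons p ord0 (@lshift 1 n ord0)).
  by apply: etrans (row_mxEl _ _ _ _) _; rewrite mxE.
by congr (rV_cons p _ _); exact: val_inj.
Qed.

Lemma rV_consS n (p : measurableTypeR R * 'rV[R]_n) i :
  rV_cons p ord0 (lift ord0 i) = p.2 ord0 i.
Proof.
rewrite (_ : rV_cons p ord0 _ = rV_cons p ord0 (@rshift 1 n i)).
  exact: row_mxEr.
by congr (rV_cons p _ _); exact: val_inj.
Qed.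

Lemma measurable_rV_cons n : measurable_fun setT (@rV_cons n).
Proof.
apply: measurable_fun_rVP => i; have [->|[j ->]] : i = ord0 \/
    exists j : 'I_n, i = lift ord0 j.
- by case: (unliftP ord0 i) => [j ->|->]; [right; exists j|left].
- rewrite (_ : (fun x => _) = fst); first exact: measurable_fst.
  by apply/funext => x; rewrite rV_cons0.
rewrite (_ : (fun x => _) = (fun v : 'rV[R]_n => v ord0 j) \o snd).
  by apply: measurableT_comp => //; exact: measurable_coord.
by apply/funext => x /=; rewrite rV_consS.
Qed.

Section succ.
Local Open Scope ereal_scope.
Variables (n : nat) (m : {sigma_finite_measure set 'rV[R]_n -> \bar R}).

Definition lebesgue_rVS : set 'rV[R]_n.+1 -> \bar R :=
  pushforward (lebesgue_measure \x m) (@rV_cons n).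

Let pushforward_measure : {measure set 'rV[R]_n.+1 -> \bar R} :=
  measure_function_pushforward__canonical__measure_function_Measure
    (lebesgue_measure \x m) (@measurable_rV_cons n).

HB.instance Definition _ := isMeasure.Build _ _ _ lebesgue_rVS
  (measure0 pushforward_measure) (measure_ge0 pushforward_measure)
  (@measure_semi_sigma_additive _ _ _ pushforward_measure).

Lemma lebesgue_rVSE A (B : set 'rV[R]_n) : measurable A -> measurable B ->
  lebesgue_rVS [set x | A (x ord0 ord0) /\ B (\row_i x ord0 (lift ord0 i))]
  = lebesgue_measure A * m B.
Proof.
move=> mA mB; rewrite -product_measure1E//; congr product_measure1.
apply/seteqP; split => -[x v] /=.
all: have <- : v = \row_i rV_cons (x, v) ord0 (lift ord0 i)
       by apply/rowP => i; rewrite mxE rV_consS.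
all: by rewrite rV_cons0.
Qed.

Let sigma_finite_lebesgue_rVS : sigma_finite setT lebesgue_rVS.
Proof.
have /sigma_finiteP[F [TF ndF Foo]] := sigma_finiteT (@lebesgue_measure R).
have /sigma_finiteP[G [TG ndG Goo]] := sigma_finiteT m.
pose tail (x : 'rV[R]_n.+1) : 'rV[R]_n := \row_i x ord0 (lift ord0 i).
have mtail : measurable_fun setT tail.
  apply: measurable_fun_rVP => i.
  rewrite (_ : (fun x => _) = fun x : 'rV[R]_n.+1 => x ord0 (lift ord0 i)).
    exact: measurable_coord.
  by apply/funext => x /=; rewrite mxE.
exists (fun k => (fun x : 'rV[R]_n.+1 => x ord0 ord0) @^-1` F k `&` tail @^-1` G k).
  apply/esym; rewrite -subTset => x _.
  have [i _ Fi] : (\bigcup_k F k) (x ord0 ord0) by rewrite -TF.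
  have [j _ Gj] : (\bigcup_k G k) (tail x) by rewrite -TG.
  exists (maxn i j) => //; split.
    by have /subsetPset := ndF _ _ (leq_maxl i j); exact.
  by have /subsetPset := ndG _ _ (leq_maxr i j); exact.
move=> k; have [mF Fkoo] := Foo k; have [mG Gkoo] := Goo k; split.
  apply: measurableI; rewrite -[X in measurable X]setTI; last exact: mtail.
  exact: measurable_coord.
by rewrite lebesgue_rVSE// lte_mul_pinfty// ge0_fin_numE.
Qed.

HB.instance Definition _ :=
  Measure_isSigmaFinite.Build _ _ _ lebesgue_rVS sigma_finite_lebesgue_rVS.

End succ.

(* Lebesgue measure on R^n, as the n-fold product of the one on R. *)
Fixpoint lebesgue_rV n : {sigma_finite_measure set 'rV[R]_n -> \bar R} :=
  if n is n'.+1 then lebesgue_rVS (lebesgue_rV n') else \d_(0 : 'rV[R]_0).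

Lemma lebesgue_rV_box n (A : 'I_n -> set R) : (forall i, measurable (A i)) ->
  lebesgue_rV n [set x | forall i, A i (x ord0 i)] =
  (\prod_(i < n) lebesgue_measure (A i))%E.
Proof.
elim: n A => [|n IH] A mA.
  rewrite big_ord0 /= diracE mem_set//=; by case.
rewrite big_ord_recl -IH//= -lebesgue_rVSE//; last first.
  rewrite [X in measurable X](_ : _ = \bigcap_(i in [set: 'I_n])
    ((fun x : 'rV[R]_n => x ord0 i) @^-1` A (lift ord0 i))).
    apply: fin_bigcap_measurable => // i _.
    by rewrite -[X in measurable X]setTI; exact: measurable_coord.
  by apply/seteqP; split => x /= h i; [move=> _|]; exact: h.
congr lebesgue_rVS; apply/seteqP; split => x /=.
  by move=> h; split => // i; rewrite mxE.
move=> [h0 hS] i; case: (unliftP ord0 i) => [j ->|->//].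
by have := hS j; rewrite mxE.
Qed.

End lebesgue_rV.

Section calculus.
Context {R : realType} {d : nat}.
Implicit Types f V : 'rV[R]_d -> R.

Definition partial (i : 'I_d) f : 'rV[R]_d -> R := 'D_(delta_mx ord0 i) f.

Definition gradient f x : 'rV[R]_d := \row_i partial i f x.

Definition hessian f x : 'M[R]_d := \matrix_(i, j) partial i (partial j f) x.

Fixpoint of_class_C (k : nat) f : Prop :=
  if k is k'.+1 then
    (forall x, differentiable f x) /\ (forall i, of_class_C k' (partial i f))
  else continuous f.

Definition smooth f : Prop := forall k, of_class_C k f.

Definition dot (u v : 'rV[R]_d) : R := \sum_i u ord0 i * v ord0 i.

Definition tensor (u v : 'rV[R]_d) : 'M[R]_d := u^T *m v.

(* <A^-1 v, v> for a positive semi-definite, possibly singular A. The vector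
   A w is written (A *m w^T)^T since vectors are rows. *)
Definition inv_quad (A : 'M[R]_d) (v : 'rV[R]_d) : \bar R :=
  ereal_sup [set (2 * dot v w - dot (A *m w^T)^T w)%:E | w in [set: 'rV[R]_d]].

Definition has_density (mu : set 'rV[R]_d -> \bar R) (rho : 'rV[R]_d -> R) :=
  forall A, measurable A -> mu A = (\int[lebesgue_rV d]_(x in A) (rho x)%:E)%E.

End calculus.

(* Main.v *)
(* Put b = 2d and phi = exp(V/b), which is convex with Hessian
   (phi/b) (D^2 V + b^-1 grad V (x) grad V), so that exp(-V) = phi^-2d. Since
   the integral of s^(2d-1) exp(-s phi) over s > 0 is (2d-1)! phi^-2d, mu is up
   to a constant the x-marginal of s^(2d-1) exp(-s phi(x)) ds dx. In the
   variables (s, y = s x) this is the density s^(d-1) exp(-s phi(y/s)), which is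
   log-concave because the perspective s phi(y/s) of phi is convex.
   A Brascamp-Lieb inequality for functions of x alone on this cone follows from
   the Prekopa-Leindler inequality for the weights w exp(tau f) and
   w exp(-tau f), expanded to second order in tau; only the x-block of the
   Hessian of the perspective enters, which is s^-1 D^2 phi in the variable y.
   The expansion is made on truncated cones with an extra uniformly convex term
   eps/2 (|y|^2/s + s^2), and the truncation is removed by monotone convergence.
   Integrating s out turns the factor 1/s into phi/(2d-1), whence the constant
   2d/(2d-1) <= 2. *)
Require Import Defs.
From HB Require Import structures.
From mathcomp Require Import all_boot all_order all_algebra.
From mathcomp Require Import all_classical all_reals all_analysis.
From mathcomp Require Import measurable_realfun.
From mathcomp Require Import ring lra.

Set Implicit Arguments.
Unset Strict Implicit.
Unset Printing Implicit Defensive.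

Import Order.TTheory GRing.Theory Num.Theory.
Import numFieldNormedType.Exports.

Local Open Scope classical_set_scope.
Local Open Scope ring_scope.

(** * The Prekopa-Leindler inequality *)

(** The lift works because of homogeneity. The perspective is linear along rays of the (s, y) space,
    so its Hessian degenerates in the radial direction; but f(y/s) is constant along rays, so its
    gradient vanishes on that same direction. The dual quadratic form of f(y/s) is therefore s^-1
    times the dual form of D^2 phi at grad f, with nothing infinite coming from the degeneracy. No
    sup-convolution is computed. The third function is guessed, w exp(tau^2 g) with g = (q +
    del)/(2s), where q is the dual form of D^2 phi + (eps/2) Id, and the hypothesis is verified
    pointwise for every small tau. The threshold on tau must be uniform over all pairs of points,
    whence the compact boxes. The eps term serves three times: it makes q finite and bounded, it
    absorbs Taylor errors, and it controls pairs that are far apart. The slack del takes the errors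
    of order tau^2 and then tends to 0. A further obstacle is that f is an arbitrary C^1 function,
    possibly outside L^2(mu). On a box everything is bounded, and square integrability is deduced
    from the uniform variance bounds when the right-hand side is finite. *)

Lemma lebesgue_measure_affine (R : realType) (c e : R) (A : set R) :
  0 < c -> measurable A ->
  (lebesgue_measure ((fun x => c * x + e)%R @^-1` A) = (c^-1)%:E * lebesgue_measure A)%E.
Proof.
move=> c0 mA.
have mf : measurable_fun [set: measurableTypeR R]
    ((fun x => c * x + e) : measurableTypeR R -> measurableTypeR R).
  by apply: measurable_funD => //; apply: measurable_funM.
pose ci : {nonneg R} := NngNum (ltW c0).
pose pm : {measure set (measurableTypeR R) -> \bar R} :=
  measure_function_pushforward__canonical__measure_function_Measure lebesgue_measure mf.
(* Half-open intervals determine Lebesgue measure, so comparing it there with [c] times the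
   pushforward is enough. *)
have H : forall X, ocitv X -> lebesgue_measure X = mscale ci pm X.
  move=> _ [[a b]] _ <-; rewrite /mscale /= /pushforward.
  rewrite (_ : _ @^-1` _ = `](a - e) / c, (b - e) / c]%classic); last first.
    apply/seteqP; split => x /=; rewrite !in_itv /= => /andP[h1 h2]; apply/andP; split.
    - by rewrite ltr_pdivrMr// mulrC; lra.
    - by rewrite ler_pdivlMr// mulrC; lra.
    - by move: h1; rewrite ltr_pdivrMr// mulrC; lra.
    - by move: h2; rewrite ler_pdivlMr// mulrC; lra.
  rewrite !lebesgue_measure_itv/= !lte_fin ltr_pM2r ?invr_gt0//.
  have -> : (a - e < b - e) = (a < b) by lra.
  case: ifPn => ab; last by rewrite mule0.
  rewrite -!EFinD -EFinM; congr EFin; field; lra.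
rewrite (lebesgue_measure_unique H mA) /mscale /= muleA -EFinM mulVf ?mul1e//.
by rewrite gt_eqF.
Qed.

(** Provides cut points below the supremum of a set and truncation levels below the supremum of a
    function. They stay strictly below [x], so that some point of the set, or value of the function,
    lies above each of them. An infinite [x] needs its own formula. *)
Lemma ereal_lt_approx (R : realType) (x : \bar R) (y : R) : (y%:E < x)%E ->
  exists a : nat -> R, [/\ {homo a : i j / (i <= j)%N >-> i <= j},
    forall k, y < a k, forall k, ((a k)%:E < x)%E &
    forall z : R, (z%:E < x)%E -> exists k, z < a k].
Proof.
case: x => [r| |//]; last first.
  move=> _; exists (fun k => y + k.+1%:R); split => [i j ij|k|k|z _].
  - by rewrite lerD2l ler_nat.
  - by rewrite ltrDl.
  - exact: ltry.
  - exists (Num.truncn `|z - y|).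
    by rewrite -ltrBlDl (le_lt_trans (ler_norm _))// truncnS_gt.
rewrite lte_fin => yr; exists (fun k => r - (r - y) / k.+2%:R); split => [i j ij|k|k|z].
- rewrite lerD2l lerN2 ler_pM2l ?subr_gt0// lef_pV2 ?posrE//.
  by rewrite ler_nat.
- by rewrite ltrBrDl -ltrBrDr ltr_pdivrMr// ltr_pMr ?subr_gt0// ltr1n.
- by rewrite lte_fin gtrDl oppr_lt0 divr_gt0// subr_gt0.
- rewrite lte_fin => zr; exists (Num.truncn ((r - y) / (r - z))).
  rewrite ltrBrDl -ltrBrDr ltr_pdivrMr// mulrC -ltr_pdivrMr ?subr_gt0//.
  by rewrite (lt_trans (truncnS_gt _))// ltr_nat.
Qed.

(** * Layer-cake formula with normalised levels *)

Section layer_cake.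
Local Open Scope ereal_scope.
Context d (T : measurableType d) (R : realType).
Variable m : {sigma_finite_measure set T -> \bar R}.

Lemma measurable_hypograph (u : T -> \bar R) (a : R) :
  measurable_fun setT u -> (forall x, 0 <= u x) ->
  measurable [set p : T * measurableTypeR R | (p.2 * a)%:E < u p.1].
Proof.
move=> mu u0.
rewrite (_ : [set _ | _] =
  (fun p : T * measurableTypeR R => (p.2 * a)%:E - u p.1) @^-1` `]-oo, 0[ ); last first.
  apply/seteqP; split => -[x t] /=; rewrite in_itv/=;
    case: (u x) (u0 x) => [r|//|//] _ /=; rewrite ?ltNyr ?ltry//.
    by rewrite -EFinB !lte_fin subr_lt0.
  by rewrite -EFinB !lte_fin subr_lt0.
rewrite -[X in measurable X]setTI; apply: emeasurable_funB => //; [|idtac|exact: emeasurable_itv].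
- by apply/measurable_EFinP; apply: measurable_funM => //; exact: measurable_snd.
- by apply: measurableT_comp => //; exact: measurable_fst.
Qed.

Lemma measurable_superlevel (u : T -> \bar R) (a : R) :
  measurable_fun setT u -> (forall x, 0 <= u x) ->
  measurable_fun setT (fun t : measurableTypeR R => m [set x | (t * a)%:E < u x]).
Proof.
move=> mu u0; have := measurable_fun_ysection m (measurable_hypograph a mu u0).
congr measurable_fun; apply/funext => t /=; congr (m _).
by apply/seteqP; split => x; rewrite /ysection /= inE.
Qed.

(** Tonelli on the hypograph. Levels are written [t * a] with [t] in the unit interval, so that two
    functions capped at different heights can be compared at the same [t]. *)
Lemma layer_cake (u : T -> \bar R) (a : R) : measurable_fun setT u ->
  (forall x, 0 <= u x) -> (0 < a)%R ->
  \int[m]_x mine (u x) a%:E =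
  a%:E * \int[lebesgue_measure]_(t in `]0%R, 1%R[) m [set x | (t * a)%:E < u x].
Proof.
move=> mu u0 a0.
pose S : set (T * measurableTypeR R) := [set p | (p.2 * a)%:E < u p.1].
have mS : measurable S by exact: measurable_hypograph.
pose D : set (measurableTypeR R) := `]0%R, 1%R[%classic.
pose F (p : T * measurableTypeR R) : \bar R :=
  (\1_S p * \1_D p.2)%:E.
have mF : measurable_fun setT F.
  apply/measurable_EFinP; apply: measurable_funM.
    by apply: measurable_indic; exact: mS.
  have mD : measurable D by exact: measurable_itv.
  exact: (measurableT_comp (measurable_indic mD) measurable_snd).
have F0 p : 0 <= F p by rewrite lee_fin mulr_ge0.
have -> : \int[lebesgue_measure]_(t in `]0%R, 1%R[) m [set x | (t * a)%:E < u x]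
   = \int[lebesgue_measure]_t \int[m]_x F (x, t).
  rewrite [LHS]integral_mkcond; apply: eq_integral => t _.
  rewrite patchE; case: ifPn => tD.
    rewrite /F /= [\1_D t]indicE tD.
    under eq_integral do rewrite mulr1.
    have mU : measurable [set x | (t * a)%:E < u x].
      by rewrite -[X in measurable X]setTI; exact: emeasurable_fun_o_infty.
    rewrite -[X in m X]setIT -integral_indic//.
  rewrite /F /= [\1_D t]indicE (negbTE tD).
  by under eq_integral do rewrite mulr0; rewrite integral0.
rewrite -(fubini_tonelli F mF F0).
rewrite -ge0_integralZl//; last 3 first.
  - exact: (measurable_fun_fubini_tonelli_F F mF F0).
  - by move=> x _; apply: integral_ge0 => t _; exact: F0.
  - by rewrite lee_fin ltW.
apply: eq_integral => x _.
have min0 : 0 <= mine (u x) a%:E by rewrite le_min u0 lee_fin ltW.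
have minf : mine (u x) a%:E \is a fin_num by rewrite ge0_fin_numE// gt_min ltry orbT.
have minE t : (t * a < fine (mine (u x) a%:E))%R = ((t * a)%:E < u x) && (t < 1)%R.
  by rewrite -lte_fin fineK// lt_min lte_fin gtr_pMl.
transitivity (a%:E * lebesgue_measure (D `&` [set t : measurableTypeR R | (t * a)%:E < u x])).
  have -> : D `&` [set t : measurableTypeR R | (t * a)%:E < u x]
    = `]0%R, (fine (mine (u x) a%:E) / a)%R[%classic.
    apply/seteqP; split => t /=; rewrite /D /= !in_itv/= ltr_pdivlMr// minE.
      by move=> [/andP[-> ->] ->].
    by move=> /andP[-> /andP[-> ->]].
  rewrite lebesgue_measure_itv/= lte_fin.
  case: ifPn => h; last first.
    rewrite mule0; apply/eqP; rewrite eq_le min0 andbT -[X in X <= _]fineK// lee_fin.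
    by move: h; rewrite -leNgt pmulr_lle0 ?invr_gt0.
  by rewrite oppr0 adde0 -EFinM mulrC divfK ?gt_eqF// fineK.
have mV : measurable (D `&` [set t : measurableTypeR R | (t * a)%:E < u x]).
  apply: measurableI; first exact: measurable_itv.
  have := measurable_xsection x mS.
  by congr measurable; apply/seteqP; split => t; rewrite /xsection /= inE.
congr (_ * _); rewrite -[X in lebesgue_measure X]setIT -integral_indic//.
apply: eq_integral => t _; congr EFin.
by rewrite !indicE in_setI mulrC -natrM mulnb.
Qed.
End layer_cake.

(** * One-dimensional Brunn-Minkowski inequality *)

Section brunn_minkowski.
Local Open Scope ereal_scope.
Context (R : realType).
Notation leb := (@lebesgue_measure R).

(** Cutting at points of [A] that increase to its supremum exhausts [A] except perhaps for the
    supremum itself, a single null point. This covers the case where the supremum is not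
    attained. *)
Lemma lebesgue_measure_cutl (A : set R) (M : \bar R) : measurable A -> 0 <= M ->
  (forall a, A a -> leb (A `&` `]-oo, a[) <= M) -> leb A <= M.
Proof.
move=> mA M0 H.
have [->|/set0P[x0 Ax0]] := eqVneq A set0; first by rewrite measure0.
pose S := ereal_sup (EFin @` A).
have ubS x : A x -> x%:E <= S by move=> Ax; apply: ereal_sup_ubound; exists x.
have x0S : (x0 - 1)%:E < S.
  by apply: lt_le_trans (ubS _ Ax0); rewrite lte_fin gtrDl oppr_lt0.
have [a [nda _ aS Sa]] := ereal_lt_approx x0S.
pose F k := A `&` `]-oo, a k[.
have mF k : measurable (F k) by apply: measurableI => //; exact: measurable_itv.
have Fle k : leb (F k) <= M.
  have [_ [b Ab <-] ab] := ereal_sup_gt (aS k).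
  apply: le_trans (H b Ab); apply: le_measure; rewrite ?inE; first exact: mF.
    by apply: measurableI => //; exact: measurable_itv.
  apply: setIS => t /=; rewrite !in_itv/= => /lt_trans; apply.
  by rewrite -lte_fin.
have mU : measurable (\bigcup_k F k) by exact: bigcup_measurable.
have Ule : leb (\bigcup_k F k) <= M.
  have ndF : {homo F : n m / (n <= m)%N >-> (n <= m)%O}.
    move=> n m nm; apply/subsetPset; apply: setIS => t /=.
    by rewrite !in_itv/= => /lt_le_trans; apply; exact: nda.
  have /cvg_lim <- // := nondecreasing_cvg_mu (mu := leb) mF mU ndF.
  apply: lime_le; last by apply: nearW => k; exact: Fle.
  by apply/cvg_ex; eexists; exact: nondecreasing_cvg_mu.
have -> : leb A = leb (A `\` \bigcup_k F k) + leb (A `&` \bigcup_k F k) :=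
  measureDI leb mA mU.
have -> : A `&` \bigcup_k F k = \bigcup_k F k.
  by apply/setIidr => x [k _ []].
suff -> : leb (A `\` \bigcup_k F k) = 0 by rewrite add0e.
apply/eqP; rewrite eq_le measure_ge0 andbT.
rewrite -(lebesgue_measure_set1 (fine S)); apply: le_measure; rewrite ?inE//.
  exact: measurableD.
move=> x [Ax nUx] /=.
have : ~~ (x%:E < S).
  apply/negP => /Sa [k xk]; apply: nUx; exists k => //; split => //=.
rewrite -leNgt => Sx; have -> // : S = x%:E.
by apply/eqP; rewrite eq_le Sx ubS.
Qed.

Lemma lebesgue_measure_cutr (A : set R) (M : \bar R) : measurable A -> 0 <= M ->
  (forall a, A a -> leb (A `&` `]a, +oo[) <= M) -> leb A <= M.
Proof.
move=> mA M0 H; rewrite -lebesgue_measureN// /pushforward.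
have mN (B : set R) : measurable B -> measurable (-%R @^-1` B : set R).
  by move=> mB; rewrite -[X in measurable X]setTI; exact: oppr_measurable.
apply: lebesgue_measure_cutl => //; first exact: mN.
move=> a /= /H; rewrite -lebesgue_measureN; last first.
  by apply: measurableI => //; exact: measurable_itv.
congr (leb _ <= M); apply/seteqP; split => x /= [? ]; rewrite !in_itv/= ?andbT ltrN2//.
Qed.

(** For [a] in [A] and [b] in [B], half of the part of [A] below [a] shifted by [b], and half of the
    part of [B] above [b] shifted by [a], both lie in [C] and are separated by the midpoint of [a]
    and [b]. Their measures add up; then [a] and [b] are moved to the ends, one after the other. A
    measurable [C] containing the midpoints avoids any measurability question about a sumset. *)
Lemma brunn_minkowski (A B C : set R) :
  measurable A -> measurable B -> measurable C -> A !=set0 -> B !=set0 ->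
  (forall x y, A x -> B y -> C ((x + y) / 2)%R) ->
  leb A + leb B <= 2%:E * leb C.
Proof.
move=> mA mB mC [a0 Aa0] [b0 Bb0] ABC.
have C20 : 0 <= 2%:E * leb C by rewrite mule_ge0.
have [->|Coo] := eqVneq (leb C) +oo; first by rewrite gt0_muley ?lte_fin// leey.
have Cfin : leb C \is a fin_num by rewrite ge0_fin_numE// ltey.
have step a b : A a -> B b ->
    leb (A `&` `]-oo, a[) + leb (B `&` `]b, +oo[) <= 2%:E * leb C.
  move=> Aa Bb.
  pose A1 := (fun x => 2 * x - b)%R @^-1` (A `&` `]-oo, a[).
  pose B1 := (fun x => 2 * x - a)%R @^-1` (B `&` `]b, +oo[).
  have mAa : measurable (A `&` `]-oo, a[).
    by apply: measurableI => //; exact: measurable_itv.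
  have mBb : measurable (B `&` `]b, +oo[).
    by apply: measurableI => //; exact: measurable_itv.
  have mpre (c : R) (D : set R) : measurable D -> measurable ((fun x => 2 * x - c)%R @^-1` D).
    move=> mD; rewrite -[X in measurable X]setTI.
    have : measurable_fun setT (fun x : R => 2 * x - c)%R.
      by apply: measurable_funB => //; exact: measurable_funM.
    exact.
  have h : leb (A1 `|` B1) <= leb C.
    apply: le_measure; rewrite ?inE//; first by apply: measurableU; exact: mpre.
    move=> x [[/= Ax _]|[/= Bx _]].
      by have := ABC _ _ Ax Bb; rewrite subrK mulrC mulKf.
    by have := ABC _ _ Aa Bx; rewrite addrC subrK mulrC mulKf.
  rewrite measureU in h; last 3 first.
  - exact: mpre.
  - exact: mpre.
  - apply/seteqP; split => // x [[_ /=]] + [_ /=].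
    by rewrite !in_itv/= andbT => h1 h2; clear -h1 h2; lra.
  have : 2%:E * (2^-1%:E * leb (A `&` `]-oo, a[) + 2^-1%:E * leb (B `&` `]b, +oo[)) <=
      2%:E * leb C.
    rewrite lee_pmul2l// -(lebesgue_measure_affine (- b))//.
    by rewrite -(lebesgue_measure_affine (- a) _ mBb).
  by rewrite -ge0_muleDr// muleA -EFinM mulfV ?mul1e.
have C2fin : 2%:E * leb C \is a fin_num by rewrite fin_numM.
have step2 b : B b -> leb A + leb (B `&` `]b, +oo[) <= 2%:E * leb C.
  move=> Bb; have hb : leb (B `&` `]b, +oo[) \is a fin_num.
    rewrite ge0_fin_numE// (@le_lt_trans _ _ (2%:E * leb C))//; last first.
      by rewrite -ge0_fin_numE.
    by apply: le_trans (step _ _ Aa0 Bb); rewrite leeDr.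
  rewrite -leeBrDr//; apply: lebesgue_measure_cutl => //.
    by rewrite leeBrDr// add0e (le_trans _ (step _ _ Aa0 Bb))// leeDr.
  by move=> a Aa; rewrite leeBrDr// step.
have hA : leb A \is a fin_num.
  rewrite ge0_fin_numE// (@le_lt_trans _ _ (2%:E * leb C))//; last first.
    by rewrite -ge0_fin_numE.
  by apply: le_trans (step2 _ Bb0); rewrite leeDl.
rewrite addeC -leeBrDr//; apply: lebesgue_measure_cutr => //.
  by rewrite leeBrDr// add0e (le_trans _ (step2 _ Bb0))// leeDl.
by move=> b Bb; rewrite leeBrDr// addeC step2.
Qed.
End brunn_minkowski.

(** Passage to the supremum in one factor of a product of extended reals. The supremum enters only
    through its least-upper-bound property, and the products of 0 with infinity are settled by
    cases. *)
Lemma lee_mul_of_ub (R : realType) (x : nat -> \bar R) (X y m : \bar R) :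
  (forall k, 0 <= x k)%E -> (0 <= X)%E -> (0 <= y)%E ->
  (forall N, (forall k, x k <= N) -> X <= N)%E ->
  (forall k, x k * y <= m)%E -> (X * y <= m)%E.
Proof.
move=> x0 X0 y0 Xle xym.
case: m xym => [m|_|/(_ 0%N)]; last first.
- by rewrite leeNy_eq => /eqP h; have := mule_ge0 (x0 0%N) y0; rewrite h.
- by rewrite leey.
case: y y0 => [y y0 xym|_ xym|//].
  move: y0 xym; rewrite lee_fin le_eqVlt => /predU1P[<- xym|y0 xym].
    by have := xym 0%N; rewrite !mule0.
  by rewrite -lee_pdivlMr//; apply: Xle => k; rewrite lee_pdivlMr.
have X00 : (X <= 0)%E.
  apply: Xle => k; rewrite leNgt; apply/negP => xk.
  by have := xym k; rewrite gt0_muley// leye_eq.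
have -> : X = 0%E by apply/eqP; rewrite eq_le X0 X00.
rewrite mul0e; have := xym 0%N; apply: le_trans; exact: mule_ge0.
Qed.

(** * One-dimensional Prekopa-Leindler inequality *)

Section prekopa_leindler1.
Local Open Scope ereal_scope.
Context (R : realType).
Notation leb := (@lebesgue_measure R).

Let half_sum (U V H : \bar R) : 0 <= U -> 0 <= V -> 0 <= H ->
  U + V <= 2%:E * H -> U * V <= H ^+ 2.
Proof.
case: H => [h|_ _ _ _|//]; last by rewrite leey.
case: U => [u|//|//]; last by move=> _ /[swap] _; case: V.
case: V => [v|//|//]; rewrite -EFinD -!EFinM !lee_fin => u0 v0 h0 le.
have := ler_pM (addr_ge0 u0 v0) (addr_ge0 u0 v0) le le.
have := sqr_ge0 (u - v)%R; rewrite expr2; lra.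
Qed.

(** Brunn-Minkowski needs nonempty sets. Capping [u] and [v] at heights that they reach makes the
    superlevel sets at [t * a] and [t * b] nonempty for every [t] below 1. The matching height for
    [h] is the geometric mean of [a] and [b], and the resulting sum of integrals is turned into a
    product by the arithmetic-geometric inequality. *)
Let truncated (u v h : R -> \bar R) (a b : R) :
  measurable_fun setT u -> measurable_fun setT v -> measurable_fun setT h ->
  (forall x, 0 <= u x) -> (forall x, 0 <= v x) -> (forall x, 0 <= h x) ->
  (0 < a)%R -> (0 < b)%R -> (exists x, a%:E <= u x) -> (exists x, b%:E <= v x) ->
  (forall x y, u x * v y <= h ((x + y) / 2)%R ^+ 2) ->
  (\int[leb]_x mine (u x) a%:E) * (\int[leb]_x mine (v x) b%:E)
   <= (\int[leb]_x h x) ^+ 2.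
Proof.
move=> mu mv mh u0 v0 h0 a0 b0 [x0 ux0] [y0 vy0] uvh.
pose c := Num.sqrt (a * b).
have ab0 : (0 < a * b)%R by rewrite mulr_gt0.
have c0 : (0 < c)%R by rewrite sqrtr_gt0.
have c2 : (c * c = a * b)%R by rewrite -expr2 sqr_sqrtr// ltW.
have hc : \int[leb]_x mine (h x) c%:E <= \int[leb]_x h x.
  apply: ge0_le_integral => //.
  - by move=> x _; rewrite le_min h0 lee_fin ltW.
  - by apply: measurable_mine => //; exact: measurable_cst.
  - by move=> x _; rewrite ge_min lexx.
have hc0 : 0 <= \int[leb]_x mine (h x) c%:E.
  by apply: integral_ge0 => x _; rewrite le_min h0 lee_fin ltW.
apply: (@le_trans _ _ ((\int[leb]_x mine (h x) c%:E) ^+ 2)); last first.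
  by rewrite lee_sqr// integral_ge0.
rewrite !layer_cake//.
set U := \int[_]_(_ in _) _; set V := \int[_]_(_ in _) _.
set H := \int[_]_(_ in _) _.
rewrite muleACA -EFinM expe2 muleACA -EFinM c2.
rewrite lee_pmul2l//.
have mI : measurable (`]0%R, 1%R[%classic : set (measurableTypeR R)) by exact: measurable_itv.
have mS (w : R -> \bar R) e : measurable_fun setT w -> (forall x, 0 <= w x) ->
  measurable_fun (`]0%R, 1%R[ : set (measurableTypeR R))
    (fun t : measurableTypeR R => leb [set x | (t * e)%:E < w x]).
  move=> mw w0; apply: (measurable_funS measurableT) => //.
  exact: measurable_superlevel.
have mset (w : R -> \bar R) e : measurable_fun setT w -> measurable [set x | e%:E < w x].
  by move=> mw; rewrite -[X in measurable X]setTI; exact: emeasurable_fun_o_infty.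
apply: half_sum; try by apply: integral_ge0.
rewrite -ge0_integralD//; [|exact: mS|exact: mS].
rewrite -ge0_integralZl//; last exact: mS.
apply: ge0_le_integral => //.
- by move=> t _; rewrite adde_ge0.
- by apply: emeasurable_funD; exact: mS.
- by apply: measurable_funeM; exact: mS.
move=> t; rewrite /= in_itv/= => /andP[t0 t1].
have lt1 e : (0 < e)%R -> (t * e < e)%R by move=> e0; rewrite gtr_pMl.
apply: brunn_minkowski; [exact: mset|exact: mset|exact: mset|exists x0|exists y0|].
- by apply: lt_le_trans ux0; rewrite lte_fin lt1.
- by apply: lt_le_trans vy0; rewrite lte_fin lt1.
move=> x y /= ux vy; rewrite ltNge; apply/negP => hle.
have : (t * c * (t * c))%:E < h ((x + y) / 2)%R ^+ 2.
  apply: lt_le_trans (uvh x y).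
  have -> : (t * c * (t * c) = (t * a) * (t * b))%R by rewrite mulrACA c2; ring.
  by rewrite EFinM lte_pmul// lee_fin mulr_ge0// ltW.
apply/negP; rewrite -leNgt expe2 EFinM; apply: lee_pmul => //.
Qed.

(** The levels increase to the supremum of [u] while remaining reached by it, so the caps satisfy
    the requirements of [truncated] and monotone convergence recovers the whole integral. *)
Let int_mine (u : R -> \bar R) (x0 : R) :
  measurable_fun setT u -> (forall x, 0 <= u x) -> 0 < u x0 ->
  exists a : nat -> R, [/\ forall k, (0 < a k)%R, forall k, exists x, (a k)%:E <= u x &
   forall N, (forall k, \int[leb]_x mine (u x) (a k)%:E <= N) ->
    \int[leb]_x u x <= N].
Proof.
move=> mu u0 ux0.
pose S := ereal_sup (range u).
have uS x : u x <= S by apply: ereal_sup_ubound; exists x.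
have S0 : 0%:E < S by exact: lt_le_trans (uS x0).
have [a [nda a0 aS Sa]] := ereal_lt_approx S0.
exists a; split => // [k|N H].
  by have [_ [x _ <-] h] := ereal_sup_gt (aS k); exists x; exact: ltW.
pose g k x := mine (u x) (a k)%:E.
have cvg_g x : g ^~ x @ \oo --> u x.
  have nd : nondecreasing_seq (g ^~ x).
    by move=> i j ij; rewrite /g le_min ge_min lexx/= ge_min lee_fin nda// orbT.
  have := ereal_nondecreasing_cvgn nd.
  suff -> : ereal_sup (range (g ^~ x)) = u x by [].
  apply/eqP; rewrite eq_le; apply/andP; split.
    by apply: ge_ereal_sup => _ [k _ <-]; rewrite ge_min lexx.
  rewrite leNgt; apply/negP => hlt.
  have gk k : g k x < u x by apply: le_lt_trans hlt; apply: ereal_sup_ubound; exists k.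
  have ak k : (a k)%:E < u x by have := gk k; rewrite gt_min ltxx.
  have : ereal_sup (range (g ^~ x)) < S by exact: lt_le_trans (uS x).
  have s0 : (a 0%N)%:E <= ereal_sup (range (g ^~ x)).
    by apply: ereal_sup_ubound; exists 0%N => //; rewrite /g min_r// ltW.
  case E : (ereal_sup _) s0 => [r| |//] _; last by rewrite ltNge leey.
  move=> /Sa [k rk]; have : (a k)%:E <= r%:E.
    by rewrite -E; apply: ereal_sup_ubound; exists k => //; rewrite /g min_r// ltW.
  by rewrite lee_fin leNgt rk.
have -> : \int[leb]_x u x = \int[leb]_x limn (g ^~ x).
  by apply: eq_integral => x _; apply/esym/cvg_lim.
rewrite monotone_convergence//.
- apply: lime_le; last by apply: nearW => k; exact: H.
  apply: ereal_nondecreasing_is_cvgn => i j ij; apply: ge0_le_integral => //.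
  + by move=> x _; rewrite le_min u0 lee_fin ltW.
  + by apply: measurable_mine => //; exact: measurable_cst.
  + by apply: measurable_mine => //; exact: measurable_cst.
  + by move=> x _; rewrite /g le_min ge_min lexx/= ge_min lee_fin nda// orbT.
- by move=> k; apply: measurable_mine => //; exact: measurable_cst.
- by move=> k x _; rewrite le_min u0 lee_fin ltW.
- by move=> x _ i j ij; rewrite /g le_min ge_min lexx/= ge_min lee_fin nda// orbT.
Qed.

Lemma prekopa_leindler1 (u v h : R -> \bar R) :
  measurable_fun setT u -> measurable_fun setT v -> measurable_fun setT h ->
  (forall x, 0 <= u x) -> (forall x, 0 <= v x) -> (forall x, 0 <= h x) ->
  (forall x y, u x * v y <= h ((x + y) / 2)%R ^+ 2) ->
  (\int[leb]_x u x) * (\int[leb]_x v x) <= (\int[leb]_x h x) ^+ 2.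
Proof.
move=> mu mv mh u0 v0 h0 uvh.
have H0 : 0 <= (\int[leb]_x h x) ^+ 2 by apply: sqre_ge0.
have [[x0 ux0]|nu] := pselect (exists x, 0 < u x); last first.
  rewrite (@integral0_eq _ _ _ leb setT u) ?mul0e// => x _.
  apply/eqP; rewrite eq_le u0 andbT leNgt; apply/negP => ux; apply: nu; by exists x.
have [[y0 vy0]|nv] := pselect (exists x, 0 < v x); last first.
  rewrite (@integral0_eq _ _ _ leb setT v) ?mule0// => x _.
  apply/eqP; rewrite eq_le v0 andbT leNgt; apply/negP => ux; apply: nv; by exists x.
have [a [a0 ua iu]] := int_mine mu u0 ux0.
have [b [b0 vb iv]] := int_mine mv v0 vy0.
have m0 (w : R -> \bar R) c : (forall x, 0 <= w x) -> (0 < c)%R ->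
    0 <= \int[leb]_x mine (w x) c%:E.
  by move=> w0 c0; apply: integral_ge0 => x _; rewrite le_min w0 lee_fin ltW.
apply: lee_mul_of_ub iu _ => //; try by [move=> k; exact: m0|exact: integral_ge0].
move=> k; rewrite muleC.
apply: lee_mul_of_ub iv _ => //; try by [move=> ?; exact: m0|exact: m0|exact: integral_ge0].
by move=> l; rewrite muleC; exact: truncated.
Qed.
End prekopa_leindler1.

(** * Borel sets of row vectors *)

Section borel_rV.
Context (R : realType) (n : nat).

(** The sigma-algebra is generated by the coordinates, so an open set has to be written as a
    countable union of boxes: rational centres and radii [1/(k+1)] suffice, enumerated through
    [pickle]. *)
Lemma open_measurable_rV (U : set 'rV[R]_n) : open U -> measurable U.
Proof.
move=> oU.
pose B (p : 'rV[rat]_n * nat) : set 'rV[R]_n :=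
  [set x | forall i, ball (ratr (p.1 ord0 i) : R) p.2.+1%:R^-1 (x ord0 i)].
have mB p : measurable (B p).
  rewrite (_ : B p = \bigcap_(i in [set: 'I_n]) ((fun x : 'rV[R]_n => x ord0 i) @^-1`
     (ball (ratr (p.1 ord0 i) : R) p.2.+1%:R^-1))); last first.
    by apply/seteqP; split => x /= h i; [move=> _|]; exact: h.
  apply: fin_bigcap_measurable => // i _; rewrite -[X in measurable X]setTI.
  by apply: measurable_coord => //; exact: measurable_ball.
pose F (k : nat) : set 'rV[R]_n :=
  if unpickle k is Some p then (if `[< B p `<=` U >] then B p else set0) else set0.
have -> : U = \bigcup_k F k.
  apply/seteqP; split => x; last first.
    by case=> k _; rewrite /F; case: unpickle => // p; case: asboolP => // + Bx; exact.
  move=> Ux; have /nbhs_ballP[e /= e0 eU] : nbhs x U by exact: open_nbhs_nbhs.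
  pose k := Num.truncn (2 / e).
  have k0 : 0 < k.+1%:R^-1 :> R by rewrite invr_gt0.
  have ke : k.+1%:R^-1 + k.+1%:R^-1 <= e.
    have : 2 / e < k.+1%:R by exact: truncnS_gt.
    rewrite ltr_pdivrMr// => h; rewrite -mulr2n -[leLHS]mulr_natl ler_pdivrMr//.
    by rewrite mulrC ltW.
  have q_ i : {q : rat | ball (x ord0 i) k.+1%:R^-1 (ratr q : R)}.
    apply: cid; move: k0; set del := (_.+1%:R^-1) => del0.
    have del1 : x ord0 i - del < x ord0 i + del by rewrite ltrD2l gtrN.
    have [q /=] := rat_in_itvoo del1.
    rewrite in_itv/= => /andP[h1 h2]; exists q.
    by rewrite /ball /= ltr_norml; clear -h1 h2; apply/andP; split; lra.
  pose q : 'rV[rat]_n := \row_i sval (q_ i).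
  exists (pickle (q, k)) => //; rewrite /F pickleK.
  have qx : B (q, k) x.
    by move=> i /=; rewrite mxE; apply: ball_sym; exact: (svalP (q_ i)).
  case: asboolP => // nBU; exfalso; apply: nBU => y By; apply: eU.
  split => // i j; rewrite (ord1 i).
  apply: (le_ball ke); apply: ball_triangle (By j).
  exact/ball_sym/qx.
apply: bigcup_measurable => k _; rewrite /F; case: unpickle => // p.
by case: asboolP.
Qed.

Lemma continuous_measurable_rV (f : 'rV[R]_n -> R) :
  continuous f -> measurable_fun setT f.
Proof.
move=> /continuousP cf; apply: (measurability _ (RGenOpens.measurableE R)).
move=> _ [_ [a [b ->] <-]]; rewrite setTI; apply: open_measurable_rV.
exact/cf/interval_open.
Qed.

(** Such a supremum is lower semicontinuous: its strict superlevel sets are unions of open sets.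
    This is what gives measurability of the dual quadratic form, a supremum over an uncountable
    family of vectors. *)
Lemma measurable_sup_continuous_rV (I : Type) (g : I -> 'rV[R]_n -> R) :
  (forall i, continuous (g i)) ->
  measurable_fun setT (fun x => ereal_sup [set (g i x)%:E | i in [set: I]]).
Proof.
move=> cg; apply: (measurability _ (ErealGenOInfty.measurableE R)).
move=> /= _ [_ [a ->]] <-; rewrite setTI; apply: open_measurable_rV.
rewrite (_ : _ @^-1` _ = \bigcup_(i in [set: I]) (g i @^-1` `]a, +oo[)).
  apply: bigcup_open => i _; have /continuousP := cg i; apply.
  exact: interval_open.
apply/seteqP; split => x /=; rewrite in_itv/= andbT.
  by move/ereal_sup_gt => [_ [i _ <-]]; rewrite lte_fin => ai; exists i => //=; rewrite in_itv/= andbT.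
move=> [i _ /=]; rewrite in_itv/= andbT => ai.
by apply: (@lt_le_trans _ _ (g i x)%:E); [rewrite lte_fin|apply: ereal_sup_ubound; exists i].
Qed.

End borel_rV.

(** * Slicing, scaling and tensorisation *)

Section lebesgue_rV_integral.
Local Open Scope ereal_scope.
Context (R : realType).
Notation leb := (@lebesgue_measure R).

Lemma ge0_integral_rVS n (g : 'rV[R]_n.+1 -> \bar R) :
  measurable_fun setT g -> (forall x, 0 <= g x) ->
  \int[lebesgue_rV n.+1]_x g x =
  \int[leb]_s \int[lebesgue_rV n]_y g (rV_cons (s, y)).
Proof.
move=> mg g0.
have mgc : measurable_fun setT (g \o @rV_cons R n).
  by apply: measurableT_comp => //; exact: measurable_rV_cons.
rewrite -(fubini_tonelli1 _ mgc (fun x => g0 _)).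
by rewrite -(ge0_integral_pushforward (measurable_rV_cons (R := R) (n := n)) _ measurableT)//.
Qed.

Lemma measurable_rV_slice n (g : 'rV[R]_n.+1 -> \bar R) s :
  measurable_fun setT g -> measurable_fun setT (fun y => g (rV_cons (s, y))).
Proof.
move=> mg; apply: measurableT_comp => //.
apply: (measurableT_comp (@measurable_rV_cons R n)).
exact: measurable_pair1.
Qed.

Lemma measurable_integral_rV_slice n (g : 'rV[R]_n.+1 -> \bar R) :
  measurable_fun setT g -> (forall x, 0 <= g x) ->
  measurable_fun [set: measurableTypeR R]
    (fun s => \int[lebesgue_rV n]_y g (rV_cons (s, y))).
Proof.
move=> mg g0; apply: (measurable_fun_fubini_tonelli_F (g \o @rV_cons R n)); last by move=> x; exact: g0.
by apply: measurableT_comp => //; exact: measurable_rV_cons.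
Qed.

Lemma rV_consD n (s t : R) (x y : 'rV[R]_n) (c : R) :
  (c *: (rV_cons (s, x) + rV_cons (t, y)) = rV_cons (c * (s + t), c *: (x + y)))%R.
Proof.
apply/rowP => i; rewrite [LHS]mxE [X in (c * X)%R]mxE.
case: (unliftP ord0 i) => [j ->|->]; last by rewrite !rV_cons0.
by rewrite !rV_consS !mxE.
Qed.

(** Tensorisation: by induction the inequality holds between slices, which says exactly that the
    slice integrals satisfy the one-dimensional hypothesis. In dimension 0 the measure is a Dirac
    mass and the hypothesis at one point is the claim. *)
Lemma prekopa_leindler n (u v h : 'rV[R]_n -> \bar R) :
  measurable_fun setT u -> measurable_fun setT v -> measurable_fun setT h ->
  (forall x, 0 <= u x) -> (forall x, 0 <= v x) -> (forall x, 0 <= h x) ->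
  (forall x y, u x * v y <= h (2^-1 *: (x + y))%R ^+ 2) ->
  (\int[lebesgue_rV n]_x u x) * (\int[lebesgue_rV n]_x v x)
    <= (\int[lebesgue_rV n]_x h x) ^+ 2.
Proof.
elim: n u v h => [|n IH] u v h mu mv mh u0 v0 h0 uvh.
  rewrite !integral_dirac// !diracT !mul1e.
  by apply: le_trans (uvh _ _) _; rewrite addr0 scaler0.
rewrite (ge0_integral_rVS mu u0) (ge0_integral_rVS mv v0) (ge0_integral_rVS mh h0).
apply: prekopa_leindler1; [exact: measurable_integral_rV_slice..|
  by move=> s; exact: integral_ge0|by move=> s; exact: integral_ge0|
  by move=> s; exact: integral_ge0|].
move=> s t; apply: IH => //; [exact: measurable_rV_slice..|].
by move=> x y; apply: le_trans (uvh _ _) _; rewrite rV_consD mulrC.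
Qed.

Lemma ge0_integral_scale (c : R) (g : R -> \bar R) : (0 < c)%R ->
  measurable_fun setT g -> (forall x, 0 <= g x) ->
  c%:E * \int[leb]_x g (c * x)%R = \int[leb]_x g x.
Proof.
move=> c0 mg g0.
have mf : measurable_fun [set: measurableTypeR R]
    ((fun x => c * x)%R : measurableTypeR R -> measurableTypeR R).
  exact: measurable_funM.
have := ge0_integral_pushforward mf leb measurableT mg (fun x _ => g0 x).
rewrite preimage_setT => /= <-.
rewrite -(ge0_integral_mscale _ measurableT (NngNum (ltW c0)))//.
apply: eq_measure_integral => A mA _.
rewrite [LHS](_ : _ = c%:E * leb ( *%R c @^-1` A))//.
have := lebesgue_measure_affine 0 c0 mA.
under [X in X @^-1` _]funext do rewrite addr0.
by move=> ->; rewrite muleA -EFinM mulfV ?mul1e// gt_eqF.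
Qed.

Lemma ge0_integral_rV_scale n (c : R) (g : 'rV[R]_n -> \bar R) : (0 < c)%R ->
  measurable_fun setT g -> (forall x, 0 <= g x) ->
  (c ^+ n)%:E * \int[lebesgue_rV n]_x g (c *: x)%R = \int[lebesgue_rV n]_x g x.
Proof.
move=> c0; elim: n g => [|n IH] g mg g0.
  by rewrite expr0 mul1e; apply: eq_integral => x _; congr g; apply/rowP; case.
have consZ s y : (c *: rV_cons (s, y) = rV_cons (c * s, c *: y) :> 'rV[R]_n.+1)%R.
  have := rV_consD s 0%R y 0%R c; rewrite !addr0.
  rewrite (_ : rV_cons (0%R, 0%R) = 0%R) ?addr0//.
  apply/rowP => i; case: (unliftP ord0 i) => [j ->|->].
    by rewrite rV_consS !mxE.
  by rewrite rV_cons0 mxE.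
have mgc : measurable_fun setT (fun x : 'rV[R]_n.+1 => g (c *: x)%R).
  apply: measurableT_comp => //; apply: measurable_fun_rVP => i.
  rewrite (_ : (fun x => _) = (fun x : 'rV[R]_n.+1 => c * x ord0 i)%R).
    by apply: measurable_funM => //; exact: measurable_coord.
  by apply/funext => x; rewrite mxE.
rewrite (ge0_integral_rVS mgc (fun x => g0 _)) (ge0_integral_rVS mg g0).
under [X in _ * X]eq_integral do under eq_integral do rewrite consZ.
have I0 s : 0 <= \int[lebesgue_rV n]_y g (rV_cons (s, y)) by exact: integral_ge0.
rewrite -(ge0_integral_scale c0 (measurable_integral_rV_slice mg g0) I0).
rewrite exprS EFinM -muleA; congr (_ * _).
rewrite -ge0_integralZl//; last 3 first.
- have := measurable_integral_rV_slice mgc (fun x => g0 _).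
  by under eq_fun do under eq_integral do rewrite consZ.
- by move=> s _; exact: integral_ge0.
- by rewrite lee_fin exprn_ge0// ltW.
apply: eq_integral => s _; apply: IH => //.
exact: measurable_rV_slice.
Qed.

End lebesgue_rV_integral.

(** * Prekopa-Leindler in the coordinates (s, x = y/s) *)

Section cone_prekopa_leindler.
Local Open Scope ereal_scope.
Context (R : realType) (d : nat).
Notation leb := (@lebesgue_measure R).
Notation nu := (leb \x lebesgue_rV d).

(** The map (s, y) -> (s, y/s). The real power with exponent -1 is the inverse for nonnegative s;
    all functions composed with this map vanish for s <= 0. *)
Let cone (p : measurableTypeR R * 'rV[R]_d) : measurableTypeR R * 'rV[R]_d :=
  (p.1, (p.1 `^ (-1) *: p.2)%R).

Let measurable_cone : measurable_fun setT cone.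
Proof.
apply: measurable_fun_pair; first exact: measurable_fst.
apply: measurable_fun_rVP => i.
rewrite (_ : (fun x => _) = (fun p : measurableTypeR R * 'rV[R]_d =>
  p.1 `^ (-1) * p.2 ord0 i)%R); last by apply/funext => p; rewrite !mxE.
apply: measurable_funM.
  by apply: (measurableT_comp (measurable_powR _)); exact: measurable_fst.
by apply: (measurableT_comp (measurable_coord _)); exact: measurable_snd.
Qed.

Let cone_integral (u : measurableTypeR R * 'rV[R]_d -> \bar R) :
  measurable_fun setT u -> (forall p, 0 <= u p) -> (forall p, (p.1 <= 0)%R -> u p = 0) ->
  \int[leb]_s \int[lebesgue_rV d]_y u (cone (s, y)) =
  \int[nu]_p ((p.1 ^+ d)%:E * u p).
Proof.
move=> mu u0 uneg.
have mw : measurable_fun setT (fun p : measurableTypeR R * 'rV[R]_d => (p.1 ^+ d)%:E * u p).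
  apply: emeasurable_funM => //; apply/measurable_EFinP; apply: measurable_funX.
  exact: measurable_fst.
have w0 p : 0 <= (p.1 ^+ d)%:E * u p.
  have [p0|p0] := leP p.1 0%R; first by rewrite uneg// mule0.
  by rewrite mule_ge0// lee_fin exprn_ge0// ltW.
rewrite (fubini_tonelli1 _ mw w0); apply: eq_integral => s _; rewrite /fubini_F/=.
have [s0|s0] := leP s 0%R.
  rewrite !integral0_eq// => y _; first by rewrite uneg// mule0.
  by rewrite uneg.
have mus (g : measurableTypeR R * 'rV[R]_d -> \bar R) : measurable_fun setT g -> measurable_fun setT (fun y => g (s, y)).
  by move=> mg; apply: measurableT_comp => //; exact: measurable_pair1.
rewrite ge0_integralZl//; last 2 first.
- exact: mus.
- by rewrite lee_fin exprn_ge0// ltW.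
have mg : measurable_fun setT (fun y => u (cone (s, y))).
  exact: (mus _ (measurableT_comp mu measurable_cone)).
rewrite -(ge0_integral_rV_scale s0 mg (fun y => u0 _)).
congr (_ * _); apply: eq_integral => y _; rewrite /cone /=.
by rewrite powR_inv1 ?(ltW s0)// scalerA mulVf ?scale1r// gt_eqF.
Qed.

(** This is the inequality in the linear coordinates (s, y = s x), rewritten in (s, x). The factor
    [p.1 ^+ d] is the Jacobian, and the midpoint of (s, s x) and (t, t y) corresponds to the mean of
    x and y with weights s and t. *)
Lemma cone_prekopa_leindler (u v h : measurableTypeR R * 'rV[R]_d -> \bar R) :
  measurable_fun setT u -> measurable_fun setT v -> measurable_fun setT h ->
  (forall p, 0 <= u p) -> (forall p, 0 <= v p) -> (forall p, 0 <= h p) ->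
  (forall p, (p.1 <= 0)%R -> u p = 0) -> (forall p, (p.1 <= 0)%R -> v p = 0) ->
  (forall p, (p.1 <= 0)%R -> h p = 0) ->
  (forall s t x y, (0 < s)%R -> (0 < t)%R ->
    u (s, x) * v (t, y) <=
    h ((s + t) / 2, (s + t)^-1 *: (s *: x + t *: y))%R ^+ 2) ->
  (\int[nu]_p ((p.1 ^+ d)%:E * u p)) * (\int[nu]_p ((p.1 ^+ d)%:E * v p)) <=
  (\int[nu]_p ((p.1 ^+ d)%:E * h p)) ^+ 2.
Proof.
move=> mu mv mh u0 v0 h0 un vn hn uvh.
have mF (g : measurableTypeR R * 'rV[R]_d -> \bar R) : measurable_fun setT g -> (forall p, 0 <= g p) ->
   measurable_fun setT (fun s => \int[lebesgue_rV d]_y g (cone (s, y))).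
  move=> mg g0; apply: (measurable_fun_fubini_tonelli_F (g \o cone)); last by move=> p; exact: g0.
  exact: measurableT_comp mg measurable_cone.
have ms (g : measurableTypeR R * 'rV[R]_d -> \bar R) s :
    measurable_fun setT g -> measurable_fun setT (fun y => g (cone (s, y))).
  move=> mg; apply: (measurableT_comp (measurableT_comp mg measurable_cone)).
  exact: measurable_pair1.
rewrite -(cone_integral mu u0 un) -(cone_integral mv v0 vn) -(cone_integral mh h0 hn).
apply: prekopa_leindler1; [exact: mF..|by move=> s; exact: integral_ge0|
  by move=> s; exact: integral_ge0|by move=> s; exact: integral_ge0|].
move=> s t.
have [s0|s0] := leP s 0%R.
  rewrite [X in X * _]integral0_eq ?mul0e ?sqre_ge0// => y _; exact: un.
have [t0|t0] := leP t 0%R.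
  rewrite [X in _ * X]integral0_eq ?mule0 ?sqre_ge0// => y _; exact: vn.
apply: prekopa_leindler => //; [exact: ms..|].
move=> x y; rewrite /cone /=; apply: le_trans (uvh _ _ _ _ s0 t0) _.
have st0 : (0 < s + t)%R by rewrite addr_gt0.
rewrite !powR_inv1 ?(ltW s0) ?(ltW t0) ?divr_ge0 ?(ltW st0)//.
rewrite !scalerA !mulfV ?gt_eqF// !scale1r.
rewrite (_ : ((s + t) / 2)^-1 / 2 = (s + t)^-1)%R//.
by field; rewrite gt_eqF.
Qed.

End cone_prekopa_leindler.

(** * Variance bounds from exponential moments *)

Lemma is_derive_ge0_le (R : realType) (f df : R -> R) (a b : R) : a <= b ->
  (forall t, is_derive t (1 : R) f (df t)) ->
  (forall t, a < t < b -> 0 <= df t) -> f a <= f b.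
Proof.
move=> ab fdf df0; apply: (@ger0_derive1_ndecr _ f a b) => //.
- move=> t; rewrite in_itv/= => /df0 h.
  by rewrite derive1E; have := fdf t; case=> _ ->.
- by apply: derivable_within_continuous => t _; have := fdf t; case.
Qed.

(** The odd order makes this valid for negative [x] too: [g2] is nondecreasing and vanishes at 0, so
    it has the sign of its argument, and its primitive [g3] is minimal at 0. *)
Lemma expR_ge_cubic (R : realType) (x : R) :
  1 + x + x ^+ 2 / 2 + x ^+ 3 / 6 <= expR x.
Proof.
pose g2 (t : R) := expR t - (1 + t + t ^+ 2 / 2).
pose g3 (t : R) := expR t - (1 + t + t ^+ 2 / 2 + t ^+ 3 / 6).
have d2 (t : R) : is_derive t (1 : R) g2 (expR t - (1 + t)).
  by apply: is_derive_eq; rewrite /GRing.scale/=; field.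
have d3 (t : R) : is_derive t (1 : R) g3 (g2 t).
  by apply: is_derive_eq; rewrite /g2 /GRing.scale/=; field.
have g20 : g2 0 = 0 by rewrite /g2 expR0; field.
have g30 : g3 0 = 0 by rewrite /g3 expR0; field.
have g2mono a b : a <= b -> g2 a <= g2 b.
  move=> ab; apply: (is_derive_ge0_le ab d2) => t _.
  by rewrite subr_ge0 expR_ge1Dx.
rewrite -subr_ge0 -/(g3 x) -g30.
have [x0|x0] := leP 0 x.
  by apply: (is_derive_ge0_le x0 d3) => t /andP[t0 _]; rewrite -g20 g2mono// ltW.
rewrite -lerN2; apply: (@is_derive_ge0_le _ (- g3) (- g2) _ _ (ltW x0)) => t.
by move=> /andP[_ t0]; rewrite oppr_ge0 -g20 g2mono// ltW.
Qed.

Lemma expR_le_quadratic (R : realType) (y : R) :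
  0 <= y <= 2^-1 -> expR y <= 1 + y + 2 * y ^+ 2.
Proof.
move=> /andP[y0 y1].
have h1 : 1 - y <= expR (- y) by exact: expR_ge1Dx.
have h2 : expR y * expR (- y) = 1 by rewrite -expRD subrr expR0.
have h3 : expR y * (1 - y) <= 1 by rewrite -[leRHS]h2 ler_wpM2l ?expR_ge0.
have h4 : 1 <= (1 + y + 2 * y ^+ 2) * (1 - y).
  rewrite (_ : _ * _ = 1 + y ^+ 2 * (1 - 2 * y)); last by ring.
  rewrite lerDl mulr_ge0 ?sqr_ge0//; lra.
have y2 : 0 < 1 - y by lra.
by rewrite -(ler_pM2r y2) (le_trans h3).
Qed.

(** Two lower bounds may be multiplied only when they are nonnegative; this is what restricts tau in
    terms of the bound on f. *)
Lemma cubic_ge0 (R : realFieldType) (e : R) :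
  `|e| <= 1 -> 0 <= 1 + e + e ^+ 2 / 2 + e ^+ 3 / 6.
Proof.
rewrite ler_norml => /andP[h1 h2].
rewrite (_ : _ + _ = (1 + e) + e ^+ 2 * (3 + e) / 6); last by field.
apply: addr_ge0; first lra.
by apply: divr_ge0 => //; apply: mulr_ge0; [exact: sqr_ge0|lra].
Qed.

(** On the left the odd powers of [t] cancel and the coefficient of [t ^+ 2] is [Z * F2 - F1 ^+ 2];
    on the right it is [2 * (Z * G)]. Everything else has order at least 4 and is bounded by
    [t ^+ 4] times a constant since [t] is at most 1. *)
Lemma second_order_compare (R : realFieldType) (Z F1 F2 F3 G G2 t : R) :
  0 <= Z -> 0 <= G -> 0 <= G2 -> 0 < t -> t <= 1 ->
  (Z + t * F1 + t ^+ 2 / 2 * F2 + t ^+ 3 / 6 * F3) *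
  (Z + - t * F1 + (- t) ^+ 2 / 2 * F2 + (- t) ^+ 3 / 6 * F3) <=
  (Z + t ^+ 2 * G + 2 * t ^+ 4 * G2) * (Z + t ^+ 2 * G + 2 * t ^+ 4 * G2) ->
  Z * F2 - F1 ^+ 2 - 2 * (Z * G) <=
  t * (G ^+ 2 + 4 * Z * G2 + 4 * G * G2 + 4 * G2 ^+ 2 + `|F1 * F3| + F3 ^+ 2).
Proof.
move=> Z0 G0 G20 t0 tle1 main; set K := (X in _ <= t * X).
have K0 : 0 <= K.
  by rewrite /K; repeat first [exact: sqr_ge0|apply: addr_ge0|apply: mulr_ge0|done].
have s0 : 0 < t ^+ 2 by rewrite exprn_gt0.
have s1 : t ^+ 2 <= t by rewrite expr2 ger_pMl.
suff : Z * F2 - F1 ^+ 2 - 2 * (Z * G) <= t ^+ 2 * K.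
  by move=> /le_trans; apply; rewrite ler_wpM2r.
rewrite -(ler_pM2l s0).
apply: (@le_trans _ _ (t ^+ 4 * (G ^+ 2 + 4 * Z * G2 + 4 * t ^+ 2 * G * G2 + 4 * t ^+ 4 * G2 ^+ 2
   - F2 ^+ 2 / 4 + F1 * F3 / 3 + t ^+ 2 * F3 ^+ 2 / 36))).
  rewrite -subr_ge0; move: main; rewrite -subr_ge0.
  by congr (0 <= _); field.
rewrite [leRHS]mulrA -(exprD t 2 2) ler_pM2l ?exprn_gt0//.
have t2le : t ^+ 2 <= 1 by exact: le_trans tle1.
have t4le : t ^+ 4 <= 1 by rewrite exprn_ile1// ltW.
have a1 : t ^+ 2 * (G * G2) <= G * G2 by rewrite ler_piMl// mulr_ge0.
have a2 : t ^+ 4 * G2 ^+ 2 <= G2 ^+ 2 by rewrite ler_piMl ?sqr_ge0.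
have a3 : t ^+ 2 * F3 ^+ 2 <= F3 ^+ 2 by rewrite ler_piMl ?sqr_ge0.
have a4 := ler_norm (F1 * F3).
have a5 := sqr_ge0 F2; have a6 := sqr_ge0 F3; have a7 := normr_ge0 (F1 * F3).
rewrite /K -[4 * t ^+ 2 * G * G2]mulrA -[4 * t ^+ 2 * _]mulrA.
rewrite -[4 * t ^+ 4 * G2 ^+ 2]mulrA -[4 * G * G2]mulrA.
lra.
Qed.

Lemma le0_of_le_small (R : realFieldType) (D K t0 : R) : 0 < t0 -> 0 <= K ->
  (forall t, 0 < t <= t0 -> D <= t * K) -> D <= 0.
Proof.
move=> t00 K0 H; rewrite leNgt; apply/negP => D0.
have K1 : 0 < 2 * K + 1 by rewrite ltr_wpDl// mulr_ge0.
have q0 : 0 < D / (2 * K + 1) by exact: divr_gt0.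
(* For [t] at most [D / (2 * K + 1)] the product [t * K] stays strictly below [D]. *)
have m0 : 0 < Num.min t0 (D / (2 * K + 1)) by rewrite lt_min t00.
have := H _ (introT andP (conj m0 _)); rewrite ge_min lexx => /(_ isT).
apply/negP; rewrite -ltNge.
apply: (@le_lt_trans _ _ (D / (2 * K + 1) * K)); first by rewrite ler_wpM2r// ge_min lexx orbT.
rewrite mulrAC ltr_pdivrMr// ltr_pM2l//; lra.
Qed.

Section weighted_integral.
Context d (T : measurableType d) (R : realType) (mu : {measure set T -> \bar R}).
Variable w : T -> R.
Hypothesis w0 : forall x, 0 <= w x.
Hypothesis iw : mu.-integrable setT (EFin \o w).

(** The bound is asked only where the weight is nonzero: on a truncated cone this admits 1/s and
    every continuous function of x. *)
Definition wbounded (k : T -> R) := measurable_fun setT k /\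
  exists M, forall x, w x != 0 -> `|k x| <= M.

Definition wint (k : T -> R) : R := \int[mu]_x (w x * k x).

Let mw : measurable_fun setT w.
Proof. by have /measurable_int/measurable_EFinP := iw. Qed.

Lemma wboundedc c : wbounded (cst c).
Proof. by split => //; exists `|c|. Qed.

Lemma wboundedD k l : wbounded k -> wbounded l -> wbounded (k \+ l).
Proof.
move=> [mk [M kM]] [ml [N lN]]; split; first exact: measurable_funD.
exists (M + N) => x wx; apply: le_trans (ler_normD _ _) _.
by apply: lerD; [exact: kM|exact: lN].
Qed.

Lemma wboundedM k l : wbounded k -> wbounded l -> wbounded (k \* l).
Proof.
move=> [mk [M kM]] [ml [N lN]]; split; first exact: measurable_funM.
exists (M * N) => x wx; rewrite normrM.
by apply: ler_pM => //; [exact: kM|exact: lN].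
Qed.

Lemma wboundedZ c k : wbounded k -> wbounded (fun x => c * k x).
Proof. exact: wboundedM (wboundedc c). Qed.

Lemma wboundedX k n : wbounded k -> wbounded (fun x => k x ^+ n).
Proof.
move=> bk; elim: n => [|n IH]; first exact: wboundedc.
rewrite (_ : (fun x => _) = k \* (fun x => k x ^+ n)); first exact: wboundedM.
by apply/funext => x /=; rewrite exprS.
Qed.

Lemma wbounded_expR k : wbounded k -> wbounded (fun x => expR (k x)).
Proof.
move=> [mk [M kM]]; split; first exact: measurableT_comp.
exists (expR M) => x wx; rewrite ger0_norm ?expR_ge0// ler_expR.
exact: le_trans (ler_norm _) (kM _ wx).
Qed.

Lemma wbounded_integrable k : wbounded k ->
  mu.-integrable setT (EFin \o (fun x => w x * k x)).
Proof.
move=> [mk [M kM]].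
apply: (@le_integrable _ _ _ mu setT measurableT _ (fun x => (`|M|%:E * (EFin \o w) x)%E)).
- by apply/measurable_EFinP; exact: measurable_funM.
- move=> x _ /=; rewrite lee_fin !normrM normr_id mulrC.
  have [->|wx] := eqVneq (w x) 0; first by rewrite normr0 !mulr0.
  by rewrite ler_wpM2r// (le_trans (kM _ wx))// ler_norm.
- exact: integrableZl.
Qed.

Lemma wint_EFin k : wbounded k -> (\int[mu]_x (w x * k x)%:E)%E = (wint k)%:E.
Proof.
move=> bk; rewrite /wint /Rintegral fineK//.
exact: integrable_fin_num (wbounded_integrable bk).
Qed.

Lemma wintD k l : wbounded k -> wbounded l -> wint (k \+ l) = wint k + wint l.
Proof.
move=> bk bl; rewrite /wint -RintegralD//; try exact: wbounded_integrable.
by apply: eq_Rintegral => x _; rewrite mulrDr.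
Qed.

Lemma wintZ c k : wbounded k -> wint (fun x => c * k x) = c * wint k.
Proof.
move=> bk; rewrite /wint -RintegralZl//; last exact: wbounded_integrable.
by apply: eq_Rintegral => x _; rewrite mulrCA.
Qed.

Lemma le_wint k l : wbounded k -> wbounded l ->
  (forall x, w x != 0 -> k x <= l x) -> wint k <= wint l.
Proof.
move=> bk bl kl; apply: le_Rintegral => //; try exact: wbounded_integrable.
move=> x _; have [->|wx] := eqVneq (w x) 0; first by rewrite !mul0r.
by rewrite ler_wpM2l// kl.
Qed.

(* Comparison of the second-order terms in tau, after integrating
   e^x >= 1 + x + x^2/2 + x^3/6 and e^y <= 1 + y + 2 y^2. *)
Lemma variance_le_of_expR (f g : T -> R) (tau0 : R) :
  wbounded f -> wbounded g -> (forall x, w x != 0 -> 0 <= g x) -> 0 < tau0 ->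
  (forall tau : R, 0 < tau -> tau <= tau0 ->
    ((\int[mu]_x (w x * expR (tau * f x))%:E) * (\int[mu]_x (w x * expR (- tau * f x))%:E)
    <= (\int[mu]_x (w x * expR (tau ^+ 2 * g x))%:E) ^+ 2)%E) ->
  wint (cst 1) * wint (fun x => f x ^+ 2) - wint f ^+ 2 <= 2 * (wint (cst 1) * wint g).
Proof.
move=> bf bg g0 tau00 H.
set Z := wint (cst 1); set F1 := wint f; set F2 := wint _.
set G := wint g; pose F3 := wint (fun x => f x ^+ 3); pose G2 := wint (fun x => g x ^+ 2).
have [_ [M fM]] := bf; have [_ [N gN]] := bg.
pose f' (tau : R) := (fun x => 1 + tau * f x + tau ^+ 2 / 2 * f x ^+ 2 + tau ^+ 3 / 6 * f x ^+ 3).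
pose g' (tau : R) := (fun x => 1 + tau ^+ 2 * g x + 2 * tau ^+ 4 * g x ^+ 2).
have b1 tau : wbounded (fun x => 1 + tau * f x).
  by apply: wboundedD; [exact: wboundedc|exact: wboundedZ].
have b2 tau : wbounded (fun x => 1 + tau * f x + tau ^+ 2 / 2 * f x ^+ 2).
  by apply: wboundedD => //; exact/wboundedZ/wboundedX.
have bf' tau : wbounded (f' tau).
  by apply: wboundedD => //; exact/wboundedZ/wboundedX.
have c1 tau : wbounded (fun x => 1 + tau ^+ 2 * g x).
  by apply: wboundedD; [exact: wboundedc|exact: wboundedZ].
have bg' tau : wbounded (g' tau).
  by apply: wboundedD => //; exact/wboundedZ/wboundedX.
have If' tau : wint (f' tau) = Z + tau * F1 + tau ^+ 2 / 2 * F2 + tau ^+ 3 / 6 * F3.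
  apply: etrans; first exact: (wintD (b2 tau) (wboundedZ _ (wboundedX 3 bf))).
  rewrite (wintZ _ (wboundedX 3 bf)); congr (_ + _).
  apply: etrans; first exact: (wintD (b1 tau) (wboundedZ _ (wboundedX 2 bf))).
  rewrite (wintZ _ (wboundedX 2 bf)); congr (_ + _).
  by apply: etrans; [exact: (wintD (wboundedc 1) (wboundedZ _ bf))|rewrite wintZ].
have Ig' tau : wint (g' tau) = Z + tau ^+ 2 * G + 2 * tau ^+ 4 * G2.
  apply: etrans; first exact: (wintD (c1 tau) (wboundedZ _ (wboundedX 2 bg))).
  rewrite (wintZ _ (wboundedX 2 bg)); congr (_ + _).
  by apply: etrans; [exact: (wintD (wboundedc 1) (wboundedZ _ bg))|rewrite wintZ].
have nonneg k : wbounded k -> (forall x, w x != 0 -> 0 <= k x) -> 0 <= wint k.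
  move=> bk k0; apply: Rintegral_ge0 => x _.
  by have [->|wx] := eqVneq (w x) 0; rewrite ?mul0r// mulr_ge0// k0.
have Z0 : 0 <= Z by apply: nonneg => //; exact: wboundedc.
have G0 : 0 <= G by exact: nonneg.
have G20 : 0 <= G2 by apply: nonneg; [exact: wboundedX|move=> x _; exact: sqr_ge0].
pose K := G ^+ 2 + 4 * Z * G2 + 4 * G * G2 + 4 * G2 ^+ 2 + `|F1 * F3| + F3 ^+ 2.
have K0 : 0 <= K by rewrite /K; repeat first [exact: sqr_ge0|apply: addr_ge0|apply: mulr_ge0|done].
rewrite -subr_le0.
(* Below [t1], [|t * f|] is at most 1, as [cubic_ge0] requires, and [t ^+ 2 * g] is at most 1/2, as
   [expR_le_quadratic] requires. *)
pose t1 := Num.min (Num.min tau0 1) (Num.min (`|M| + 1)^-1 (2 * (`|N| + 1))^-1).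
have t10 : 0 < t1.
  by rewrite !lt_min tau00 ltr01/= !invr_gt0 mulr_gt0 ?andbT// ltr_wpDl.
apply: (le0_of_le_small t10 K0) => t /andP[t0].
rewrite !le_min => /andP[/andP[ttau0 tle1] /andP[tM tN]].
have ftau x : w x != 0 -> `|t * f x| <= 1.
  move=> wx; rewrite normrM gtr0_norm//.
  apply: (@le_trans _ _ ((`|M| + 1)^-1 * (`|M| + 1))); last by rewrite mulVf// gt_eqF// ltr_wpDl.
  apply: ler_pM => //; first exact: ltW.
  by rewrite (le_trans (fM _ wx))// (le_trans (ler_norm _))// lerDl.
have gtau x : w x != 0 -> 0 <= t ^+ 2 * g x <= 2^-1.
  move=> wx; rewrite mulr_ge0 ?sqr_ge0 ?g0//=.
  have gxN : g x <= `|N| + 1.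
    by rewrite (le_trans (ler_norm _))// (le_trans (gN _ wx))// (le_trans (ler_norm _))// lerDl.
  have t2 : t ^+ 2 <= (2 * (`|N| + 1))^-1.
    by rewrite (le_trans _ tN)// expr2 ger_pMl.
  apply: (@le_trans _ _ ((2 * (`|N| + 1))^-1 * (`|N| + 1))).
    by apply: ler_pM => //; [exact: sqr_ge0|exact: g0].
  by rewrite invfM -mulrA mulVf ?mulr1// gt_eqF// ltr_wpDl.
have f'E s x : f' s x = 1 + s * f x + (s * f x) ^+ 2 / 2 + (s * f x) ^+ 3 / 6.
  by rewrite /f'; field.
have g'E x : g' t x = 1 + t ^+ 2 * g x + 2 * (t ^+ 2 * g x) ^+ 2 by rewrite /g'; ring.
have := H t t0 ttau0.
have bexp s : wbounded (fun x => expR (s * f x)) by exact/wbounded_expR/wboundedZ.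
have bexpg s : wbounded (fun x => expR (s * g x)) by exact/wbounded_expR/wboundedZ.
rewrite !wint_EFin// expe2 -!EFinM lee_fin => main.
have lo1 : wint (f' t) <= wint (fun x => expR (t * f x)).
  by apply: le_wint => // x wx; rewrite f'E expR_ge_cubic.
have lo2 : wint (f' (- t)) <= wint (fun x => expR (- t * f x)).
  by apply: le_wint => // x wx; rewrite f'E expR_ge_cubic.
have hi : wint (fun x => expR (t ^+ 2 * g x)) <= wint (g' t).
  by apply: le_wint => // x wx; rewrite g'E expR_le_quadratic// gtau.
have p1 : 0 <= wint (f' t).
  by apply: nonneg => // x wx; rewrite f'E cubic_ge0// ftau.
have p2 : 0 <= wint (f' (- t)).
  by apply: nonneg => // x wx; rewrite f'E cubic_ge0// mulNr normrN ftau.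
have p3 : 0 <= wint (fun x => expR (t ^+ 2 * g x)).
  by apply: nonneg => // x wx; exact: expR_ge0.
have := le_trans (le_trans (ler_pM p1 p2 lo1 lo2) main) (ler_pM p3 p3 hi hi).
rewrite !If' Ig'.
clearbody Z F1 F2 G F3 G2.
move=> {main lo1 lo2 hi p1 p2 p3} main.
exact: second_order_compare main.
Qed.
End weighted_integral.

(** * Passage to the limit along increasing weights *)

Section exhaustion.
Context d (T : measurableType d) (R : realType) (mu : {measure set T -> \bar R}).
Variables (w_ : nat -> T -> R) (w : T -> R).
Hypothesis mw_ : forall n, measurable_fun setT (w_ n).
Hypothesis w_0 : forall n x, 0 <= w_ n x.
Hypothesis w_w : forall n x, w_ n x <= w x.
Hypothesis nd_w_ : forall x, nondecreasing_seq (w_ ^~ x).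
Hypothesis cvg_w_ : forall x, w_ n x @[n --> \oo] --> w x.
Hypothesis iw : mu.-integrable setT (EFin \o w).

Let w0 x : 0 <= w x. Proof. exact: le_trans (w_0 0%N x) (w_w 0%N x). Qed.

Let mw : measurable_fun setT w.
Proof. by have /measurable_int/measurable_EFinP := iw. Qed.

Let iwn n : mu.-integrable setT (EFin \o w_ n).
Proof.
apply: (le_integrable measurableT _ _ iw); first exact/measurable_EFinP.
by move=> x _ /=; rewrite lee_fin !ger0_norm.
Qed.

Let cvg_wint (k : T -> R) : measurable_fun setT k ->
  mu.-integrable setT (EFin \o (fun x => w x * k x)) ->
  wint mu (w_ n) k @[n --> \oo] --> wint mu w k.
Proof.
move=> mk iwk.
have iwnk n : mu.-integrable setT (EFin \o (fun x => w_ n x * k x)).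
  apply: (le_integrable measurableT _ _ iwk).
    by apply/measurable_EFinP; exact: measurable_funM.
  by move=> x _ /=; rewrite lee_fin !normrM (ger0_norm (w_0 _ _)) (ger0_norm (w0 _)) ler_wpM2r.
have mwk n : measurable_fun setT (fun x => (w_ n x * k x)%:E).
  by apply/measurable_EFinP; exact: measurable_funM.
have mwk0 : measurable_fun setT (fun x => (w x * k x)%:E).
  by apply/measurable_EFinP; exact: measurable_funM.
have cvgp : {ae mu, forall x, [set: T] x -> (w_ n x * k x)%:E @[n --> \oo] --> (w x * k x)%:E}.
  by apply: aeW => x _; apply: cvg_EFin; [exact: nearW|exact: cvgMl].
have dom : {ae mu, forall x n, [set: T] x -> (`|(w_ n x * k x)%:E| <= `|(w x * k x)%:E|)%E}.
  by apply: aeW => x n _; rewrite lee_fin !normrM (ger0_norm (w_0 _ _)) (ger0_norm (w0 _)) ler_wpM2r.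
have [_ _ h] := dominated_convergence measurableT mwk mwk0 cvgp (integrable_abse iwk) dom.
rewrite -(@fineK _ (\int[mu]_x (w x * k x)%:E)%E) in h.
  exact: (fine_cvg h).
exact: integrable_fin_num iwk.
Qed.

(* The means F1_n / Z_n stay bounded (compare with the weight w_ n0), so the
   second moments do too, and f is square integrable for w. *)
Lemma variance_le_exhaustion (f : T -> R) (C : R) :
  (forall n, wbounded (w_ n) f) -> 0 < wint mu w (cst 1) ->
  (forall n, wint mu (w_ n) (cst 1) * wint mu (w_ n) (fun x => f x ^+ 2) -
     wint mu (w_ n) f ^+ 2 <= wint mu (w_ n) (cst 1) * C) ->
  mu.-integrable setT (EFin \o (fun x => w x * f x ^+ 2)) /\
  wint mu w (cst 1) * wint mu w (fun x => f x ^+ 2) - wint mu w f ^+ 2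
    <= wint mu w (cst 1) * C.
Proof.
move=> bf Zpos HC.
have mf : measurable_fun setT f by have [] := bf 0%N.
set Z := wint mu w (cst 1).
pose Zn n := wint mu (w_ n) (cst 1); pose F1 n := wint mu (w_ n) f.
pose F2 n := wint mu (w_ n) (fun x => f x ^+ 2).
have iw1 : mu.-integrable setT (EFin \o (fun x => w x * cst 1 x)).
  exact: wbounded_integrable iw _ (wboundedc _ 1).
have cvgZ : Zn n @[n --> \oo] --> Z by exact: cvg_wint.
have [n0 Zn0] : exists n0, 0 < Zn n0.
  have : \forall n \near \oo, 0 < Zn n by exact: cvgr_gt cvgZ _ Zpos.
  by case=> n0 _ H; exists n0; apply: H => /=.
have bsq n k : wbounded (w_ n) k -> wbounded (w_ n) (fun x => k x ^+ 2).
  exact: wboundedX.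
have wint_le m n k : (m <= n)%N -> wbounded (w_ m) k -> wbounded (w_ n) k ->
    (forall x, 0 <= k x) -> wint mu (w_ m) k <= wint mu (w_ n) k.
  move=> mn bm bn k0; apply: le_Rintegral => //.
  - exact: wbounded_integrable (iwn m) _ bm.
  - exact: wbounded_integrable (iwn n) _ bn.
  - by move=> x _; rewrite ler_wpM2r// nd_w_.
have Zn_Z n : Zn n <= Z.
  apply: le_Rintegral => //; first exact: wbounded_integrable (iwn n) _ (wboundedc _ 1).
  by move=> x _; rewrite ler_wpM2r.
have Znpos n : (n0 <= n)%N -> 0 < Zn n.
  by move=> nn; apply: lt_le_trans Zn0 _; apply: wint_le => //; exact: wboundedc.
pose D := 2 * C + 2 * F2 n0.
(* Integrate m^2 <= 2 (f - m)^2 + 2 f^2 against [w_ n0]. As [w_ n0 <= w_ n], the first term is at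
   most twice the centred second moment at stage [n], itself at most [C]. *)
have mean n : (n0 <= n)%N -> (F1 n / Zn n) ^+ 2 * Zn n0 <= D.
  move=> nn; set m := F1 n / Zn n.
  have bfm : wbounded (w_ n) (fun x => f x - m) by exact: wboundedD (bf n) (wboundedc _ (- m)).
  have bfm0 : wbounded (w_ n0) (fun x => f x - m) by exact: wboundedD (bf n0) (wboundedc _ (- m)).
  have Q : wint mu (w_ n) (fun x => (f x - m) ^+ 2) <= C.
    have -> : wint mu (w_ n) (fun x => (f x - m) ^+ 2) = F2 n - F1 n ^+ 2 / Zn n.
      transitivity (F2 n + ((- 2 * m) * F1 n + m ^+ 2 * Zn n)).
        rewrite /F2 /F1 /Zn -(wintZ (iwn n) _ (bf n)) -(wintZ (iwn n) _ (wboundedc _ 1)).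
        rewrite -(wintD (iwn n) (wboundedZ _ (bf n)) (wboundedZ _ (wboundedc _ 1))).
        rewrite -(wintD (iwn n) (bsq _ _ (bf n)) (wboundedD (wboundedZ _ (bf n)) (wboundedZ _ (wboundedc _ 1)))).
        by congr (wint _ _ _); apply/funext => x /=; ring.
      by rewrite /m; field; rewrite gt_eqF// Znpos.
    rewrite -(ler_pM2l (Znpos _ nn)) (le_trans _ (HC n))// mulrBr.
    by rewrite [Zn n * (_ / _)]mulrC divfK// gt_eqF// Znpos.
  have -> : m ^+ 2 * Zn n0 = wint mu (w_ n0) (fun x => m ^+ 2).
    rewrite mulrC -[RHS]/(wint mu (w_ n0) (cst (m ^+ 2))) mulrC -(wintZ (iwn n0) _ (wboundedc _ 1)).
    by congr (wint _ _ _); apply/funext => x /=; rewrite mulr1.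
  apply: (@le_trans _ _ (wint mu (w_ n0) (fun x => 2 * (f x - m) ^+ 2 + 2 * f x ^+ 2))).
    apply: (le_wint (w_0 n0) (iwn n0)); first exact: wboundedc.
      by apply: wboundedD; apply: wboundedZ; exact: bsq.
    move=> x _; rewrite -subr_ge0 (_ : _ - _ = (2 * f x - m) ^+ 2) ?sqr_ge0//.
    by ring.
  rewrite (wintD (iwn n0) (wboundedZ 2 (bsq _ _ bfm0)) (wboundedZ 2 (bsq _ _ (bf n0)))).
  rewrite (wintZ (iwn n0) _ (bsq _ _ bfm0)) (wintZ (iwn n0) _ (bsq _ _ (bf n0))).
  rewrite /D lerD2r ler_pM2l// (le_trans _ Q)//; apply: wint_le => //.
  - exact: bsq.
  - exact: bsq.
  - by move=> x; exact: sqr_ge0.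
have D0 : 0 <= D by apply: le_trans (mean n0 (leqnn _)); rewrite mulr_ge0 ?sqr_ge0// ltW.
pose B := C + D / Zn n0 * Z.
have F2B n : (n0 <= n)%N -> F2 n <= B.
  move=> nn; have := HC n; rewrite lerBlDr => h.
  have Zp := Znpos _ nn.
  have {}h : F2 n <= C + (F1 n / Zn n) ^+ 2 * Zn n.
    rewrite -(ler_pM2l Zp) (le_trans h)// mulrDr lerD2l.
    rewrite -/(F1 n) (_ : Zn n * _ = F1 n ^+ 2)//.
    by field; rewrite gt_eqF.
  apply: le_trans h _; rewrite lerD2l; apply: ler_pM; rewrite ?sqr_ge0// ?(ltW Zp)//.
  by rewrite ler_pdivlMr// mean.
have iw2 : mu.-integrable setT (EFin \o (fun x => w x * f x ^+ 2)).
  have m2 : measurable_fun setT (fun x => w x * f x ^+ 2).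
    by apply: measurable_funM => //; exact: measurable_funX.
  have m2n n : measurable_fun setT (fun x => (w_ n x * f x ^+ 2)%:E).
    by apply/measurable_EFinP; apply: measurable_funM => //; exact: measurable_funX.
  apply/integrableP; split; first exact/measurable_EFinP.
  apply: (@le_lt_trans _ _ B%:E); last by rewrite ltry.
  have -> : (\int[mu]_x `|(EFin \o (fun x => w x * f x ^+ 2)%R) x| =
      \int[mu]_x limn (fun n => (w_ n x * f x ^+ 2)%R%:E))%E.
    apply: eq_integral => x _ /=; rewrite ger0_norm; last by apply: mulr_ge0 => //; exact: sqr_ge0.
    apply/esym/cvg_lim => //; apply: cvg_EFin; first exact: nearW.
    exact: cvgMl.
  rewrite (monotone_convergence mu measurableT (g' := fun n x => (w_ n x * f x ^+ 2)%:E))//.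
  - apply: lime_le.
      apply: ereal_nondecreasing_is_cvgn => i j ij; apply: ge0_le_integral => //.
      + by move=> x _; rewrite lee_fin; apply: mulr_ge0 => //; exact: sqr_ge0.
      + by move=> x _; rewrite lee_fin ler_wpM2r ?sqr_ge0// nd_w_.
    exists n0 => // n /= nn.
    by rewrite (wint_EFin (iwn n) (bsq _ _ (bf n))) lee_fin F2B.
  - by move=> n x _; rewrite lee_fin; apply: mulr_ge0 => //; exact: sqr_ge0.
  - by move=> x _ i j ij; rewrite lee_fin ler_wpM2r ?sqr_ge0// nd_w_.
split => //.
have iwf : mu.-integrable setT (EFin \o (fun x => w x * f x)).
  apply: (le_integrable measurableT _ _ (integrableD measurableT iw iw2)).
    by apply/measurable_EFinP; exact: measurable_funM.
  move=> x _ /=; rewrite lee_fin normrM (ger0_norm (w0 x)).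
  rewrite [leRHS]ger0_norm; last by apply: addr_ge0 => //; apply: mulr_ge0 => //; exact: sqr_ge0.
  rewrite -[leRHS]/(w x + w x * f x ^+ 2) -{2}(mulr1 (w x)) -mulrDr ler_wpM2l//.
  rewrite -(real_normK (num_real (f x))).
  by have := sqr_ge0 (2 * `|f x| - 1); have := normr_ge0 (f x); rewrite !expr2; nra.
have cF1 : F1 n @[n --> \oo] --> wint mu w f by exact: cvg_wint.
have cF2 : F2 n @[n --> \oo] --> wint mu w (fun x => f x ^+ 2).
  by apply: cvg_wint => //; exact: measurable_funX.
have cL : Zn n * F2 n - F1 n ^+ 2 @[n --> \oo] -->
   Z * wint mu w (fun x => f x ^+ 2) - wint mu w f ^+ 2.
  apply: cvgB; first exact: cvgM.
  by rewrite !expr2; exact: cvgM.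
have cR : Zn n * C @[n --> \oo] --> Z * C by exact: cvgMl.
rewrite -(cvg_lim _ cL)// -(cvg_lim _ cR)//.
apply: ler_lim; [by apply/cvg_ex; eexists; exact: cL|by apply/cvg_ex; eexists; exact: cR|].
by apply: nearW => n; exact: HC.
Qed.
End exhaustion.

(** * Calculus on row vectors *)

Section calculus_rV.
Context (R : realType) (d : nat).

(** The squared Euclidean length, to be distinguished from [|w|], which is the maximum norm on row
    vectors. *)
Definition vsq (w : 'rV[R]_d) : R := dot w w.

Definition quad (A : 'M[R]_d) (w : 'rV[R]_d) : R := dot (A *m w^T)^T w.

(** On the compact set [D] of pairs where [g] changes by at least [eta], the distance attains a
    minimum, positive because [D] misses the diagonal; any smaller [r] works. Stating this with a
    filter lets finitely many moduli, one per matrix entry, be intersected. *)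
Lemma unif_continuous_rV (g : 'rV[R]_d -> R) (n eta : R) : continuous g -> 0 < eta ->
  \forall r \near 0^'+, forall x z, `|x| <= n -> `|z| <= n -> `|z - x| <= r ->
    `|g z - g x| <= eta.
Proof.
move=> cg eta0.
pose D := [set p : 'rV[R]_d * 'rV[R]_d | `|p.1| <= n /\ `|p.2| <= n /\ eta <= `|g p.2 - g p.1|].
have clB : closed [set x : 'rV[R]_d | `|x| <= n].
  apply: (@preimage_closed _ _ (fun x : 'rV[R]_d => `|x|) [set y | y <= n]); last exact: closed_le.
  by move=> x _; exact: norm_continuous.
have cB : compact [set x : 'rV[R]_d | `|x| <= n].
  apply: bounded_closed_compact => //.
  exists n; split; first exact: num_real.
  by move=> M nM x /= xn; exact: le_trans xn (ltW nM).
have cD : compact D.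
  have DE : D = ([set x : 'rV[R]_d | `|x| <= n] `*` [set x : 'rV[R]_d | `|x| <= n]) `&`
     ((fun p : 'rV[R]_d * 'rV[R]_d => `|g p.2 - g p.1|) @^-1` [set y | eta <= y]).
    by apply/seteqP; split => -[x z] /=; rewrite /D /=; tauto.
  rewrite DE; apply: compact_closedI; first exact: compact_setX.
  apply: preimage_closed; last exact: closed_ge.
  move=> p _; apply: cvg_norm; apply: cvgB.
    by apply: (cvg_comp snd g); [exact: cvg_snd|exact: cg].
  by apply: (cvg_comp fst g); [exact: cvg_fst|exact: cg].
have [D0|/set0P Dn0] := eqVneq D set0.
  near=> r => x z xn zn xz; rewrite leNgt; apply/negP => h.
  have : D (x, z) by rewrite /D /=; split => //; split => //; exact: ltW.
  by rewrite D0.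
have cf : {within D, continuous (fun p : 'rV[R]_d * 'rV[R]_d => `|p.2 - p.1|)}.
  apply: continuous_subspaceT => p; apply: cvg_norm; apply: cvgB; [exact: cvg_snd|exact: cvg_fst].
have [[x0 z0] /set_mem D0 minD] := compact_EVT_min Dn0 cD cf.
have r0 : 0 < `|z0 - x0|.
  rewrite normr_gt0 subr_eq0; apply/eqP => zx; move: D0; rewrite /D /= zx subrr normr0 => -[_ [_]].
  by rewrite leNgt eta0.
near=> r => x z xn zn xz; rewrite leNgt; apply/negP => h.
have Dxz : D (x, z) by rewrite /D /=; split => //; split => //; exact: ltW.
have := minD (x, z) (mem_set Dxz); rewrite /= => h1.
have : r < `|z0 - x0| by near: r; exact: nbhs_right_lt.
by rewrite ltNge (le_trans h1).
Unshelve. all: by end_near. Qed.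

Lemma diff_partial (g : 'rV[R]_d -> R) (y v : 'rV[R]_d) : differentiable g y ->
  'd g y v = dot (gradient g y) v.
Proof.
move=> dg; rewrite [v in LHS](row_sum_delta v).
rewrite linear_sum /dot; apply: eq_bigr => i _.
by rewrite linearZ /= mxE /partial deriveE// /GRing.scale/= mulrC.
Qed.

Lemma line_derive (g : 'rV[R]_d -> R) (x xi : 'rV[R]_d) (t : R) :
  (forall y, differentiable g y) ->
  is_derive t (1 : R) (fun t : R => g (x + t *: xi)) (dot (gradient g (x + t *: xi)) xi).
Proof.
move=> dg; pose a (t : R) : 'rV[R]_d := x + t *: xi.
have da (u : R) : is_diff u a ( *:%R^~ xi).
  rewrite (_ : a = cst x + ( *:%R^~ xi : R -> 'rV[R]_d)); last exact/funext.
  apply: (is_diff_eq (is_diffD (is_diff_cst _ _) (is_diff_scalel _ _))).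
  exact: add0r.
have dat : differentiable a t by case: (da t).
have dga : differentiable (g \o a) t by apply: differentiable_comp.
apply: DeriveDef; first exact: diff_derivable.
rewrite deriveE// (diff_comp dat (dg _)).
rewrite /= -diff_partial//; congr ('d g _ _).
by case: (da t) => _ ->; rewrite scale1r.
Qed.

(** Subtracting the tangent and [c * t ^+ 2 / 2] leaves a function [k] whose derivative is
    nondecreasing on the segment and vanishes at 0, so [k] is minimal at 0. The endpoints have
    barycentre 0 for the weights [l] and [1 - l], which eliminates the slope. *)
Lemma line_taylor (g p q : R -> R) (c l : R) : 0 <= l <= 1 ->
  (forall t, is_derive t (1 : R) g (p t)) -> (forall t, is_derive t (1 : R) p (q t)) ->
  (forall t, - l <= t <= 1 - l -> c <= q t) ->
  l * (1 - l) * c / 2 <= l * g (1 - l) + (1 - l) * g (- l) - g 0.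
Proof.
move=> /andP[l0 l1] dg dp cq.
pose k (t : R) := g t - c * t ^+ 2 / 2 - p 0 * t.
pose k' (t : R) := p t - c * t - p 0.
have dk t : is_derive t (1 : R) k (k' t).
  by apply: is_derive_eq; rewrite /k' /GRing.scale/=; field.
have dk' t : is_derive t (1 : R) k' (q t - c).
  by apply: is_derive_eq; rewrite /GRing.scale/=; field.
have k'0 : k' 0 = 0 by rewrite /k'; ring.
have k'pos t : 0 <= t <= 1 - l -> 0 <= k' t.
  move=> /andP[t0 t1]; rewrite -k'0; apply: (is_derive_ge0_le t0 dk') => u /andP[u0 u1].
  rewrite subr_ge0 cq//; apply/andP; split; lra.
have k'neg t : - l <= t <= 0 -> k' t <= 0.
  move=> /andP[t0 t1]; rewrite -k'0; apply: (is_derive_ge0_le t1 dk') => u /andP[u0 u1].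
  rewrite subr_ge0 cq//; apply/andP; split; lra.
have h1 : k 0 <= k (1 - l).
  apply: (is_derive_ge0_le _ dk); first by rewrite subr_ge0.
  by move=> t /andP[t0 t1]; rewrite k'pos// !ltW.
have h2 : k 0 <= k (- l).
  rewrite -lerN2; apply: (@is_derive_ge0_le _ (fun t => - k t) (fun t => - k' t)).
  - by rewrite oppr_le0.
  - by move=> t /andP[t0 t1]; rewrite oppr_ge0 k'neg// !ltW.
have := lerD (ler_wpM2l l0 h1) (ler_wpM2l (_ : 0 <= 1 - l) h2).
rewrite subr_ge0 => /(_ l1); rewrite /k -subr_ge0 => h.
rewrite -subr_ge0; apply: le_trans h _; rewrite le_eqVlt; apply/orP; left; apply/eqP.
by field.
Qed.

Lemma line_mvt (g : 'rV[R]_d -> R) (x xi : 'rV[R]_d) (l : R) : 0 <= l <= 1 ->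
  (forall y, differentiable g y) ->
  exists2 t, - l <= t <= 1 - l &
    g (x + (1 - l) *: xi) - g (x - l *: xi) = dot (gradient g (x + t *: xi)) xi.
Proof.
move=> /andP[l0 l1] dg.
have lt : - l < 1 - l by lra.
have dline (u : R) := line_derive x xi u dg.
have cline : {within `[- l, 1 - l], continuous (fun t : R => g (x + t *: xi))}.
  by apply: derivable_within_continuous => u _; case: (dline u).
have [t] := MVT lt (fun u _ => dline u) cline.
rewrite in_itv/= => /andP[t0 t1] E; exists t; first by rewrite !ltW.
by move: E; rewrite scaleNr (_ : 1 - l - - l = 1) ?mulr1//; ring.
Qed.

End calculus_rV.

(** * Quadratic forms under perturbation *)

Section quadratic_rV.
Context (R : realType) (d : nat).
Implicit Types (A B : 'M[R]_d) (v w x y : 'rV[R]_d).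

Lemma quadE A w : quad A w = \sum_i \sum_j A i j * w ord0 j * w ord0 i.
Proof.
rewrite /quad /dot; apply: eq_bigr => i _; rewrite !mxE mulr_suml.
by apply: eq_bigr => j _; rewrite !mxE.
Qed.

Lemma vsqE w : vsq w = \sum_i w ord0 i ^+ 2.
Proof. by apply: eq_bigr => i _; rewrite expr2. Qed.

Lemma vsq_ge0 w : 0 <= vsq w.
Proof. by rewrite vsqE sumr_ge0// => i _; exact: sqr_ge0. Qed.

Lemma quadZ (c : R) A w : quad A (c *: w) = c ^+ 2 * quad A w.
Proof.
rewrite !quadE mulr_sumr; apply: eq_bigr => i _; rewrite mulr_sumr.
by apply: eq_bigr => j _; rewrite !mxE; ring.
Qed.

Lemma vsqZ (c : R) w : vsq (c *: w) = c ^+ 2 * vsq w.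
Proof. by rewrite !vsqE mulr_sumr; apply: eq_bigr => i _; rewrite mxE exprMn. Qed.

Lemma dotZr (c : R) v w : dot v (c *: w) = c * dot v w.
Proof. by rewrite /dot mulr_sumr; apply: eq_bigr => i _; rewrite mxE mulrCA. Qed.

(** An entrywise error [eta] costs [d * eta * vsq w] because |w_i w_j| <= (w_i^2 + w_j^2)/2. *)
Lemma quad_perturb A B (eta : R) w : (forall i j, `|A i j - B i j| <= eta) ->
  quad B w - d%:R * eta * vsq w <= quad A w.
Proof.
move=> AB; rewrite lerBlDr -lerBlDl.
have -> : d%:R * eta * vsq w = \sum_(i < d) \sum_(j < d) eta * (w ord0 i ^+ 2 + w ord0 j ^+ 2) / 2.
  transitivity (\sum_(i < d) (d%:R * eta / 2 * w ord0 i ^+ 2 + eta / 2 * vsq w)); last first.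
    apply: eq_bigr => i _; rewrite vsqE mulr_sumr.
    under [RHS]eq_bigr do rewrite mulrDr mulrDl.
    rewrite big_split /= sumr_const card_ord -mulr_natl; congr (_ + _); first by field.
    by apply: eq_bigr => j _; field.
  by rewrite big_split/= sumr_const card_ord -mulr_sumr -vsqE -mulr_natl; field.
rewrite !quadE -sumrB; apply: ler_sum => i _; rewrite -sumrB; apply: ler_sum => j _.
set p := w ord0 i; set q := w ord0 j.
have -> : B i j * q * p - A i j * q * p = (B i j - A i j) * (q * p) by ring.
apply: le_trans (ler_norm _) _; rewrite normrM distrC.
apply: (@le_trans _ _ (eta * `|q * p|)); first by rewrite ler_wpM2r.
have eta0 : 0 <= eta by exact: le_trans (AB i j).
rewrite -mulrA ler_wpM2l// ler_norml.
have h1 := sqr_ge0 (p + q); have h2 := sqr_ge0 (p - q).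
by rewrite !expr2 in h1 h2 *; apply/andP; split; nra.
Qed.

(** Young's inequality applied to [tau * w_i] splits the error in two: the multiple of [vsq w] will
    be absorbed by uniform convexity, the multiple of [tau ^+ 2] by the slack [del]. *)
Lemma dot_perturb v v' (eta tau : R) w : 0 <= tau -> (forall i, `|v ord0 i - v' ord0 i| <= eta) ->
  tau * dot v w <= tau * dot v' w + eta / 2 * vsq w + d%:R * eta * tau ^+ 2 / 2.
Proof.
move=> tau0 vv; rewrite -addrA -lerBlDl -mulrBr.
have -> : eta / 2 * vsq w + d%:R * eta * tau ^+ 2 / 2 =
    \sum_(i < d) (eta / 2 * w ord0 i ^+ 2 + eta / 2 * tau ^+ 2).
  by rewrite big_split/= sumr_const card_ord -mulr_sumr -vsqE -mulr_natl; field.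
rewrite /dot -sumrB mulr_sumr; apply: ler_sum => i _; rewrite -mulrBl.
set p := w ord0 i; apply: le_trans (ler_norm _) _; rewrite mulrCA normrM.
apply: (@le_trans _ _ (eta * `|tau * p|)); first by rewrite ler_wpM2r.
have eta0 : 0 <= eta by exact: le_trans (vv i).
rewrite -mulrDr -mulrA ler_wpM2l// ler_norml.
have h1 := sqr_ge0 (p + tau); have h2 := sqr_ge0 (p - tau).
by rewrite !expr2 in h1 h2 *; apply/andP; split; nra.
Qed.

Lemma coord_le_norm w i : `|w ord0 i| <= `|w|.
Proof. by rewrite [leRHS]mx_normrE; exact: (le_bigmax _ (fun ij => `|w ij.1 ij.2|) (ord0, i)). Qed.

Lemma norm_sq_le_vsq w : `|w| ^+ 2 <= vsq w.
Proof.
have [->|w0] := eqVneq `|w| 0; first by rewrite expr0n vsq_ge0.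
have [[i0 i] /= E] := mx_norm_neq0 w0; rewrite [`|w|]E.
rewrite (ord1 i0) real_normK ?num_real// vsqE (bigD1 i)//= lerDl.
by rewrite sumr_ge0// => j _; exact: sqr_ge0.
Qed.

Lemma vsq_le_norm_sq w : vsq w <= d%:R * `|w| ^+ 2.
Proof.
rewrite vsqE (@le_trans _ _ (\sum_(i < d) `|w| ^+ 2))//; last first.
  by rewrite sumr_const card_ord mulr_natl.
apply: ler_sum => i _; rewrite -[leLHS]real_normK ?num_real//.
by rewrite lerXn2r ?nnegrE// coord_le_norm.
Qed.

Lemma bounded_rV (g : 'rV[R]_d -> R) (n : R) : continuous g ->
  \forall M \near +oo, forall x, `|x| <= n -> `|g x| <= M.
Proof.
move=> cg.
have clB : closed [set x : 'rV[R]_d | `|x| <= n].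
  apply: (@preimage_closed _ _ (fun x : 'rV[R]_d => `|x|) [set y | y <= n]); last exact: closed_le.
  by move=> x _; exact: norm_continuous.
have cB : compact [set x : 'rV[R]_d | `|x| <= n].
  apply: bounded_closed_compact => //.
  exists n; split; first exact: num_real.
  by move=> M nM x /= xn; exact: le_trans xn (ltW nM).
have /compact_bounded [M [_ HM]] := continuous_compact (continuous_subspaceT cg) cB.
near=> M' => x xn; apply: (HM M'); last by exists x.
near: M'; apply: nbhs_pinfty_gt; exact: num_real.
Unshelve. all: by end_near. Qed.

End quadratic_rV.

(** Arithmetic of the case of nearby points. Here [D] is (s - t)^2, [k] is st/(s + t), [Q] and [N]
    are the Hessian form and squared length of x - y, [T] is the convexity defect of phi and [F] is
    the tau term. Since [k] falls short of [sg / 2] by [D / (8 * sg)], a multiple of [D * Q] is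
    lost; [Q] being small, the radial penalty [eps / 4 * D] pays for it. The spare
    [sg * eps * N / 16] pays for the variation of the gradient of f. *)
Lemma midpoint_core (R : realFieldType)
    (sg eps eta D k Q N g T F E P Dl : R) :
  0 < sg -> 0 <= D -> 0 <= N -> k = sg / 2 - D / (8 * sg) ->
  Q + 3 * eps / 4 * N <= 4 * sg * eps -> 8 * eta <= sg * eps ->
  k / 2 * (Q - eps / 4 * N) <= T -> F <= g + eta / 2 * N + E -> E <= Dl ->
  g - sg / 4 * (Q + eps / 2 * N) <= P ->
  - (P + Dl) <= T + eps / 2 * (k * N) + eps / 4 * D - F.
Proof.
move=> sg0 D0 N0 kE mle etale HT HF HE HP.
have h1 : D / (16 * sg) * (Q + 3 * eps / 4 * N) <= D / (16 * sg) * (4 * sg * eps).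
  by apply: ler_wpM2l => //; apply: divr_ge0 => //; apply: mulr_ge0 => //; exact: ltW.
have h2 : D / (16 * sg) * (4 * sg * eps) = eps / 4 * D by field; rewrite gt_eqF.
have h3 : k / 2 * (Q - eps / 4 * N) + eps / 2 * (k * N) =
   sg / 4 * (Q + 3 * eps / 4 * N) - D / (16 * sg) * (Q + 3 * eps / 4 * N).
  by rewrite kE; field; rewrite gt_eqF.
have h4 : 8 * eta * N <= sg * eps * N by exact: ler_wpM2r.
have h5 : sg / 4 * (Q + 3 * eps / 4 * N) = sg / 4 * (Q + eps / 2 * N) + sg * eps * N / 16 by field.
lra.
Qed.

Lemma segment_ball (R : realType) (d : nat) (n : R) (x xi : 'rV[R]_d) (l t : R) : 0 <= l <= 1 ->
  `|x + (1 - l) *: xi| <= n -> `|x - l *: xi| <= n -> - l <= t <= 1 - l ->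
  `|x + t *: xi| <= n.
Proof.
move=> /andP[l0 l1] h1 h2 /andP[t0 t1].
have -> : x + t *: xi = (t + l) *: (x + (1 - l) *: xi) + (1 - (t + l)) *: (x - l *: xi).
  by apply/rowP => i; rewrite !mxE; ring.
apply: le_trans (ler_normD _ _) _; rewrite !normrZ !ger0_norm ?subr_ge0; [|lra|lra].
have : (t + l) * `|x + (1 - l) *: xi| <= (t + l) * n by apply: ler_wpM2l => //; lra.
have : (1 - (t + l)) * `|x - l *: xi| <= (1 - (t + l)) * n by apply: ler_wpM2l => //; lra.
lra.
Qed.

(* The second derivative along a line of a convex function cannot be negative:
   by continuity it would be bounded away from 0 on a small symmetric segment. *)
Lemma quad_hessian_ge0 (R : realType) (d : nat) (phi : 'rV[R]_d -> R)
    (H : 'rV[R]_d -> 'M[R]_d) :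
  (forall x xi, exists p : R -> R,
    (forall t : R, is_derive t (1 : R) (fun t : R => phi (x + t *: xi)) (p t)) /\
    (forall t : R, is_derive t (1 : R) p (quad (H (x + t *: xi)) xi))) ->
  (forall i j, continuous (fun x => H x i j)) ->
  (forall (l : R) x y, 0 <= l <= 1 ->
    phi (l *: x + (1 - l) *: y) <= l * phi x + (1 - l) * phi y) ->
  forall x xi, 0 <= quad (H x) xi.
Proof.
move=> phiH cH cvx x xi.
rewrite leNgt; apply/negP => neg.
set c := quad (H x) xi in neg.
have N0 := vsq_ge0 xi.
(* With this [eta] the variation of the Hessian costs at most half of [- c], so the second
   derivative stays below [c / 2] on the segment. *)
pose eta := - c / (2 * (d%:R * vsq xi + 1)).
have den0 : 0 < 2 * (d%:R * vsq xi + 1) by rewrite mulr_gt0// ltr_wpDl// mulr_ge0.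
have eta0 : 0 < eta by rewrite divr_gt0// oppr_gt0.
have : \forall r \near 0^'+, forall (ij : 'I_d * 'I_d) y z, `|y| <= `|x| + `|xi| -> `|z| <= `|x| + `|xi| ->
    `|z - y| <= r -> `|H z ij.1 ij.2 - H y ij.1 ij.2| <= eta.
  by apply: filter_forall => ij; exact: unif_continuous_rV.
move=> unifH.
have [r [[rH r0] r1]] := filter_ex (filterI (filterI unifH (nbhs_right_gt 0)) (nbhs_right_le ltr01)).
have xi1 : 0 < `|xi| + 1 by rewrite ltr_wpDl.
pose e := r / (`|xi| + 1).
have e0 : 0 < e by rewrite divr_gt0.
have exi : e * `|xi| <= r by rewrite mulrAC ler_pdivrMr// ler_pM2l// lerDl.
have [p [dp1 dp2]] := phiH x (e *: xi).
have hl : 0 <= (2^-1 : R) <= 1 by apply/andP; split; lra.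
have Hc (t : R) : - 2^-1 <= t <= 1 - 2^-1 ->
    e ^+ 2 * (- c / 2) <= - quad (H (x + t *: (e *: xi))) (e *: xi).
  move=> /andP[t0 t1]; rewrite quadZ -mulrN ler_pM2l ?exprn_gt0//.
  have tle : `|t| <= 1 by rewrite ler_norml; clear -t0 t1; apply/andP; split; lra.
  have zx : `|t *: (e *: xi)| <= r.
    rewrite scalerA normrZ normrM (gtr0_norm e0) -mulrA -[leRHS]mul1r.
    by apply: ler_pM => //; rewrite mulr_ge0// ltW.
  have close i j : `|H x i j - H (x + t *: (e *: xi)) i j| <= eta.
    rewrite distrC; apply: (rH (i, j)); first by rewrite lerDl.
      apply: le_trans (ler_normD _ _) _; rewrite lerD2l scalerA normrZ normrM (gtr0_norm e0).
      have e1 : e <= 1 by rewrite ler_pdivrMr// mul1r (le_trans r1)// lerDr.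
      rewrite -[leRHS]mul1r ler_wpM2r//.
      by rewrite mulr_ile1// ltW.
    by rewrite addrC addKr.
  have := quad_perturb xi close; rewrite -/c.
  have : d%:R * eta * vsq xi <= - c / 2.
    rewrite /eta mulrAC mulrA ler_pdivrMr//.
    have -> : - c / 2 * (2 * (d%:R * vsq xi + 1)) = - c * (d%:R * vsq xi) - c by field.
    by rewrite mulrC; clear -neg; lra.
  by clear; lra.
have T := @line_taylor _ (fun t => - phi (x + t *: (e *: xi))) (fun t => - p t)
   (fun t => - quad (H (x + t *: (e *: xi))) (e *: xi)) (e ^+ 2 * (- c / 2)) (2^-1) hl
   (fun t => is_deriveN (dp1 t)) (fun t => is_deriveN (dp2 t)) Hc.
move: T; have := cvx _ (x + 2^-1 *: (e *: xi)) (x - 2^-1 *: (e *: xi)) hl.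
have -> : 2^-1 *: (x + 2^-1 *: (e *: xi)) + (1 - 2^-1) *: (x - 2^-1 *: (e *: xi)) = x.
  by apply/rowP => i; rewrite !mxE; field.
rewrite (_ : 1 - 2^-1 = 2^-1); last by field.
rewrite scale0r addr0 scaleNr.
have c2 : 0 < e ^+ 2 * (- c / 2) by rewrite mulr_gt0 ?exprn_gt0// divr_gt0// oppr_gt0.
by move: c2; clear; lra.
Qed.

(* Up to the tau term, the right-hand side is twice the midpoint convexity defect
   of (s, y) |-> s phi(y/s) + eps/2 (|y|^2/s + s^2) between (s, s x) and
   (t, t y). Nearby points are handled by a Taylor expansion at z; for distant
   ones the uniform convexity due to eps dominates the tau term. *)
Lemma weighted_midpoint (R : realType) (d : nat) (phi f : 'rV[R]_d -> R)
    (H : 'rV[R]_d -> 'M[R]_d) (n a b eps del : R) (q : 'rV[R]_d -> R) :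
  (forall x xi, exists p : R -> R,
    (forall t : R, is_derive t (1 : R) (fun t : R => phi (x + t *: xi)) (p t)) /\
    (forall t : R, is_derive t (1 : R) p (quad (H (x + t *: xi)) xi))) ->
  (forall i j, continuous (fun x => H x i j)) ->
  (forall (l : R) x y, 0 <= l <= 1 ->
    phi (l *: x + (1 - l) *: y) <= l * phi x + (1 - l) * phi y) ->
  (forall x, differentiable f x) -> (forall i, continuous (partial i f)) ->
  0 < a -> a <= b -> 0 < eps -> 0 < del ->
  (forall x w, `|x| <= n ->
    2 * dot (gradient f x) w - quad (H x) w - eps / 2 * vsq w <= q x) ->
  exists2 tau0 : R, 0 < tau0 & forall tau s t x y, 0 < tau -> tau <= tau0 ->
    a <= s <= b -> a <= t <= b -> `|x| <= n -> `|y| <= n ->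
    let sg := (s + t) / 2 in let z := (s + t)^-1 *: (s *: x + t *: y) in
    - (tau ^+ 2 * (q z + del) / sg) <=
    (s * phi x + t * phi y - 2 * sg * phi z)
    + eps / 2 * (s * vsq x + t * vsq y - 2 * sg * vsq z)
    + eps / 2 * (s ^+ 2 + t ^+ 2 - 2 * sg ^+ 2) - tau * (f x - f y).
Proof.
move=> phiH cH cvx df cdf a0 ab eps0 del0 Hq.
have b0 : 0 < b by exact: lt_le_trans ab.
pose dd : R := d%:R + 1.
have dd0 : 0 < dd by rewrite ltr_wpDl.
(* The first bound gives [8 * eta <= sg * eps], the second makes the error of order [tau ^+ 2] at
   most [tau ^+ 2 * del / sg]. Using [d + 1] for [dd] avoids a zero denominator. *)
pose eta := Num.min (a * eps / 8) (2 * del / (b * dd)).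
have eta0 : 0 < eta.
  by rewrite lt_min !divr_gt0 ?mulr_gt0.
pose etaH := eps / (4 * dd).
have etaH0 : 0 < etaH by rewrite divr_gt0 ?mulr_gt0.
have unifH : \forall r \near 0^'+, forall (ij : 'I_d * 'I_d) y z, `|y| <= n -> `|z| <= n ->
    `|z - y| <= r -> `|H z ij.1 ij.2 - H y ij.1 ij.2| <= etaH.
  by apply: filter_forall => ij; exact: unif_continuous_rV.
have unifG : \forall r \near 0^'+, forall (i : 'I_d) y z, `|y| <= n -> `|z| <= n ->
    `|z - y| <= r -> `|partial i f z - partial i f y| <= eta.
  by apply: filter_forall => i; exact: unif_continuous_rV.
have bdH : \forall M \near +oo, forall (ij : 'I_d * 'I_d) x, `|x| <= n -> `|H x ij.1 ij.2| <= M.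
  by apply: filter_forall => ij; exact: bounded_rV.
have cf : continuous f by move=> x; exact: differentiable_continuous.
have [M [[MH Mf] M0]] := filter_ex (filterI (filterI bdH (bounded_rV n cf)) (nbhs_pinfty_gt (num_real (0 : R)))).
(* Since the Hessian form is at most [d * M * vsq xi], the condition [K * r ^+ 2 <= 4 * a * eps]
   yields the smallness of [Q] that [midpoint_core] asks for. *)
pose K := (d%:R * M + eps) * d%:R + 1.
have K0 : 0 < K by rewrite ltr_wpDl// !(mulr_ge0, addr_ge0)// ltW.
have small : \forall r \near 0^'+, K * r ^+ 2 <= 4 * a * eps.
  pose e1 := 4 * a * eps / K; have e10 : 0 < e1 by rewrite divr_gt0 ?mulr_gt0.
  near=> r; have r0 : 0 < r by near: r; exact: nbhs_right_gt.
  rewrite -ler_pdivlMl// mulrC -/e1 expr2.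
  have r1 : r <= 1 by near: r; exact: nbhs_right_le.
  have r2 : r <= e1 by near: r; exact: nbhs_right_le.
  by apply: le_trans r2; rewrite ger_pMl.
have [r [[[rH rG] rK] r0]] := filter_ex (filterI (filterI (filterI unifH unifG) small) (nbhs_right_gt 0)).
(* Chosen so that [tau0 * (2 * M)] equals the penalty [eps / 2 * (a ^+ 2 / (2 * b) * r ^+ 2)]
   guaranteed for points at distance more than [r]. *)
pose tau0 := eps * a ^+ 2 * r ^+ 2 / (8 * b * M).
exists tau0.
  by rewrite divr_gt0 ?mulr_gt0 ?exprn_gt0.
move=> tau s t x y tau_gt0 tau_le /andP[sa sb] /andP[ta tb] xn yn.
pose sg := (s + t) / 2; pose z : 'rV[R]_d := (s + t)^-1 *: (s *: x + t *: y).
cbv zeta; rewrite -/sg -/z.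
have s0 : 0 < s by exact: lt_le_trans sa.
have t0 : 0 < t by exact: lt_le_trans ta.
have st0 : 0 < s + t by exact: addr_gt0.
have stn0 : s + t != 0 by rewrite gt_eqF.
have sg0 : 0 < sg by exact: divr_gt0.
have sga : a <= sg by rewrite /sg; clear -sa ta; lra.
have sgb : sg <= b by rewrite /sg; clear -sb tb; lra.
have sg2 : 2 * sg = s + t by rewrite /sg; field.
pose l := s / (s + t); pose xi := x - y.
have l01 : 0 <= l <= 1.
  by rewrite /l divr_ge0 ?(ltW s0) ?(ltW st0)//= ler_pdivrMr// mul1r lerDl ltW.
have zi i : z ord0 i = (s * x ord0 i + t * y ord0 i) / (s + t) by rewrite !mxE mulrC.
have xE : x = z + (1 - l) *: xi.
  by apply/rowP => i; rewrite mxE zi !mxE /l; field.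
have yE : y = z - l *: xi.
  by apply/rowP => i; rewrite mxE zi !mxE /l; field.
have segn u : - l <= u <= 1 - l -> `|z + u *: xi| <= n.
  by move=> hu; apply: (segment_ball l01) hu; rewrite -?xE -?yE.
have zn : `|z| <= n.
  have := segn 0; rewrite scale0r addr0; apply.
  by move: l01 => /andP[h1 h2]; clear -h1 h2; apply/andP; split; lra.
pose k := s * t / (s + t).
have kl : (s + t) * (l * (1 - l)) = k by rewrite /l /k; field.
have kE : k = sg / 2 - (s - t) ^+ 2 / (8 * sg).
  by rewrite /k /sg; field.
have A1 : s * phi x + t * phi y - 2 * sg * phi z =
    (s + t) * (l * phi x + (1 - l) * phi y - phi z).
  by rewrite sg2 /l; field.
have A2 : s * vsq x + t * vsq y - 2 * sg * vsq z = k * vsq xi.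
  rewrite sg2 !vsqE !mulr_sumr -big_split -sumrB/=; apply: eq_bigr => i _.
  by rewrite zi !mxE /k; field.
have A3 : s ^+ 2 + t ^+ 2 - 2 * sg ^+ 2 = (s - t) ^+ 2 / 2 by rewrite /sg; field.
have convexT : 0 <= s * phi x + t * phi y - 2 * sg * phi z.
  rewrite A1 mulr_ge0 ?(ltW st0)// subr_ge0 (_ : z = l *: x + (1 - l) *: y); first exact: cvx.
  by apply/rowP => i; rewrite zi !mxE /l; field.
have qz0 : 0 <= q z.
  have := Hq z 0 zn; rewrite -(scale0r (0 : 'rV[R]_d)) dotZr quadZ vsqZ expr0n/= !mul0r !mulr0.
  by rewrite subr0 subr0.
rewrite A2 A3.
have N0 := vsq_ge0 xi.
have [xir|xir] := leP `|xi| r.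
  have Hz i j : `|H z i j| <= M by exact: (MH (i, j)).
  have QN : quad (H z) xi + 3 * eps / 4 * vsq xi <= 4 * sg * eps.
    have Q1 : quad (H z) xi <= d%:R * M * vsq xi.
      have := @quad_perturb _ _ 0 (H z) M xi _; rewrite [quad 0 xi]quadE.
      rewrite (eq_bigr (fun=> 0)); last first.
        by move=> i _; rewrite big1// => j _; rewrite mxE !mul0r.
      rewrite big1// subr_le0; apply=> i j.
      by rewrite mxE sub0r normrN.
    have N1 : vsq xi <= d%:R * r ^+ 2.
      apply: le_trans (vsq_le_norm_sq _) _; rewrite ler_wpM2l//.
      by rewrite lerXn2r ?nnegrE// ltW.
    have : (d%:R * M + eps) * vsq xi <= K * r ^+ 2.
      apply: (@le_trans _ _ ((d%:R * M + eps) * (d%:R * r ^+ 2))).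
        by rewrite ler_wpM2l// addr_ge0 ?mulr_ge0// ltW.
      by rewrite mulrA ler_wpM2r ?sqr_ge0// /K lerDl.
    have : 4 * a * eps <= 4 * sg * eps by rewrite ler_pM2r// ler_pM2l.
    have : 0 <= eps * vsq xi by rewrite mulr_ge0// ltW.
    rewrite mulrDl => h1 h2 h3; clear -h1 h2 h3 Q1 rK; lra.
  have [p [dp1 dp2]] := phiH z xi.
  have T := line_taylor l01 dp1 dp2 (c := quad (H z) xi - eps / 4 * vsq xi).
  have segr u : - l <= u <= 1 - l -> `|(z + u *: xi) - z| <= r.
    move=> /andP[u0 u1]; rewrite addrC addKr normrZ -[leRHS]mul1r; apply: ler_pM => //.
    by move: l01 => /andP[l0 l1]; rewrite ler_norml; clear -l0 l1 u0 u1; apply/andP; split; lra.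
  have {}T : k / 2 * (quad (H z) xi - eps / 4 * vsq xi) <= s * phi x + t * phi y - 2 * sg * phi z.
    rewrite A1 [in leRHS]xE [in leRHS]yE -kl.
    have := T _; rewrite scale0r addr0 scaleNr => T'.
    rewrite (_ : _ * (_ - _) = (s + t) * (l * (1 - l) * (quad (H z) xi - eps / 4 * vsq xi) / 2)); last by field.
    rewrite ler_pM2l//; apply: T' => u hu.
    apply: le_trans _ (@quad_perturb _ _ _ (H z) etaH xi _); last first.
      by move=> i j; apply: (rH (i, j)) => //; [exact: segn|exact: segr].
    rewrite lerD2l lerN2 ler_wpM2r// /etaH.
    rewrite mulrA ler_pdivrMr ?mulr_gt0//.
    have : d%:R * eps <= dd * eps by rewrite ler_pM2r// lerDl.
    by clear; lra.
  have [u hu Fu] := line_mvt z xi l01 df.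
  rewrite -xE -yE in Fu.
  have FE := @dot_perturb _ _ (gradient f (z + u *: xi)) (gradient f z) eta tau xi (ltW tau_gt0) _.
  have {}FE : tau * (f x - f y) <= tau * dot (gradient f z) xi + eta / 2 * vsq xi
      + d%:R * eta * tau ^+ 2 / 2.
    by rewrite Fu; apply: FE => i; rewrite !mxE; apply: rG => //; [exact: segn|exact: segr].
  (* The scale of the test vector is dictated by the defect: after multiplication by [tau ^+ 2 / sg]
     the linear term becomes the tau term and the quadratic one gets the coefficient [sg / 4], the
     main part of [k / 2]. *)
  have P1 := Hq z ((sg / (2 * tau)) *: xi) zn.
  rewrite dotZr quadZ vsqZ in P1.
  have tau2 : 0 < tau ^+ 2 / sg by rewrite divr_gt0// exprn_gt0.
  have {}P1 : tau * dot (gradient f z) xi - sg / 4 * (quad (H z) xi + eps / 2 * vsq xi)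
      <= tau ^+ 2 / sg * q z.
    apply: le_trans _ (ler_wpM2l (ltW tau2) P1); rewrite le_eqVlt; apply/orP; left; apply/eqP.
    by field; rewrite !gt_eqF.
  have EDl : d%:R * eta * tau ^+ 2 / 2 <= tau ^+ 2 / sg * del.
    have eta2 : eta <= 2 * del / (b * dd) by rewrite ge_min lexx orbT.
    rewrite mulrAC [leRHS]mulrAC -[leRHS]mulrA mulrC ler_pM2l ?exprn_gt0//.
    rewrite ler_pdivlMr//.
    apply: (@le_trans _ _ (dd * (2 * del / (b * dd)) / 2 * b)).
      apply: ler_pM => //; [by rewrite !mulr_ge0// ltW|exact: ltW|].
      by rewrite ler_pM2r//; apply: ler_pM => //; [exact: ltW|rewrite lerDl].
    by rewrite le_eqVlt; apply/orP; left; apply/eqP; field; rewrite !gt_eqF.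
  have eta1 : 8 * eta <= sg * eps.
    have : eta <= a * eps / 8 by rewrite ge_min lexx.
    have : a * eps <= sg * eps by rewrite ler_pM2r.
    by clear; lra.
  have := midpoint_core sg0 (sqr_ge0 (s - t)) N0 kE QN eta1 T FE EDl P1.
  by congr (_ <= _); field; rewrite ?gt_eqF.
have kge : a ^+ 2 / (2 * b) <= k.
  rewrite /k ler_pdivlMr// mulrAC ler_pdivrMr ?mulr_gt0//.
  rewrite expr2; apply: ler_pM; rewrite ?mulr_ge0 ?(ltW a0) ?(ltW st0)//.
    by apply: ler_pM => //; exact: ltW.
  by clear -sb tb; lra.
have Nge : r ^+ 2 <= vsq xi.
  apply: le_trans _ (norm_sq_le_vsq xi).
  by rewrite lerXn2r ?nnegrE ?(ltW r0) ?(ltW xir).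
have kN : a ^+ 2 / (2 * b) * r ^+ 2 <= k * vsq xi.
  by apply: ler_pM => //; rewrite ?sqr_ge0 ?divr_ge0 ?sqr_ge0// mulr_ge0// ltW.
have ff : f x - f y <= 2 * M.
  have := Mf x xn; have := Mf y yn; rewrite !ler_norml => /andP[h1 h2] /andP[h3 h4].
  by clear -h1 h2 h3 h4; lra.
have tff : tau * (f x - f y) <= eps / 2 * (a ^+ 2 / (2 * b) * r ^+ 2).
  apply: (@le_trans _ _ (tau0 * (2 * M))).
    apply: (@le_trans _ _ (tau * (2 * M))); first by rewrite ler_pM2l.
    by rewrite ler_pM2r ?mulr_gt0.
  by rewrite le_eqVlt; apply/orP; left; apply/eqP; rewrite /tau0; field; rewrite !gt_eqF.
have lhs : - (tau ^+ 2 * (q z + del) / sg) <= 0.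
  by rewrite oppr_le0 divr_ge0 ?(ltW sg0)// mulr_ge0 ?sqr_ge0// addr_ge0// ltW.
have e1 : eps / 2 * (a ^+ 2 / (2 * b) * r ^+ 2) <= eps / 2 * (k * vsq xi).
  by rewrite ler_pM2l// divr_gt0.
have e2 : 0 <= eps / 2 * ((s - t) ^+ 2 / 2).
  by rewrite mulr_ge0 ?divr_ge0 ?sqr_ge0// ltW.
by clear -convexT tff lhs e1 e2; lra.
Unshelve. all: by end_near. Qed.

Lemma mul_le_midpoint_sq (R : realFieldType) (s t : R) : s * t <= ((s + t) / 2) ^+ 2.
Proof.
rewrite -subr_ge0 (_ : _ - _ = ((s - t) / 2) ^+ 2) ?sqr_ge0//.
by field.
Qed.

Lemma midpoint_itv (R : realFieldType) (a b s t : R) :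
  a <= s <= b -> a <= t <= b -> a <= (s + t) / 2 <= b.
Proof. by move=> /andP[h1 h2] /andP[h3 h4]; apply/andP; split; lra. Qed.

Lemma continuous_sum (R : realType) (T : topologicalType) (I : finType)
    (g : I -> T -> R) :
  (forall i, continuous (g i)) -> continuous (fun x => \sum_i g i x).
Proof.
move=> cg; elim: (index_enum I) => [|i r IH].
  rewrite (_ : (fun x => _) = cst 0); last by apply/funext => x; rewrite big_nil.
  by move=> x; exact: cvg_cst.
rewrite (_ : (fun x => _) = (fun x => g i x + \sum_(j <- r) g j x)); last first.
  by apply/funext => x; rewrite big_cons.
by move=> x; apply: cvgD; [exact: cg|exact: IH].
Qed.

(** Writing the inverse as x (x^2)^-1 leaves only a nonnegative base for the real power; at 0 both
    sides are 0. *)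
Lemma measurable_inv (R : realType) : measurable_fun [set: R] (fun x : R => x^-1).
Proof.
rewrite (_ : (fun x => _) = (fun x : R => x * (x ^+ 2) `^ (-1))).
  apply: measurable_funM => //; apply: (measurableT_comp (measurable_powR _)).
  exact: measurable_funX.
apply/funext => x; rewrite powR_inv1 ?sqr_ge0//.
have [->|x0] := eqVneq x 0; first by rewrite invr0 mul0r.
by field.
Qed.

(** * Variance inequality on truncated cones *)

Section cone_weight.
Context (R : realType) (d : nat).
Notation leb := (@lebesgue_measure R).
Notation nu := (leb \x lebesgue_rV d)%E.
Notation T := (measurableTypeR R * 'rV[R]_d)%type.
Variable phi : 'rV[R]_d -> R.
Hypothesis cphi : continuous phi.

(** In the coordinates (s, s x) this is a convex truncated cone, so the midpoints of
    Prekopa-Leindler stay in it. Keeping s away from 0 and from infinity bounds both s and 1/s. *)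
Definition cone_box (n : nat) : set T :=
  [set p | n.+1%:R^-1 <= p.1 <= n.+1%:R /\ `|p.2| <= n%:R].

(* The term with coefficient eps = 1/(n+1) makes the potential uniformly convex
   in the variables (s, s x). *)
Definition cone_weight (k n : nat) (p : T) : R :=
  \1_(cone_box n) p * (p.1 ^+ k *
    expR (- (p.1 * phi p.2) - n.+1%:R^-1 / 2 * (p.1 * vsq p.2 + p.1 ^+ 2))).

Lemma measurable_snd_continuous (g : 'rV[R]_d -> R) : continuous g ->
  measurable_fun setT (fun p : T => g p.2).
Proof.
move=> cg; apply: (measurableT_comp (continuous_measurable_rV cg)).
exact: measurable_snd.
Qed.

Lemma continuous_vsq : continuous (@vsq R d).
Proof.
rewrite (_ : @vsq R d = fun w => \sum_i w ord0 i * w ord0 i); last exact/funext.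
apply: continuous_sum => i w; apply: continuousM; exact: coord_continuous.
Qed.

Lemma measurable_cone_box n : measurable (cone_box n).
Proof.
rewrite (_ : cone_box n = (fun p : T => p.1) @^-1` `[n.+1%:R^-1, n.+1%:R] `&`
   (fun p : T => `|p.2|) @^-1` `]-oo, n%:R]).
  apply: measurableI; rewrite -[X in measurable X]setTI.
    by apply: measurable_fst => //; exact: measurable_itv.
  apply: (@measurable_snd_continuous (fun x => `|x|)) => //; first exact: norm_continuous.
by apply/seteqP; split => p /=; rewrite !in_itv.
Qed.

Lemma measurable_cone_weight k n : measurable_fun setT (cone_weight k n).
Proof.
apply: measurable_funM; first by apply: measurable_indic; exact: measurable_cone_box.
have m1 : measurable_fun setT (fun p : T => p.1 : R) by exact: measurable_fst.
apply: measurable_funM; first exact: measurable_funX.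
apply: measurableT_comp => //; apply: measurable_funB.
  apply: measurableT_comp => //; apply: measurable_funM => //.
  exact: measurable_snd_continuous.
apply: measurable_funM => //; apply: measurable_funD; last exact: measurable_funX.
by apply: measurable_funM => //; apply: measurable_snd_continuous; exact: continuous_vsq.
Qed.

Lemma cone_weight_gt0 k n p : cone_weight k n p != 0 -> cone_box n p.
Proof.
rewrite /cone_weight indicE; case: (boolP (p \in _)) => [/set_mem//|_].
by rewrite mul0r eqxx.
Qed.

Lemma cone_box_gt0 n p : cone_box n p -> 0 < p.1.
Proof. by move=> [/andP[h _] _]; apply: lt_le_trans h; rewrite invr_gt0. Qed.

Lemma cone_weight_ge0 k n p : 0 <= cone_weight k n p.
Proof.
rewrite /cone_weight indicE; case: (boolP (p \in _)) => [/set_mem/cone_box_gt0 p0|_].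
  by rewrite mul1r mulr_ge0 ?expR_ge0// exprn_ge0// ltW.
by rewrite mul0r.
Qed.

Variables (f : 'rV[R]_d -> R) (H : 'rV[R]_d -> 'M[R]_d).
Hypothesis phiH : forall x xi, exists p : R -> R,
  (forall t : R, is_derive t (1 : R) (fun t : R => phi (x + t *: xi)) (p t)) /\
  (forall t : R, is_derive t (1 : R) p (quad (H (x + t *: xi)) xi)).
Hypothesis cH : forall i j, continuous (fun x => H x i j).
Hypothesis cvx : forall (l : R) x y, 0 <= l <= 1 ->
  phi (l *: x + (1 - l) *: y) <= l * phi x + (1 - l) * phi y.
Hypothesis df : forall x, differentiable f x.
Hypothesis cdf : forall i, continuous (partial i f).

Let cf : continuous f. Proof. by move=> x; exact: differentiable_continuous. Qed.

Lemma wbounded_box k n (g : T -> R) : measurable_fun setT g ->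
  (exists M, forall p, cone_box n p -> `|g p| <= M) ->
  wbounded (cone_weight k n) g.
Proof. by move=> mg [M gM]; split => //; exists M => p /cone_weight_gt0; exact: gM. Qed.

Lemma wbounded_inv k n : wbounded (cone_weight k n) (fun p : T => p.1^-1).
Proof.
apply: wbounded_box; first exact: (measurableT_comp (@measurable_inv R) measurable_fst).
exists n.+1%:R => p pb; have p0 := cone_box_gt0 pb.
rewrite ger0_norm ?invr_ge0 ?(ltW p0)// -[leRHS]invrK lef_pV2 ?posrE ?invr_gt0//.
by case: pb => /andP[].
Qed.

Lemma wbounded_snd k n (g : 'rV[R]_d -> R) : continuous g ->
  wbounded (cone_weight k n) (fun p : T => g p.2).
Proof.
move=> cg; apply: wbounded_box; first exact: measurable_snd_continuous.
have [M HM] := filter_ex (bounded_rV n%:R cg).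
by exists M => p [_ pn]; exact: HM.
Qed.

(** [weighted_midpoint] is precisely the hypothesis of [cone_prekopa_leindler] after taking
    logarithms. Twice the exponent of the third function must be [tau ^+ 2 * (q + del) / s], whence
    the factor 1/2 in [g], which cancels the factor 2 of [variance_le_of_expR]. *)
Lemma cone_variance n (q : 'rV[R]_d -> R) :
  nu.-integrable setT (EFin \o cone_weight (d + d.-1) n) ->
  measurable_fun setT q ->
  (exists M, forall x, `|x| <= n%:R -> `|q x| <= M) ->
  (forall x w, `|x| <= n%:R ->
    2 * dot (gradient f x) w - quad (H x) w - n.+1%:R^-1 / 2 * vsq w <= q x) ->
  wint nu (cone_weight (d + d.-1) n) (cst 1) *
    wint nu (cone_weight (d + d.-1) n) (fun p => f p.2 ^+ 2) -
  wint nu (cone_weight (d + d.-1) n) (fun p => f p.2) ^+ 2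
  <= wint nu (cone_weight (d + d.-1) n) (cst 1) *
    wint nu (cone_weight (d + d.-1) n) (fun p => q p.2 * p.1^-1).
Proof.
set w := cone_weight (d + d.-1) n.
move=> iw mq [Mq qM] Hq.
have w0 : forall p, 0 <= w p by exact: cone_weight_ge0.
have q0 x : `|x| <= n%:R -> 0 <= q x.
  move=> xn; have := Hq x 0 xn; rewrite -(scale0r (0 : 'rV[R]_d)) dotZr quadZ vsqZ expr0n/= !mul0r !mulr0.
  by rewrite !subr0.
have bq : wbounded w (fun p : T => q p.2).
  apply: wbounded_box; first exact: (measurableT_comp mq measurable_snd).
  by exists Mq => p [_ pn]; exact: qM.
have binv : wbounded w (fun p : T => p.1^-1) by exact: wbounded_inv.
have bf : wbounded w (fun p : T => f p.2) by exact: wbounded_snd.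
have bqi : wbounded w (fun p : T => q p.2 * p.1^-1) by exact: wboundedM.
have Z0 : 0 <= wint nu w (cst 1).
  by apply: Rintegral_ge0 => p _; rewrite mulr1.
have I0 : 0 <= wint nu w (fun p : T => p.1^-1).
  apply: Rintegral_ge0 => p _; have [->|wp] := eqVneq (w p) 0; first by rewrite mul0r.
  by rewrite mulr_ge0// invr_ge0 ltW// (cone_box_gt0 (cone_weight_gt0 wp)).
rewrite -subr_le0.
(* This lets the slack [del] tend to 0; its cost is [del] times a fixed integral of 1/s. *)
apply: (le0_of_le_small (t0 := 1) (K := wint nu w (cst 1) * wint nu w (fun p : T => p.1^-1))) => //.
  exact: mulr_ge0.
move=> del /andP[del0 _].
pose g (p : T) := 2^-1 * (q p.2 * p.1^-1 + del * p.1^-1).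
have bg : wbounded w g.
  by apply: wboundedZ; apply: wboundedD => //; exact: wboundedZ.
have Ig : wint nu w g = (wint nu w (fun p : T => q p.2 * p.1^-1) + del * wint nu w (fun p : T => p.1^-1)) / 2.
  rewrite /g (wintZ iw); last by apply: wboundedD => //; exact: wboundedZ.
  by rewrite (wintD iw bqi (wboundedZ _ binv)) (wintZ iw _ binv) mulrC.
have a0 : 0 < n.+1%:R^-1 :> R by rewrite invr_gt0.
have ab : n.+1%:R^-1 <= n.+1%:R :> R.
  by rewrite (@le_trans _ _ 1)// ?invf_le1// ler1n.
have [tau0 tau00 Htau] := weighted_midpoint phiH cH cvx df cdf a0 ab a0 del0 Hq.
have g0 p : w p != 0 -> 0 <= g p.
  move=> /cone_weight_gt0 pb; have p0 := cone_box_gt0 pb; case: pb => _ pn.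
  rewrite /g mulr_ge0// addr_ge0// mulr_ge0 ?invr_ge0 ?(ltW p0) ?(ltW del0)//.
  exact: q0.
rewrite lerBlDl.
suff main : wint nu w (cst 1) * wint nu w (fun p => f p.2 ^+ 2) - wint nu w (fun p => f p.2) ^+ 2
   <= 2 * (wint nu w (cst 1) * wint nu w g).
  apply: le_trans main _; rewrite Ig le_eqVlt; apply/orP; left; apply/eqP.
  by field.
apply: (variance_le_of_expR w0 iw bf bg g0 tau00) => tau tau_gt0 tau_le.
pose u (e : T -> R) (p : T) := (cone_weight d.-1 n p * expR (e p))%:E.
(* From the exponent 2d - 1, [d] powers of s become the Jacobian; the remaining power [d.-1] is
   log-concave in s, by [mul_le_midpoint_sq]. *)
have uE (e : T -> R) : (\int[nu]_p (w p * expR (e p))%:E =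
   \int[nu]_p ((p.1 ^+ d)%:E * u e p))%E.
  apply: eq_integral => p _; rewrite /u -EFinM; congr EFin.
  by rewrite /w /cone_weight exprD; ring.
rewrite (uE (fun p => tau * f p.2)) (uE (fun p => - tau * f p.2)) (uE (fun p => tau ^+ 2 * g p)).
have mu (e : T -> R) : measurable_fun setT e -> measurable_fun setT (u e).
  move=> me; apply/measurable_EFinP; apply: measurable_funM.
    exact: measurable_cone_weight.
  exact: measurableT_comp.
have u0 e p : (0 <= u e p)%E by rewrite lee_fin mulr_ge0 ?expR_ge0 ?cone_weight_ge0.
have un e p : p.1 <= 0 -> u e p = 0%E.
  move=> p0; rewrite /u; have [->|/cone_weight_gt0/cone_box_gt0] := eqVneq (cone_weight d.-1 n p) 0.
    by rewrite mul0r.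
  by rewrite ltNge p0.
have mf := bf.1; have mg := bg.1.
apply: cone_prekopa_leindler => //.
- by apply: mu; exact: measurable_funM.
- by apply: mu; exact: measurable_funM.
- by apply: mu; exact: measurable_funM.
- by move=> p; exact: un.
- by move=> p; exact: un.
- by move=> p; exact: un.
move=> s t x y s0 t0.
have [wx0|] := eqVneq (cone_weight d.-1 n (s, x)) 0.
  by rewrite /u wx0 mul0r mul0e sqre_ge0.
move=> /cone_weight_gt0 sxb.
have [wy0|] := eqVneq (cone_weight d.-1 n (t, y)) 0.
  by rewrite /u wy0 mul0r mule0 sqre_ge0.
move=> /cone_weight_gt0 tyb.
have [/= sI xn] := sxb; have [/= tI yn] := tyb.
have := Htau tau s t x y tau_gt0 tau_le sI tI xn yn; cbv zeta.
set sg := (s + t) / 2; set z := (_ *: _).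
have sg0 : 0 < sg by rewrite divr_gt0// addr_gt0.
have szb : cone_box n (sg, z).
  split => /=.
    exact: midpoint_itv.
  have st0 : 0 < s + t by exact: addr_gt0.
  rewrite /z normrZ gtr0_norm ?invr_gt0// ler_pdivrMl//.
  apply: le_trans (ler_normD _ _) _; rewrite !normrZ !gtr0_norm// mulrDl.
  by apply: lerD; rewrite ler_pM2l.
move=> mid.
have cwE p (k : nat) : cone_box n p -> cone_weight k n p = p.1 ^+ k *
    expR (- (p.1 * phi p.2) - n.+1%:R^-1 / 2 * (p.1 * vsq p.2 + p.1 ^+ 2)).
  by move=> pb; rewrite /cone_weight indicE mem_set// mul1r.
rewrite /u -!EFinM lee_fin (cwE _ _ sxb) (cwE _ _ tyb) (cwE _ _ szb) /=.
set A := expR _; set B := expR _; set C := expR _; set D := expR _.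
set E := expR _; set F := expR _.
rewrite (_ : _ * (t ^+ d.-1 * C * D) = (s * t) ^+ d.-1 * (A * B * C * D)); last first.
  by rewrite exprMn; ring.
rewrite (_ : _ * (sg ^+ d.-1 * E * F) = (sg ^+ 2) ^+ d.-1 * (E * F * E * F)); last first.
  by rewrite -exprM mulnC exprM expr2; ring.
apply: ler_pM.
- by rewrite exprn_ge0// mulr_ge0// ltW.
- by rewrite !mulr_ge0// expR_ge0.
- apply: lerXn2r; rewrite ?nnegrE; [by rewrite mulr_ge0// ltW|exact: sqr_ge0|].
  exact: mul_le_midpoint_sq.
rewrite /A /B /C /D /E /F -!expRD ler_expR -subr_ge0.
move: mid; rewrite -subr_ge0; congr (0 <= _).
rewrite /g /=; set e := _.+1%:R^-1; set qz := q z.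
by field; rewrite gt_eqF.
Qed.

End cone_weight.

(** * The potential exp(V/b) *)

Section potential_calculus.
Context (R : realType) (d : nat).
Implicit Types (g h : 'rV[R]_d -> R).

Lemma of_class_C1M g h : of_class_C 1 g -> of_class_C 1 h -> of_class_C 1 (fun x => g x * h x).
Proof.
move=> [dg cg] [dh ch].
have cgg : continuous g by move=> x; exact: differentiable_continuous.
have chh : continuous h by move=> x; exact: differentiable_continuous.
split => [x|i]; first exact: differentiableM.
rewrite /= (_ : partial i _ = fun x => g x * partial i h x + h x * partial i g x).
  by move=> x; exact: (cvgD (cvgM (cgg x) (ch i x)) (cvgM (chh x) (cg i x))).
by apply/funext => x; rewrite /partial deriveM//; exact: diff_derivable.
Qed.

Lemma of_class_C1V g : (forall x, g x != 0) -> of_class_C 1 g ->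
  of_class_C 1 (fun x => (g x)^-1).
Proof.
move=> g0 [dg cg].
have cgg : continuous g by move=> x; exact: differentiable_continuous.
split => [x|i]; first exact: differentiableV.
rewrite /= (_ : partial i _ = fun x => - ((g x)^-1 * (g x)^-1) * partial i g x).
  move=> x; have ci : {for x, continuous (fun y => (g y)^-1)} := differentiable_continuous (differentiableV (dg x) (g0 x)).
  exact: (cvgM (cvgN (cvgM ci ci)) (cg i x)).
by apply/funext => x; rewrite /partial deriveV// -?invfM -?expr2//; exact: diff_derivable.
Qed.

Lemma partial_ln g i x : 0 < g x -> differentiable g x ->
  differentiable (fun y => ln (g y)) x /\
  partial i (fun y => ln (g y)) x = (g x)^-1 * partial i g x.
Proof.
move=> g0 dg; have dln := is_derive1_ln g0.
have dlng : differentiable (@ln R) (g x) by apply/derivable1_diffP; case: dln.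
have dc : differentiable (@ln R \o g) x by exact: differentiable_comp.
have dlnd : derivable (@ln R) (g x) 1 by case: dln.
split => //; rewrite /partial (deriveE _ dc) (deriveE _ dg) (diff_comp dg dlng) /= (deriv1E dlnd) derive1E.
by case: dln => _ ->; rewrite /GRing.scale/= mulrC.
Qed.

(** Regularity is assumed of the density, so it is transferred through V = - ln rho: the partial
    derivatives of V are those of rho times - rho^-1, and rho never vanishes. *)
Lemma of_class_C2_potential (V : 'rV[R]_d -> R) :
  of_class_C 2 (fun x => expR (- V x)) -> of_class_C 2 V.
Proof.
set rho := (fun x => _) => -[drho crho].
have rho0 x : 0 < rho x by exact: expR_gt0.
have VE : V = fun x => - ln (rho x).
  by apply/funext => x; rewrite /rho expRK opprK.
have dV x : differentiable V x.
  rewrite VE; apply: differentiableN.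
  have [//|i] := pselect (differentiable (fun y => ln (rho y)) x).
  case: i; have dln := is_derive1_ln (rho0 x).
  apply: (differentiable_comp (g := @ln R)) => //.
  by apply/derivable1_diffP; case: dln.
split; first exact: dV.
move=> i.
rewrite (_ : partial i V = fun x => (- (rho x)^-1) * partial i rho x); last first.
  apply/funext => x; have [dl pl] := partial_ln i (rho0 x) (drho x).
  rewrite VE /partial deriveN; last exact: diff_derivable.
  by rewrite mulNr -pl.
apply: of_class_C1M; last exact: crho.
rewrite (_ : (fun x => _) = fun x => (- rho x)^-1); last first.
  by apply/funext => x; rewrite invrN.
apply: of_class_C1V; first by move=> x; rewrite oppr_eq0 gt_eqF.
split => [x|j]; first exact: differentiableN.
rewrite /= (_ : partial j _ = fun x => - partial j rho x).
  move=> x; have [dr _] := crho j.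
  exact: (cvgN (differentiable_continuous (dr x))).
by apply/funext => x; rewrite /partial deriveN//; exact: diff_derivable.
Qed.

End potential_calculus.

Section cone_potential.
Context (R : realType) (d : nat).
Variables (V : 'rV[R]_d -> R) (b : R).
Hypothesis b0 : 0 < b.
Hypothesis V_C2 : of_class_C 2 V.

Let phi x := expR (V x / b).

(* The Hessian of exp(V/b). *)
Definition cone_hessian x : 'M[R]_d :=
  (expR (V x / b) / b) *: (hessian V x + b^-1 *: tensor (gradient V x) (gradient V x)).

Let dV x : differentiable V x. Proof. by have [] := V_C2. Qed.
Let dpV i x : differentiable (partial i V) x.
Proof. by have [_ /(_ i) []] := V_C2. Qed.

Lemma quad_tensor (u w : 'rV[R]_d) : quad (tensor u u) w = dot u w ^+ 2.
Proof.
rewrite quadE expr2 /dot mulr_suml; apply: eq_bigr => i _.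
rewrite mulr_sumr; apply: eq_bigr => j _.
by rewrite /tensor mxE big_ord1 !mxE; ring.
Qed.

Lemma quadD (A B : 'M[R]_d) w : quad (A + B) w = quad A w + quad B w.
Proof.
rewrite !quadE -big_split; apply: eq_bigr => i _ /=; rewrite -big_split.
by apply: eq_bigr => j _ /=; rewrite mxE !mulrDl.
Qed.

Lemma quad_scale (c : R) (A : 'M[R]_d) w : quad (c *: A) w = c * quad A w.
Proof.
rewrite !quadE mulr_sumr; apply: eq_bigr => i _; rewrite mulr_sumr.
by apply: eq_bigr => j _; rewrite mxE !mulrA.
Qed.

Lemma line_derive2 x xi (t : R) :
  is_derive t (1 : R) (fun t : R => dot (gradient V (x + t *: xi)) xi)
    (quad (hessian V (x + t *: xi)) xi).
Proof.
have -> : (fun t : R => dot (gradient V (x + t *: xi)) xi) =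
    \sum_(i < d) (fun t : R => xi ord0 i * partial i V (x + t *: xi)).
  apply/funext => u; rewrite fct_sumE /dot; apply: eq_bigr => i _.
  by rewrite mxE mulrC.
apply: is_derive_eq.
  apply: is_derive_sum => i.
  apply: (is_deriveZ (xi ord0 i)); exact: line_derive.
rewrite quadE exchange_big; apply: eq_bigr => i _ /=.
rewrite /dot /GRing.scale/= mulr_sumr; apply: eq_bigr => j _.
by rewrite !mxE; ring.
Qed.

(** Along a line, phi'' = (phi/b) (V'' + V'^2/b): the square of the first derivative is the origin
    of the tensor term. *)
Lemma cone_potential_line x xi : exists p : R -> R,
  (forall t : R, is_derive t (1 : R) (fun t : R => phi (x + t *: xi)) (p t)) /\
  (forall t : R, is_derive t (1 : R) p (quad (cone_hessian (x + t *: xi)) xi)).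
Proof.
pose v' (t : R) := dot (gradient V (x + t *: xi)) xi.
pose p (t : R) := phi (x + t *: xi) * (v' t / b).
have dphi (t : R) : is_derive t (1 : R) (fun t : R => phi (x + t *: xi)) (p t).
  apply: (@is_derive1_comp _ (@expR R) (fun t => V (x + t *: xi) / b)).
  have h := line_derive x xi t dV.
  rewrite (_ : (fun _ => _) = b^-1 *: (fun t : R => V (x + t *: xi))); last first.
    by apply/funext => u /=; rewrite mulrC.
  by apply: is_derive_eq; rewrite mulrC.
exists p; split => // t.
have h := line_derive2 x xi t.
have dv' : is_derive t (1 : R) (fun t : R => v' t / b) (quad (hessian V (x + t *: xi)) xi / b).
  rewrite (_ : (fun _ => _) = b^-1 *: v'); last by apply/funext => u /=; rewrite mulrC.
  by apply: is_derive_eq; rewrite mulrC.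
have dphit := dphi t.
apply: is_derive_eq.
rewrite /cone_hessian quad_scale quadD quad_scale quad_tensor -/(v' t) /p /phi /GRing.scale/=.
by field; rewrite gt_eqF.
Qed.

Lemma continuous_cone_potential : continuous phi.
Proof.
move=> x; have cV : {for x, continuous V} by exact: differentiable_continuous.
apply: (@continuous_comp _ _ _ (fun x => V x / b) expR); last exact: continuous_expR.
exact: (cvgM cV (cvg_cst _)).
Qed.

Lemma continuous_cone_hessian i j : continuous (fun x => cone_hessian x i j).
Proof.
rewrite (_ : (fun x => _) = fun x => phi x / b * (partial i (partial j V) x +
  b^-1 * (partial i V x * partial j V x))); last first.
  by apply/funext => x; rewrite /cone_hessian !mxE big_ord1 !mxE.
move=> x.
have ci k : {for x, continuous (partial k V)} by exact: differentiable_continuous.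
have cij : {for x, continuous (partial i (partial j V))}.
  by have [_ /(_ j) [_ /(_ i) h]] := V_C2; exact: h.
have cp : {for x, continuous phi} by exact: continuous_cone_potential.
exact: (cvgM (cvgM cp (cvg_cst _)) (cvgD cij (cvgM (cvg_cst _) (cvgM (ci i) (ci j))))).
Qed.

Lemma convex_cone_potential : convex_function [set: 'rV[R]_d] V ->
  forall (l : R) x y, 0 <= l <= 1 ->
    phi (l *: x + (1 - l) *: y) <= l * phi x + (1 - l) * phi y.
Proof.
move=> cV l x y /andP[l0 l1].
have h := cV (Itv01 l0 l1) x y; rewrite !inE in h.
have {}h := h I I.
have e := convex_expR (Itv01 l0 l1) (V x / b) (V y / b).
apply: le_trans e; rewrite ler_expR.
have -> : conv (Itv01 l0 l1) (V x / b : R^o) (V y / b : R^o) =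
   (l * V x + (1 - l) * V y) / b.
  by rewrite convRE /= /unstable.onem; ring.
by rewrite ler_pM2r ?invr_gt0.
Qed.

End cone_potential.

(** * Integrating out the radial variable *)

Section gamma.
Context (R : realType) (c : R).
Hypothesis c0 : 0 < c.
Notation leb := (@lebesgue_measure R).

(* Antiderivative of s^n e^(-cs), by repeated integration by parts. *)
Fixpoint gamma_primitive (n : nat) (s : R) : R :=
  if n is n'.+1 then
    n%:R / c * gamma_primitive n' s - s ^+ n * expR (- (s * c)) / c
  else - expR (- (s * c)) / c.

Lemma is_derive_gamma_primitive n (s : R) :
  is_derive s (1 : R) (gamma_primitive n) (s ^+ n * expR (- (s * c))).
Proof.
have dexp : is_derive s (1 : R) (fun s => expR (- (s * c))) (- c * expR (- (s * c))).
  rewrite mulrC; apply: (@is_derive1_comp _ (@expR R) (fun s => - (s * c))).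
  rewrite (_ : (fun s => _) = - c *: (id : R -> R)); last first.
    by apply/funext => u; rewrite -[RHS]/(- c * u); ring.
  by apply: is_derive_eq; rewrite /GRing.scale/= mulr1.
elim: n => [|n IH] /=.
  rewrite (_ : (fun s => _) = - c^-1 *: (fun s => expR (- (s * c)))); last first.
    by apply/funext => u; rewrite -[RHS]/(- c^-1 * expR (- (u * c))); ring.
  by apply: is_derive_eq; rewrite /GRing.scale/= expr0; field; rewrite gt_eqF.
rewrite (_ : (fun s => _) = (n.+1%:R / c) *: gamma_primitive n -
   c^-1 *: ((@GRing.exp R ^~ n.+1) * (fun s => expR (- (s * c))))); last first.
  apply/funext => u.
  rewrite -[RHS]/(n.+1%:R / c * gamma_primitive n u - c^-1 * (u ^+ n.+1 * expR (- (u * c)))).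
  ring.
have dpow : is_derive s (1 : R) (@GRing.exp R ^~ n.+1) (n.+1%:R * s ^+ n).
  apply: DeriveDef; first exact: exprn_derivable.
  by rewrite -derive1E exp_derive1.
apply: (is_derive_eq (is_deriveB (is_deriveZ _ IH) (is_deriveZ _ (is_deriveM dpow dexp)))).
by rewrite /GRing.scale/= exprS; field; rewrite gt_eqF.
Qed.

Lemma gamma_primitive0 n : gamma_primitive n 0 = - (n`!%:R / c ^+ n.+1).
Proof.
elim: n => [|n IH] /=; first by rewrite mul0r oppr0 expR0 fact0 expr1 mulNr.
rewrite IH expr0n/= mul0r mul0r subr0 factS natrM !exprS.
by field; rewrite expf_neq0 gt_eqF.
Qed.

Lemma cvg_gamma_primitive n : gamma_primitive n s @[s --> +oo] --> 0.
Proof.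
have cvg0 k : s ^+ k * expR (- (s * c)) @[s --> +oo] --> 0.
  (* From e^x >= x^(k+1)/(k+1)! at x = s c, the function is at most [K / s]. *)
  pose K : R := k.+1`!%:R / c ^+ k.+1.
  apply: (@squeeze_cvgr _ _ _ _ (cst 0) (fun s => K * s^-1)); last 2 first.
  - exact: cvg_cst.
  - rewrite -[X in _ --> X](mulr0 K); apply: cvgM; first exact: cvg_cst.
    by apply/(@gtr0_cvgV0 _ _ _ _ id); [exact: nbhs_pinfty_gt|exact: cvg_id].
  near=> s.
  have s0 : 0 < s by near: s; exact: nbhs_pinfty_gt.
  rewrite mulr_ge0 ?expR_ge0 ?exprn_ge0 ?(ltW s0)//=.
  have sc0 : 0 < s * c by exact: mulr_gt0.
  have := expR_ge1Dxn k (ltW sc0) => h.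
  have {}h : (s * c) ^+ k.+1 / k.+1`!%:R <= expR (s * c) by apply: le_trans h; rewrite lerDr.
  rewrite expRN -ler_pdivlMr ?invr_gt0 ?expR_gt0// invrK.
  have f0 : 0 < k.+1`!%:R :> R by rewrite ltr0n fact_gt0.
  have K0 : 0 < K / s by rewrite !divr_gt0// exprn_gt0.
  rewrite -ler_pdivrMl//; apply: le_trans h.
  rewrite le_eqVlt; apply/orP; left; apply/eqP.
  have cn0 : c ^+ k.+1 != 0 by rewrite expf_neq0// gt_eqF.
  rewrite /K exprMn [s ^+ k.+1]exprS; move: cn0 f0; move: (c ^+ _) (_%:R) => C F C0 F0.
  by field; rewrite C0 !gt_eqF.
elim: n => [|n IH] /=.
  have h := cvg0 0%N.
  rewrite (_ : (fun s => _) = (fun s => - c^-1 * (s ^+ 0 * expR (- (s * c))))); last first.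
    by apply/funext => s; rewrite expr0 mul1r; field; rewrite gt_eqF.
  rewrite -[X in _ --> X](mulr0 (- c^-1)); apply: cvgM; [exact: cvg_cst|exact: h].
rewrite -[X in _ --> X](_ : n.+1%:R / c * 0 - 0 / c = 0); last by rewrite mulr0 mul0r subr0.
apply: cvgB; apply: cvgM; [exact: cvg_cst|exact: IH|exact: cvg0|exact: cvg_cst].
Unshelve. all: by end_near. Qed.

Lemma integral_gamma n :
  (\int[leb]_(s in `]0%R, +oo[) (s ^+ n * expR (- (s * c)))%:E = (n`!%:R / c ^+ n.+1)%:E)%E.
Proof.
have cF : continuous (fun s : R => s ^+ n * expR (- (s * c))).
  move=> s; apply: (@continuousM _ _ (fun s : R => s ^+ n)); first exact: exprn_continuous.
  apply: (@continuous_comp _ _ _ (fun s : R => - (s * c)) expR); last exact: continuous_expR.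
  exact: (cvgN (cvgM cvg_id (cvg_cst _))).
rewrite integral_itv_obnd_cbnd; last first.
  apply/measurable_EFinP; apply: measurable_funTS.
  exact: continuous_measurable_fun.
rewrite (@ge0_continuous_FTC2y _ _ (gamma_primitive n) _ 0).
- by rewrite gamma_primitive0 EFinN oppeK add0e.
- by move=> s s0; rewrite mulr_ge0 ?expR_ge0// exprn_ge0.
- exact: continuous_subspaceT.
- exact: cvg_gamma_primitive.
- by move=> s _; case: (is_derive_gamma_primitive n s).
- apply/cvg_at_right_filter.
  have [+ _] := is_derive_gamma_primitive n 0.
  by move=> /derivable1_diffP/differentiable_continuous.
- by move=> s _; rewrite derive1E; case: (is_derive_gamma_primitive n s).
Qed.
End gamma.

Import HBNNSimple.

(** The density is given on sets; simple functions and monotone convergence extend it to nonnegative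
    functions. *)
Lemma ge0_integral_density (dT : measure_display) (T : measurableType dT) (R : realType)
    (mu nu : {measure set T -> \bar R}) (rho : T -> R) (k : T -> \bar R) :
  measurable_fun setT rho -> (forall x, 0 <= rho x) ->
  (forall A, measurable A -> mu A = (\int[nu]_(x in A) (rho x)%:E)%E) ->
  measurable_fun setT k -> (forall x, (0 <= k x)%E) ->
  (\int[mu]_x k x = \int[nu]_x (k x * (rho x)%:E))%E.
Proof.
move=> mrho rho0 muE mk k0.
have mrhoE : measurable_fun setT (EFin \o rho) by exact/measurable_EFinP.
pose h := nnsfun_approx measurableT mk.
have cvgh x : (h n x)%:E @[n --> \oo] --> k x by exact: cvg_nnsfun_approx.
have mh n : measurable_fun setT (EFin \o h n) by exact/measurable_EFinP.
have ndh x : {homo (fun n => (h n x)%:E) : m n / (m <= n)%N >-> (m <= n)%E}.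
  by move=> a b ab; rewrite lee_fin; exact/lefP/nd_nnsfun_approx.
have -> : (\int[mu]_x k x = limn (fun n => \int[mu]_x (h n x)%:E))%E.
  rewrite -monotone_convergence//; last by move=> n x _; rewrite lee_fin.
  by apply: eq_integral => x _; apply/esym/cvg_lim.
have -> : (\int[nu]_x (k x * (rho x)%:E) = limn (fun n => \int[nu]_x ((h n x)%:E * (rho x)%:E)))%E.
  rewrite -monotone_convergence//.
  - apply: eq_integral => x _; apply/esym/cvg_lim => //.
    by apply: cvgeZr.
  - by move=> n; exact: (emeasurable_funM (mh n) mrhoE).
  - by move=> n x _; rewrite mule_ge0 ?lee_fin.
  - by move=> x _ a b ab; rewrite lee_wpmul2r ?lee_fin// -lee_fin; exact: ndh.
congr (limn _); apply/funext => n.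
transitivity (\int[mu]_x (\sum_(y \in range (h n)) (y * \1_(h n @^-1` [set y]) x)%:E))%E.
  by apply: eq_integral => t _; rewrite /= fimfunE -fsumEFin.
have indich r : measurable_fun setT (fun x => (r * \1_(h n @^-1` [set r]) x)%:E).
  by apply/measurable_EFinP; exact: measurable_funM.
rewrite ge0_integral_fsum//; last by move=> m y _; exact: nnfun_muleindic_ge0.
transitivity (\int[nu]_x (\sum_(y \in range (h n))
    (y * \1_(h n @^-1` [set y]) x)%:E * (rho x)%:E))%E; last first.
  apply: eq_integral => x _.
  rewrite -ge0_mule_fsuml => [|y]; last exact: nnfun_muleindic_ge0.
  by rewrite fsumEFin // -(fimfunE _ x).
rewrite ge0_integral_fsum//; last 2 first.
  - by move=> y; exact: (emeasurable_funM (indich y) mrhoE).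
  - by move=> m y _; apply: mule_ge0; [exact: nnfun_muleindic_ge0|rewrite lee_fin].
apply: eq_fsbigr => r rhn.
have r0 : 0 <= r by move: rhn; rewrite inE => -[t _ <-].
under eq_integral do rewrite EFinM.
rewrite integralZl_indic_nnsfun => //.
under [RHS]eq_integral do rewrite EFinM -muleA.
rewrite ge0_integralZl//; last 2 first.
- apply: (emeasurable_funM _ mrhoE); apply/measurable_EFinP.
  exact: measurable_indic.
- by move=> t _; rewrite mule_ge0 ?lee_fin.
congr (_ * _)%E; rewrite integral_indic// setIT muE// integral_mkcond.
apply: eq_integral => x _; rewrite patchE indicE.
by case: (boolP (x \in _)) => _; rewrite ?mul1e ?mul0e.
Qed.

Section cone_marginal.
Context (R : realType) (d : nat).
Notation leb := (@lebesgue_measure R).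
Notation nu := (leb \x lebesgue_rV d)%E.
Notation T := (measurableTypeR R * 'rV[R]_d)%type.
Variable phi : 'rV[R]_d -> R.
Hypothesis cphi : continuous phi.
Hypothesis phi0 : forall x, 0 < phi x.

(** The limit of [cone_weight] once the box fills the half-space s > 0 and the penalty disappears;
    the lifted measure is the case n = 2d - 1. *)
Definition cone_limit (n : nat) (p : T) : R :=
  \1_(`]0%R, +oo[%classic : set R) p.1 * (p.1 ^+ n * expR (- (p.1 * phi p.2))).

Lemma cone_limit_ge0 n p : 0 <= cone_limit n p.
Proof.
rewrite /cone_limit indicE; case: (boolP (p.1 \in _)) => [|_]; last by rewrite mul0r.
rewrite inE/= in_itv/= andbT => p0.
by rewrite mul1r mulr_ge0 ?expR_ge0// exprn_ge0// ltW.
Qed.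

Lemma measurable_cone_limit n : measurable_fun setT (cone_limit n).
Proof.
have m1 : measurable_fun setT (fun p : T => p.1 : R) by exact: measurable_fst.
apply: measurable_funM.
  have mI : measurable (`]0%R, +oo[%classic : set R) by exact: measurable_itv.
  exact: (measurableT_comp (measurable_indic mI) m1).
apply: measurable_funM; first exact: measurable_funX.
apply: measurableT_comp => //; apply: measurableT_comp => //; apply: measurable_funM => //.
exact: measurable_snd_continuous.
Qed.

Lemma cone_limit_marginal n (K : 'rV[R]_d -> \bar R) :
  measurable_fun setT K -> (forall x, (0 <= K x)%E) ->
  (\int[nu]_p ((cone_limit n p)%:E * K p.2) =
   \int[lebesgue_rV d]_x ((n`!%:R / phi x ^+ n.+1)%:E * K x))%E.
Proof.
move=> mK K0.
have mF : measurable_fun setT (fun p : T => (cone_limit n p)%:E * K p.2)%E.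
  apply: emeasurable_funM; first by apply/measurable_EFinP; exact: measurable_cone_limit.
  exact: (measurableT_comp mK measurable_snd).
have F0 p : (0 <= (cone_limit n p)%:E * K p.2)%E.
  by rewrite mule_ge0// lee_fin cone_limit_ge0.
rewrite (fubini_tonelli2 _ mF F0); apply: eq_integral => x _; rewrite /fubini_G/=.
rewrite ge0_integralZr//; last 2 first.
- apply/measurable_EFinP; apply: (measurableT_comp (measurable_cone_limit n)).
  exact: measurable_pair2.
- by move=> s _; rewrite lee_fin cone_limit_ge0.
congr (_ * _)%E; rewrite -integral_gamma// [RHS]integral_mkcond.
apply: eq_integral => s _; rewrite patchE /cone_limit indicE/=.
by case: (boolP (s \in _)) => _; rewrite ?mul1r ?mul0r.
Qed.

End cone_marginal.

(** * Monotone exhaustion of the cone *)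

Section cone_limits.
Context (R : realType) (d : nat).
Notation T := (measurableTypeR R * 'rV[R]_d)%type.
Variable phi : 'rV[R]_d -> R.

Let boxE k n (p : T) : cone_box n p -> cone_weight phi k n p = p.1 ^+ k *
    expR (- (p.1 * phi p.2) - n.+1%:R^-1 / 2 * (p.1 * vsq p.2 + p.1 ^+ 2)).
Proof. by move=> pb; rewrite /cone_weight indicE mem_set// mul1r. Qed.

Let limitE k (p : T) : 0 < p.1 :> R ->
  cone_limit phi k p = p.1 ^+ k * expR (- (p.1 * phi p.2)).
Proof.
by move=> p0; rewrite /cone_limit indicE mem_set ?mul1r//= in_itv/= p0.
Qed.

Let pen_ge0 (p : T) : 0 < p.1 :> R -> 0 <= p.1 * vsq p.2 + p.1 ^+ 2.
Proof. by move=> p0; rewrite addr_ge0 ?sqr_ge0// mulr_ge0 ?vsq_ge0// ltW. Qed.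

Lemma cone_box_le m n : (m <= n)%N -> cone_box m `<=` @cone_box R d n.
Proof.
move=> mn p [/andP[h1 h2] h3]; split; last by rewrite (le_trans h3)// ler_nat.
apply/andP; split; last by rewrite (le_trans h2)// ler_nat.
by rewrite (le_trans _ h1)// lef_pV2 ?posrE// ler_nat.
Qed.

(** Enlarging the box and shrinking the penalty coefficient both increase the weight, because the
    penalty is nonnegative for s > 0. *)
Lemma cone_weight_nd k (p : T) : nondecreasing_seq (cone_weight phi k ^~ p).
Proof.
move=> m n mn /=.
have [->|/cone_weight_gt0 pm] := eqVneq (cone_weight phi k m p) 0.
  exact: cone_weight_ge0.
have p0 := cone_box_gt0 pm.
rewrite boxE// boxE; last exact: cone_box_le pm.
rewrite ler_wpM2l ?exprn_ge0 ?(ltW p0)// ler_expR lerD2l lerN2.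
by rewrite ler_wpM2r ?pen_ge0// ler_wpM2r// lef_pV2 ?posrE// ler_nat.
Qed.

Lemma cone_weight_le_limit k n (p : T) : cone_weight phi k n p <= cone_limit phi k p.
Proof.
have [->|/cone_weight_gt0 pm] := eqVneq (cone_weight phi k n p) 0.
  exact: cone_limit_ge0.
have p0 := cone_box_gt0 pm.
rewrite boxE// limitE//.
rewrite ler_wpM2l ?exprn_ge0 ?(ltW p0)// ler_expR gerDl oppr_le0.
by rewrite mulr_ge0 ?pen_ge0// divr_ge0// invr_ge0.
Qed.

Lemma cone_weight_cvg k (p : T) :
  cone_weight phi k n p @[n --> \oo] --> cone_limit phi k p.
Proof.
have [p0|p0] := leP (p.1 : R) 0.
  rewrite (_ : cone_limit phi k p = 0); last first.
    by rewrite /cone_limit indicE memNset ?mul0r//= in_itv/= ltNge p0.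
  rewrite (_ : (fun n => _) = cst 0); first exact: cvg_cst.
  apply/funext => n; apply/eqP; apply: contraT => /cone_weight_gt0/cone_box_gt0.
  by rewrite ltNge p0.
pose A := p.1 * vsq p.2 + p.1 ^+ 2.
have cv : p.1 ^+ k * expR (- (p.1 * phi p.2) - n.+1%:R^-1 / 2 * A) @[n --> \oo] -->
    cone_limit phi k p.
  rewrite limitE//; apply: cvgM; first exact: cvg_cst.
  apply: continuous_cvg; first exact: continuous_expR.
  rewrite -[X in _ --> X](_ : - (p.1 * phi p.2) - 0 / 2 * A = _); last by rewrite !mul0r subr0.
  apply: cvgB; first exact: cvg_cst.
  by apply: cvgM; [apply: cvgM; [exact: cvg_harmonic|exact: cvg_cst]|exact: cvg_cst].
apply: cvg_trans cv; apply: near_eq_cvg; near=> n.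
rewrite boxE//; split.
  apply/andP; split.
    rewrite -[leRHS]invrK lef_pV2 ?posrE ?invr_gt0//.
    by apply: (@le_trans _ _ n%:R); [near: n; exact: nbhs_infty_ger|rewrite ler_nat].
  by apply: (@le_trans _ _ n%:R); [near: n; exact: nbhs_infty_ger|rewrite ler_nat].
by near: n; exact: nbhs_infty_ger.
Unshelve. all: by end_near. Qed.

(** The factor 1/s of the variance bound lowers the exponent from 2d - 1 to 2d - 2, hence produces
    one more factor phi after integration in s. *)
Lemma cone_limit_div k (p : T) : cone_limit phi k.+1 p * (p.1 : R)^-1 = cone_limit phi k p.
Proof.
rewrite /cone_limit indicE; case: (boolP (p.1 \in _)) => [|_]; last by rewrite !mul0r.
rewrite inE/= in_itv/= andbT => p0.
by rewrite !mul1r exprSr -!mulrA; congr (_ * _); rewrite mulrCA mulfV ?mulr1// gt_eqF.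
Qed.

End cone_limits.

(** The factor [g] measures how far the marginal is from [mu]: it is 1 for the exponent 2d - 1 and
    phi for 2d - 2. *)
Lemma cone_limit_density (R : realType) (d : nat) (phi rho g : 'rV[R]_d -> R)
    (mu : {measure set 'rV[R]_d -> \bar R}) (n : nat) (K : 'rV[R]_d -> \bar R) :
  continuous phi -> (forall x, 0 < phi x) ->
  measurable_fun setT rho -> (forall x, 0 <= rho x) -> has_density mu rho ->
  measurable_fun setT g -> (forall x, 0 <= g x) ->
  (forall x, (phi x ^+ n.+1)^-1 = g x * rho x) ->
  measurable_fun setT K -> (forall x, (0 <= K x)%E) ->
  (\int[lebesgue_measure \x lebesgue_rV d]_p ((cone_limit phi n p)%:E * K p.2) =
   (n`!%:R)%:E * \int[mu]_x ((g x)%:E * K x))%E.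
Proof.
move=> cphi phi0 mrho rho0 muE mg g0 phiE mK K0.
have mgE : measurable_fun setT (EFin \o g) by exact/measurable_EFinP.
have mrhoE : measurable_fun setT (EFin \o rho) by exact/measurable_EFinP.
have mgK : measurable_fun setT (fun x => (g x)%:E * K x)%E by exact: (emeasurable_funM mgE mK).
have gK0 x : (0 <= (g x)%:E * K x)%E by rewrite mule_ge0// lee_fin.
rewrite (cone_limit_marginal cphi phi0 n mK K0).
rewrite (ge0_integral_density mrho rho0 muE mgK gK0) -ge0_integralZl//.
- by apply: eq_integral => x _; rewrite phiE EFinM EFinM -!muleA [((rho x)%:E * _)%E]muleC.
- exact: (emeasurable_funM mgK mrhoE).
- by move=> x _; rewrite mule_ge0// lee_fin.
Qed.

(** Here [c] is the total mass of the lifted weight, so the assumed inequality reads c^2 Var(f) <= c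
    C. Square integrability is needed before the variance can be expanded. *)
Lemma variance_marginal (d1 d2 : measure_display) (T : measurableType d1)
    (X : measurableType d2) (R : realType) (nu : {measure set T -> \bar R})
    (mu : probability X R) (W : T -> R) (pi : T -> X) (f : X -> R) (c C : R) :
  measurable_fun setT W -> (forall p, 0 <= W p) -> measurable_fun setT pi ->
  0 < c ->
  (forall K : X -> \bar R, measurable_fun setT K -> (forall x, (0 <= K x)%E) ->
    (\int[nu]_p ((W p)%:E * K (pi p)) = c%:E * \int[mu]_x K x)%E) ->
  measurable_fun setT f ->
  nu.-integrable setT (EFin \o (fun p => W p * f (pi p) ^+ 2)) ->
  wint nu W (cst 1) * wint nu W (fun p => f (pi p) ^+ 2) - wint nu W (f \o pi) ^+ 2
    <= wint nu W (cst 1) * C ->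
  ('V_mu[f] <= (C / c)%:E)%E.
Proof.
move=> mW W0 mpi c0 WE mf iWf2 hC.
have W1 : wint nu W (cst 1) = c.
  have : (\int[nu]_p (W p * 1)%:E = c%:E)%E.
    under eq_integral do rewrite EFinM.
    have -> : (\int[nu]_p ((W p)%:E * 1%:E) = \int[nu]_p ((W p)%:E * cst 1%E (pi p)))%E by [].
    rewrite (WE (cst 1%E)) ?integral_cst ?mul1e//.
    by rewrite -[RHS]mule1; congr (_ * _)%E; exact: (probability_setT mu).
  by rewrite /wint /Rintegral => ->.
have mf2 : measurable_fun setT (fun x => (f x ^+ 2)%:E).
  by apply/measurable_EFinP; exact: measurable_funX.
have f20 x : (0 <= (f x ^+ 2)%:E)%E by rewrite lee_fin sqr_ge0.
have W2E : (\int[nu]_p (W p * f (pi p) ^+ 2)%:E = c%:E * \int[mu]_x (f x ^+ 2)%:E)%E.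
  by rewrite -WE//; apply: eq_integral => p _; rewrite EFinM.
have F2fin : (\int[mu]_x (f x ^+ 2)%:E < +oo)%E.
  have : (\int[nu]_p (W p * f (pi p) ^+ 2)%:E < +oo)%E.
    have /integrableP[mWf] := iWf2; apply: le_lt_trans; apply: ge0_le_integral => //.
    - by move=> p _; rewrite lee_fin mulr_ge0 ?sqr_ge0.
    - exact: measurableT_comp.
    - by move=> p _; rewrite lee_fin ler_norm.
  rewrite W2E; case: (\int[mu]_x _)%E => [r| |]; rewrite ?ltry ?ltNyr//.
  by rewrite gt0_muley ?lte_fin.
have F2num : (\int[mu]_x (f x ^+ 2)%:E)%E \is a fin_num.
  by rewrite ge0_fin_numE// integral_ge0.
have f_L2 : f \in Lfun mu 2%:E.
  rewrite inE/=; apply/andP; split; first by rewrite inE.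
  rewrite inE/= /finite_norm unlock /Lnorm poweR_lty//.
  rewrite (eq_integral (fun x => (f x ^+ 2)%:E))// => x _.
  by rewrite /= powR_mulrn// -normrX ger0_norm ?sqr_ge0.
have if1 : mu.-integrable setT (EFin \o f).
  by apply/Lfun1_integrable; exact: (Lfun_subset12 (fin_num_measure _ _ measurableT) f_L2).
have F1num : (\int[mu]_x (f x)%:E)%E \is a fin_num by exact: integrable_fin_num.
have mfE : measurable_fun setT (EFin \o f) by exact/measurable_EFinP.
(* The marginal identity is available for nonnegative functions, so it is applied to the positive
   and negative parts of [f]. *)
have W1E : (\int[nu]_p (W p * f (pi p))%:E = c%:E * \int[mu]_x (f x)%:E)%E.
  rewrite integralE [in RHS]integralE muleBr//; last first.
    apply: fin_num_adde_defr; apply: integrable_fin_num => //.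
    exact: integrable_funepos.
  rewrite -!WE//; try by [exact: measurable_funepos|exact: measurable_funeneg].
  congr (_ - _)%E; apply: eq_integral => p _.
    by rewrite !funeposE EFinM maxe_pMr ?mule0 ?lee_fin.
  by rewrite !funenegE EFinM -muleN maxe_pMr ?mule0 ?lee_fin.
rewrite varianceE// unlock.
have -> : (\int[mu]_x ((f ^+ 2) x)%:E = \int[mu]_x (f x ^+ 2)%:E)%E by [].
move: W2E W1E hC; rewrite W1 /wint /Rintegral => -> ->.
rewrite -(fineK F2num) -(fineK F1num) -!EFinM/= -EFinB lee_fin.
move: (fine _) (fine _) => F2 F1.
rewrite ler_pdivlMr// => h.
rewrite -(ler_pM2l c0); move: h; lra.
Qed.

(** * The dual quadratic form and its regularisation *)

Section inv_quad_fields.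
Context (R : realType) (d : nat).
Variables (g : 'rV[R]_d -> 'rV[R]_d) (H : 'rV[R]_d -> 'M[R]_d).
Hypothesis cg : forall i, continuous (fun x => g x ord0 i).

Let F e w x : R := 2 * dot (g x) w - quad (H x) w - e * vsq w.

Section measurability.
Hypothesis cH : forall i j, continuous (fun x => H x i j).

Let continuous_scaler (a : 'rV[R]_d -> R) c : continuous a -> continuous (fun x => a x * c).
Proof. by move=> ca x; exact: (cvgMr_tmp (ca x)). Qed.

Let continuous_F e w : continuous (F e w).
Proof.
have c1 : continuous (fun x => dot (g x) w).
  by apply: continuous_sum => i; exact: continuous_scaler _ _ (@cg i).
have c2 : continuous (fun x => quad (H x) w).
  rewrite (_ : (fun x => _) = fun x => \sum_i \sum_j H x i j * w ord0 j * w ord0 i).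
    apply: continuous_sum => i; apply: continuous_sum => j.
    apply: (@continuous_scaler (fun x => H x i j * w ord0 j)).
    exact: continuous_scaler _ _ (@cH i j).
  by apply/funext => x; rewrite quadE.
move=> x; exact: (cvgB (cvgB (cvgMl_tmp (c1 x)) (c2 x)) (cvg_cst _)).
Qed.

Lemma measurable_sup_quad e : measurable_fun setT (fun x =>
  ereal_sup [set (2 * dot (g x) w - quad (H x) w - e * vsq w)%:E | w in setT]).
Proof. exact: (measurable_sup_continuous_rV (@continuous_F e)). Qed.

Lemma measurable_inv_quad : measurable_fun setT (fun x => inv_quad (H x) (g x)).
Proof.
rewrite (_ : (fun x => _) = (fun x => ereal_sup
    [set (2 * dot (g x) w - quad (H x) w - 0 * vsq w)%:E | w in setT])).
  exact: measurable_sup_quad.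
apply/funext => x; rewrite /inv_quad.
by under [in RHS]eq_fun do rewrite mul0r subr0.
Qed.

End measurability.

Lemma inv_quad_ge0 (A : 'M[R]_d) v : (0 <= inv_quad A v)%E.
Proof.
apply: ereal_sup_ubound; exists 0 => //=; congr (_%:E).
by rewrite -/(quad A 0) -(scale0r (0 : 'rV[R]_d)) quadZ dotZr expr2 !mul0r mulr0 subr0.
Qed.

Hypothesis H0 : forall x w, 0 <= quad (H x) w.
Variable e : R.
Hypothesis e0 : 0 < e.

(** The dual form of [H x] plus [e] times the identity. For positive semi-definite [H x] it is at
    most [vsq (g x) / e], so [fine] takes a genuine real value and the function is bounded on
    balls. *)
Definition reg_inv_quad x : R := fine
  (ereal_sup [set (2 * dot (g x) w - quad (H x) w - e * vsq w)%:E | w in setT]).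

Let sup_le x : (ereal_sup [set (F e w x)%:E | w in setT] <= (vsq (g x) / e)%:E)%E.
Proof.
apply: ge_ereal_sup => _ [w _ <-]; rewrite lee_fin ler_pdivlMr// /F.
have h : 0 <= vsq (g x) - 2 * e * dot (g x) w + e ^+ 2 * vsq w.
  have -> : vsq (g x) - 2 * e * dot (g x) w + e ^+ 2 * vsq w = vsq (g x - e *: w).
    rewrite /vsq /dot !mulr_sumr -sumrN -!big_split/=.
    by apply: eq_bigr => i _; rewrite !mxE; ring.
  exact: vsq_ge0.
have := mulr_ge0 (H0 x w) (ltW e0); lra.
Qed.

Let sup_ge w x : ((F e w x)%:E <= ereal_sup [set (F e w x)%:E | w in setT])%E.
Proof. by apply: ereal_sup_ubound; exists w. Qed.

Let F0 x : F e 0 x = 0.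
Proof.
rewrite /F -(scale0r (0 : 'rV[R]_d)) quadZ dotZr vsqZ; ring.
Qed.

Let sup_fin x : ereal_sup [set (F e w x)%:E | w in setT] \is a fin_num.
Proof.
have := sup_ge 0 x; rewrite F0 => s0; rewrite ge0_fin_numE//.
by apply: le_lt_trans (sup_le x) _; rewrite ltry.
Qed.

Lemma reg_inv_quad_ge w x : 2 * dot (g x) w - quad (H x) w - e * vsq w <= reg_inv_quad x.
Proof. by rewrite -lee_fin /reg_inv_quad fineK ?sup_fin//; exact: sup_ge. Qed.

Lemma reg_inv_quad_ge0 x : 0 <= reg_inv_quad x.
Proof. by have := reg_inv_quad_ge 0 x; rewrite -/(F e 0 x) F0. Qed.

Lemma reg_inv_quad_le_vsq x : reg_inv_quad x <= vsq (g x) / e.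
Proof. by rewrite -lee_fin /reg_inv_quad fineK ?sup_fin//; exact: sup_le. Qed.

Lemma reg_inv_quad_le x : ((reg_inv_quad x)%:E <= inv_quad (H x) (g x))%E.
Proof.
rewrite /reg_inv_quad fineK ?sup_fin//; apply: ge_ereal_sup => _ [w _ <-].
apply: (@le_trans _ _ (2 * dot (g x) w - quad (H x) w)%:E); last first.
  by apply: ereal_sup_ubound; exists w.
by rewrite lee_fin gerBl mulr_ge0 ?vsq_ge0// ltW.
Qed.

Lemma measurable_reg_inv_quad : (forall i j, continuous (fun x => H x i j)) ->
  measurable_fun setT reg_inv_quad.
Proof.
by move=> cH; apply: measurableT_comp => //; exact: measurable_sup_quad.
Qed.

Lemma reg_inv_quad_bounded n : exists M, forall x, `|x| <= n -> `|reg_inv_quad x| <= M.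
Proof.
have cv : continuous (fun x => vsq (g x)).
  by apply: continuous_sum => i x; exact: (cvgM (@cg i x) (@cg i x)).
have cve : continuous (fun x => vsq (g x) / e) by move=> x; exact: (cvgMr_tmp (cv x)).
have [M HM] := filter_ex (bounded_rV n cve).
exists M => x xn; rewrite ger0_norm ?reg_inv_quad_ge0//.
by rewrite (le_trans (reg_inv_quad_le_vsq x))// (le_trans _ (HM x xn))// ler_norm.
Qed.

End inv_quad_fields.

(** Multiplying a matrix by [c] divides its inverse by [c]; on suprema this is the substitution of
    [c *: w] for [w]. *)
Lemma inv_quad_scale (R : realType) (d : nat) (A : 'M[R]_d) v c : 0 < c ->
  (c%:E * inv_quad (c *: A) v <= inv_quad A v)%E.
Proof.
move=> c0; rewrite muleC -lee_pdivlMr//; apply: ge_ereal_sup => _ [w _ <-].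
rewrite lee_pdivlMr// -EFinM; apply: ereal_sup_ubound; exists (c *: w) => //.
by congr (_%:E); rewrite -!/(quad _ _) dotZr quadZ quad_scale; ring.
Qed.

(** Domination by the limit weight gives a bound that does not depend on [n], as the exhaustion
    argument requires. *)
Lemma wint_cone_weight_le (R : realType) (d k n : nat) (phi q : 'rV[R]_d -> R) (B : R) :
  continuous phi -> measurable_fun setT q -> (forall x, 0 <= q x) ->
  (\int[lebesgue_measure \x lebesgue_rV d]_p ((cone_limit phi k p)%:E * (q p.2)%:E)
    <= B%:E)%E ->
  wint (lebesgue_measure \x lebesgue_rV d)%E (cone_weight phi k.+1 n)
    (fun p => q p.2 * (p.1 : R)^-1) <= B.
Proof.
move=> cphi mq q0 hB.
have mq2 : measurable_fun setT (fun p : measurableTypeR R * 'rV[R]_d => q p.2).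
  exact: (measurableT_comp mq measurable_snd).
have u0 (p : measurableTypeR R * 'rV[R]_d) :
    0 <= cone_weight phi k.+1 n p * (q p.2 * (p.1 : R)^-1).
  have [->|/cone_weight_gt0/cone_box_gt0 p0] := eqVneq (cone_weight phi k.+1 n p) 0.
    by rewrite mul0r.
  by rewrite mulr_ge0 ?cone_weight_ge0// mulr_ge0// invr_ge0 ltW.
have u1 (p : measurableTypeR R * 'rV[R]_d) :
    cone_weight phi k.+1 n p * (q p.2 * (p.1 : R)^-1) <= cone_limit phi k p * q p.2.
  have [->|/cone_weight_gt0/cone_box_gt0 p0] := eqVneq (cone_weight phi k.+1 n p) 0.
    by rewrite mul0r mulr_ge0// cone_limit_ge0.
  rewrite -cone_limit_div mulrCA [leRHS]mulrC ler_wpM2l// ler_wpM2r ?invr_ge0 ?(ltW p0)//.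
  exact: cone_weight_le_limit.
have : (\int[lebesgue_measure \x lebesgue_rV d]_p
    (cone_weight phi k.+1 n p * (q p.2 * (p.1 : R)^-1))%:E <= B%:E)%E.
  apply: le_trans hB; apply: ge0_le_integral => //.
  - by move=> p _; rewrite lee_fin.
  - apply/measurable_EFinP/measurable_funM; first exact: measurable_cone_weight.
    by apply: measurable_funM => //; apply: (measurableT_comp (@measurable_inv R)); exact: measurable_fst.
  - apply: emeasurable_funM; apply/measurable_EFinP => //.
    exact: measurable_cone_limit.
  - by move=> p _; rewrite -EFinM lee_fin.
have : (0 <= \int[lebesgue_measure \x lebesgue_rV d]_p
    (cone_weight phi k.+1 n p * (q p.2 * (p.1 : R)^-1))%:E)%E.
  by apply: integral_ge0 => p _; rewrite lee_fin.
rewrite /wint /Rintegral; case: (\int[_]_p _)%E => [s| |]//=.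
Qed.

(** * Return from the cone to the measure mu *)

Theorem corollary3p2 (R : realType) (d : nat) (d_gt0 : (0 < d)%N)
    (V : 'rV[R]_d -> R) (mu : probability 'rV[R]_d R)
    (mu_density : has_density mu (fun x => expR (- V x)))
    (density_smooth : smooth (fun x => expR (- V x)))
    (V_convex : convex_function [set: 'rV[R]_d] V)
    (f : 'rV[R]_d -> R) (f_C1 : of_class_C 1 f) :
  ('V_mu[f] <= 2%:E * \int[mu]_x
     inv_quad (hessian V x
                 + (2 * d%:R)^-1 *: tensor (gradient V x) (gradient V x))%R
              (gradient f x))%E.
Proof.
pose b : R := 2 * d%:R.
have b0 : 0 < b by rewrite mulr_gt0// ltr0n.
(* [k] is 2d - 2, the exponent left after the division by s; thus b = k + 2 and phi^(k+2) = e^V. *)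
have [k Nk] : exists k, (d + d.-1 = k.+1)%N.
  by exists (d.-1 + d.-1)%N; rewrite -addSn prednK.
have bk : b = k.+2%:R by rewrite -Nk -addnS prednK// addnn -mul2n natrM.
have V_C2 := of_class_C2_potential (density_smooth 2%N).
pose phi x := expR (V x / b).
have phi0 x : 0 < phi x by exact: expR_gt0.
have cphi : continuous phi by exact: continuous_cone_potential.
have mphi := continuous_measurable_rV cphi.
pose rho x := expR (- V x).
have mrho : measurable_fun setT rho by exact: (continuous_measurable_rV (density_smooth 0%N)).
have rho0 x : 0 <= rho x by exact: expR_ge0.
have phiN x : phi x ^+ k.+2 = expR (V x).
  by rewrite /phi -expRM_natl -bk; congr expR; rewrite mulrC divfK// gt_eqF.
pose M x := hessian V x + (2 * d%:R)^-1 *: tensor (gradient V x) (gradient V x).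
pose Q x := inv_quad (M x) (gradient f x).
pose H := cone_hessian V b.
have HM x : H x = (phi x / b) *: M x by [].
have cf i : continuous (fun x => gradient f x ord0 i).
  rewrite (_ : (fun x => _) = partial i f); first by have [_] := f_C1; exact.
  by apply/funext => x; rewrite mxE.
have cH i j : continuous (fun x => H x i j) by exact: (continuous_cone_hessian V_C2).
have phiH := cone_potential_line b0 V_C2.
have cvx := convex_cone_potential b0 V_convex.
have H0 x w : 0 <= quad (H x) w by exact: (quad_hessian_ge0 phiH cH cvx).
have Q0 x : (0 <= Q x)%E by exact: inv_quad_ge0.
have mQ : measurable_fun setT Q.
  apply: measurable_inv_quad => //.
  (* Continuity of the entries of [M] is read off from that of [H], dividing by the positive
     continuous factor [phi / b]. *)
  move=> i j; rewrite (_ : (fun x => _) = fun x => b * (phi x)^-1 * H x i j).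
    move=> x; apply: (cvgM (cvgMl_tmp (cvgV (lt0r_neq0 (phi0 x)) (cphi x))) (@cH i j x)).
  apply/funext => x; have -> : H x i j = phi x / b * M x i j by rewrite HM [LHS]mxE.
  rewrite mulrA -[LHS]mul1r; congr (_ * _).
  by rewrite mulrA divfK ?mulfV ?gt_eqF.
have [Qoo|Qoo] := eqVneq (\int[mu]_x Q x)%E +oo%E.
  by rewrite Qoo gt0_muley ?lte_fin// leey.
have Qfin : (\int[mu]_x Q x)%E \is a fin_num.
  by rewrite ge0_fin_numE ?integral_ge0// lt_neqAle Qoo leey.
rewrite -(fineK Qfin); set r := fine _.
have r0 : 0 <= r by rewrite fine_ge0// integral_ge0.
(* The regularisation is eps/2 with eps = 1/(n+1), the coefficient used in [cone_weight] at stage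
   [n]. *)
pose q n := reg_inv_quad (gradient f) H (n.+1%:R^-1 / 2).
have e0 n : 0 < n.+1%:R^-1 / 2 :> R by rewrite divr_gt0// invr_gt0.
have mq n : measurable_fun setT (q n) by exact: measurable_reg_inv_quad.
have q0 n x : 0 <= q n x by exact: reg_inv_quad_ge0.
(* The dual form of [H = (phi / b) M] is b/phi times that of [M]; the factor phi from the radial
   integration cancels the denominator. *)
have qQ n x : ((phi x)%:E * (q n x)%:E <= b%:E * Q x)%E.
  have c0 : 0 < phi x / b by rewrite divr_gt0.
  have := inv_quad_scale (M x) (gradient f x) c0; rewrite -HM => h.
  have -> : (phi x)%:E = (b%:E * (phi x / b)%:E)%E.
    by rewrite -EFinM mulrC divfK// gt_eqF.
  rewrite -muleA lee_pmul2l ?lte_fin//.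
  apply: le_trans h; rewrite lee_pmul2l ?lte_fin//; exact: reg_inv_quad_le.
have limN (K : 'rV[R]_d -> \bar R) : measurable_fun setT K -> (forall x, (0 <= K x)%E) ->
    (\int[lebesgue_measure \x lebesgue_rV d]_p ((cone_limit phi (d + d.-1) p)%:E * K p.2) =
     ((d + d.-1)`!%:R)%:E * \int[mu]_x K x)%E.
  move=> mK K0.
  rewrite (@cone_limit_density _ _ phi rho (cst 1) mu _ K)//; last first.
    by move=> x; rewrite Nk phiN mul1r /rho expRN.
  by congr (_ * _)%E; apply: eq_integral => x _; rewrite mul1e.
have limk n : (\int[lebesgue_measure \x lebesgue_rV d]_p ((cone_limit phi k p)%:E * (q n p.2)%:E)
    <= (k`!%:R * (b * r))%:E)%E.
  have mqE : measurable_fun setT (EFin \o q n) by exact/measurable_EFinP.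
  rewrite (cone_limit_density cphi phi0 mrho rho0 mu_density mphi
    (fun x => ltW (phi0 x)) _ mqE (fun x => q0 n x : (0 <= (q n x)%:E)%E)); last first.
    by move=> x; rewrite /rho expRN -phiN [phi x ^+ k.+2]exprS invfM mulrA mulfV ?mul1r// gt_eqF.
  rewrite EFinM lee_wpmul2l ?lee_fin// EFinM /r fineK// -ge0_integralZl//; last first.
    by rewrite lee_fin ltW.
  apply: ge0_le_integral => //.
  - by move=> x _; rewrite -EFinM lee_fin mulr_ge0 ?q0// ltW.
  - by apply: emeasurable_funM => //; exact/measurable_EFinP.
  - exact: measurable_funeM.
  - by move=> x _; exact: qQ.
have lim1 : (\int[lebesgue_measure \x lebesgue_rV d]_p (cone_limit phi (d + d.-1) p)%:E =
    ((d + d.-1)`!%:R)%:E)%E.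
  have := limN (cst 1%E) (measurable_cst _) (fun=> lee01).
  under eq_integral do rewrite mule1.
  move=> ->; rewrite integral_cst// mul1e -[RHS]mule1; congr (_ * _)%E.
  exact: (probability_setT mu).
have iN : (lebesgue_measure \x lebesgue_rV d)%E.-integrable setT
    (EFin \o cone_limit phi (d + d.-1)).
  apply/integrableP; split; first by apply/measurable_EFinP; exact: measurable_cone_limit.
  rewrite (eq_integral (fun p => (cone_limit phi (d + d.-1) p)%:E)); first by rewrite lim1 ltry.
  by move=> p _; rewrite /= ger0_norm// cone_limit_ge0.
have iw n : (lebesgue_measure \x lebesgue_rV d)%E.-integrable setT
    (EFin \o cone_weight phi (d + d.-1) n).
  apply: le_integrable iN => //; first by apply/measurable_EFinP; exact: measurable_cone_weight.
  move=> p _; rewrite lee_fin !ger0_norm ?cone_limit_ge0 ?cone_weight_ge0//.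
  exact: cone_weight_le_limit.
have [df cdf] := f_C1.
have cfun : continuous f by move=> x; exact: differentiable_continuous.
have Nfact0 : 0 < (d + d.-1)`!%:R :> R by rewrite ltr0n fact_gt0.
have wint1 : wint (lebesgue_measure \x lebesgue_rV d)%E (cone_limit phi (d + d.-1)) (cst 1)
    = (d + d.-1)`!%:R.
  by rewrite /wint /Rintegral; under eq_integral do rewrite mulr1; rewrite lim1.
pose w n := cone_weight phi (d + d.-1) n.
have step n : wint (lebesgue_measure \x lebesgue_rV d)%E (w n) (cst 1) *
      wint (lebesgue_measure \x lebesgue_rV d)%E (w n) (fun p => f p.2 ^+ 2) -
      wint (lebesgue_measure \x lebesgue_rV d)%E (w n) (fun p => f p.2) ^+ 2 <=
    wint (lebesgue_measure \x lebesgue_rV d)%E (w n) (cst 1) * (k`!%:R * (b * r)).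
  apply: le_trans (cone_variance cphi phiH cH cvx df cdf (iw n) (mq n)
    (reg_inv_quad_bounded cf H0 (e0 n) n%:R) _) _.
    by move=> x v _; exact: reg_inv_quad_ge.
  rewrite ler_wpM2l//.
    by apply: Rintegral_ge0 => p _; rewrite mulr1 cone_weight_ge0.
  rewrite Nk; exact: (wint_cone_weight_le n cphi (mq n) (q0 n) (limk n)).
have [if2 var] := variance_le_exhaustion (fun n => measurable_cone_weight cphi (d + d.-1) n)
  (@cone_weight_ge0 _ _ phi (d + d.-1)) (cone_weight_le_limit phi (d + d.-1))
  (@cone_weight_nd _ _ phi (d + d.-1)) (@cone_weight_cvg _ _ phi (d + d.-1)) iN
  (fun n => wbounded_snd phi (d + d.-1) n cfun) (eq_ind_r (fun z => 0 < z) Nfact0 wint1) step.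
apply: le_trans (variance_marginal (measurable_cone_limit cphi _) (cone_limit_ge0 phi _)
  measurable_snd Nfact0 limN (continuous_measurable_rV cfun) if2 var) _.
(* What remains is (k + 2) k! <= 2 (k + 1)!, that is 2d/(2d - 1) <= 2, with equality for d = 1. *)
rewrite -EFinM lee_fin ler_pdivrMr// Nk factS natrM bk.
have -> : 2 * r * (k.+1%:R * k`!%:R) = k`!%:R * (2 * k.+1%:R * r) by ring.
rewrite ler_wpM2l// ler_wpM2r// -natrM ler_nat.
by rewrite mul2n -addnn !addSn ltnS addnS ltnS leq_addr.
Qed.
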